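(* Let $A$ be a relative DGA over $\mathcal O$ and let $\epsilon$ be a relative augmentation of $A$. The homomorphism of double complexes $$\sigma:\mathbf{Bar}_{simp}(A/\mathcal O,\epsilon)\to \mathbf{Bar}(A/\mathcal O,\epsilon),$$ which sends, for each $n\ge 0$ and each sequence of integers $\alpha=(\alpha_0<\cdots<\alpha_n)$, the summand $Bar^{\alpha}_{simp}=A\otimes_{\mathcal O}\cdots\otimes_{\mathcal O}A$ ($n$ factors) identically onto $Bar_n=A\otimes_{\mathcal O}\cdots\otimes_{\mathcal O}A$ ($n$ factors), is a quasi-isomorphism (i.e. it induces a quasi-isomorphism of the associated simple complexes).
   Context: Let $k$ be a field of characteristic zero; $\otimes$ without subscript is over $k$. $S$ is a split reductive group over $k$ (all irreducible representations over $k$ are absolutely irreducible) and $\mathcal O$ is its coordinate ring, with the Hopf algebra structure for which left (right) $\mathcal O$-comodules are left (right) algebraic representations of $S$. For $\alpha\in \mathrm{Irr}(S)$ (isomorphism classes of irreducible representations) $V^\alpha$ is a representative and ${}^\alpha V$ its dual, a right representation; $\mathcal O=\bigoplus_\alpha V^\alpha\otimes{}^\alpha V$ as bicomodule. For a right comodule $M$ and a left comodule $N$ the cotensor product is $M\otimes_{\mathcal O}N=\ker(\Delta_M\otimes 1-1\otimes\Delta_N: M\otimes N\to M\otimes\mathcal O\otimes N)$. A relative DGA over $\mathcal O$ is a complex $A$ of $k$-vector spaces with commuting coassociative counitary left and right $\mathcal O$-coactions that are homomorphisms of complexes, a homomorphism $i:\mathcal O\to A$ of complexes of bicomodules, and an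 associative homomorphism $\mu:A\otimes_{\mathcal O}A\to A$ of complexes of bicomodules (written $x\otimes y\mapsto xy$), such that $i$ is a two-sided unit: the composites $A=\mathcal O\otimes_{\mathcal O}A\to A\otimes_{\mathcal O}A\to A$ and $A=A\otimes_{\mathcal O}\mathcal O\to A\otimes_{\mathcal O}A\to A$ are the identity. One has $A=\bigoplus_{\alpha,\beta}V^\alpha\otimes A^{\alpha\beta}\otimes{}^\beta V$ with $A^{\alpha\beta}=Hom_{\mathcal O}(V^\alpha,A\otimes_{\mathcal O}V^\beta)$, and $\mu$ is given by maps $A^{\alpha\beta}\otimes A^{\beta\gamma}\to A^{\alpha\gamma}$, $i$ by elements $1_\alpha\in A^{\alpha\alpha}$. A relative augmentation is a homomorphism $\epsilon:A\to Hom_k(\mathcal O,\mathcal O):=\bigoplus_{\alpha,\beta}V^\alpha\otimes Hom_k(V^\alpha,V^\beta)\otimes{}^\beta V$ (placed in degree $0$) of complexes of bicomodules, given by maps $\epsilon:A^{\alpha\beta}\to Hom_k(V^\alpha,V^\beta)$ with $\epsilon(xy)=\epsilon(y)\circ\epsilon(x)$ and $\epsilon(1_\alpha)=\mathrm{id}$. It induces the right and left augmentations $\epsilon^r,\epsilon^l:A\to\mathcal O$: for $v\otimes a\otimes w\in V^\alpha\otimes A^{\alpha\beta}\otimes{}^\beta V$, $\epsilon^r(v\otimes a\otimes w)=\epsilon(a)(v)\otimes w\in V^\beta\otimes{}^\beta V$ and $\epsilon^l(v\otimes a\otimes w)=v\otimes(w\circ\epsilon(a))\in V^\alpha\otimes{}^\alpha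 V$. $\mathbf{Bar}(A/\mathcal O,\epsilon)$ is the double complex $\cdots\to Bar_n\to\cdots\to Bar_1\to Bar_0\to 0$ with $Bar_0=\mathcal O$, $Bar_n=A\otimes_{\mathcal O}\cdots\otimes_{\mathcal O}A$ ($n$ factors), and outer differential $x_1\otimes\cdots\otimes x_n\mapsto \epsilon^r(x_1)\otimes x_2\otimes\cdots\otimes x_n+\sum_{i=1}^{n-1}(-1)^ix_1\otimes\cdots\otimes x_ix_{i+1}\otimes\cdots\otimes x_n+(-1)^nx_1\otimes\cdots\otimes\epsilon^l(x_n)$ (using $\mathcal O\otimes_{\mathcal O}A=A=A\otimes_{\mathcal O}\mathcal O$). $\mathbf{Bar}_{simp}(A/\mathcal O,\epsilon)$ is the double complex with $\mathbf{Bar}_{simp,n}=\bigoplus_{\alpha_0<\cdots<\alpha_n}Bar^{\alpha}_{simp}$ (sum over strictly increasing sequences of integers), $Bar^\alpha_{simp}=A\otimes_{\mathcal O}\cdots\otimes_{\mathcal O}A$ ($n$ factors; $\mathcal O$ if $n=0$), and outer differential $\sum_{\alpha}\sum_{i=0}^n(-1)^i\partial_{\alpha,i}$, where $\partial_{\alpha,i}:Bar^\alpha_{simp}\to Bar_{simp}^{(\alpha_0<\cdots<\widehat{\alpha_i}<\cdots<\alpha_n)}$ is: for $i=0$, apply $\epsilon^r$ to $x_1$; for $0<i<n$, multiply $x_i$ and $x_{i+1}$; for $i=n$, apply $\epsilon^l$ to $x_n$ ($n\ge1$). The associated simple complexes are $Bar(A/\mathcal O,\epsilon)$ and $Bar_{simp}(A/\mathcal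 O,\epsilon)$. *)

(* Defs.v *)
From HB Require Import structures.
From mathcomp Require Import all_boot all_order all_algebra.
From mathcomp Require Import all_classical.

Set Implicit Arguments.
Unset Strict Implicit.
Unset Printing Implicit Defensive.

Import GRing.Theory.
Local Open Scope ring_scope.
Local Open Scope quotient_scope.

Section LinearHelpers.
Context {k : fieldType}.
Implicit Types U V W : lmodType k.

Definition mklin U V (f : U -> V) (hf : linear f) : {linear U -> V} :=
  HB.pack_for {linear U -> V} f (GRing.isLinear.Build _ _ _ _ f hf).

Definition lcomp U V W (g : {linear V -> W}) (f : {linear U -> V}) :
  {linear U -> W} := g \o f.

Lemma lcompE U V W (g : {linear V -> W}) (f : {linear U -> V}) x :
  lcomp g f x = g (f x).
Proof. by []. Qed.

Definition lid U : {linear U -> U} := idfun.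

Definition ladd U V (f g : {linear U -> V}) : {linear U -> V} := f \+ g.

Definition lscale U V (a : k) (f : {linear U -> V}) : {linear U -> V} := a \*: f.

Lemma laddE U V (f g : {linear U -> V}) x : ladd f g x = f x + g x.
Proof. by []. Qed.

Lemma lscaleE U V a (f : {linear U -> V}) x : lscale a f x = a *: f x.
Proof. by []. Qed.

(* The alternating sum f 0 - f 1 + ... + (-1)^n f n. *)
Fixpoint lalt U V (n : nat) (f : nat -> {linear U -> V}) : {linear U -> V} :=
  if n is n'.+1 then ladd (lalt n' f) (lscale ((-1) ^+ n) (f n)) else f 0%N.

Definition bilin U V W (f : U -> V -> W) : Prop :=
  (forall v, linear (f^~ v)) /\ (forall u, linear (f u)).

End LinearHelpers.

Notation "g ∘ f" := (lcomp g f) (at level 50, left associativity).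

(* The tensor product over k: formal sums of pairs, two of them being
   identified when every bilinear map into every vector space identifies them. *)
Section Tensor.
Context {k : fieldType}.
Section Def.
Variables U V : lmodType k.

Definition formal_eval (W : lmodType k) (f : U -> V -> W) (s : seq (U * V)) : W :=
  \sum_(p <- s) f p.1 p.2.

Definition tensor_rel : rel (seq (U * V)) := fun s t =>
  `[< forall (W : lmodType k) (f : U -> V -> W),
      bilin f -> formal_eval f s = formal_eval f t >].

Lemma tensor_rel_refl : reflexive tensor_rel.
Proof. by move=> s; apply/asboolP. Qed.

Lemma tensor_rel_sym : symmetric tensor_rel.
Proof. by move=> s t; apply/asboolP/asboolP=> h W f hf; rewrite (h W f hf). Qed.

Lemma tensor_rel_trans : transitive tensor_rel.
Proof.
move=> t s u /asboolP h1 /asboolP h2; apply/asboolP => W f hf.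
by rewrite (h1 W f hf) (h2 W f hf).
Qed.

Canonical tensor_equiv :=
  EquivRel tensor_rel tensor_rel_refl tensor_rel_sym tensor_rel_trans.

Definition tensor := {eq_quot tensor_equiv}.

HB.instance Definition _ := Choice.on tensor.
HB.instance Definition _ := EqQuotient.on tensor.

Lemma tensor_piP (s t : seq (U * V)) :
  (forall (W : lmodType k) (f : U -> V -> W),
      bilin f -> formal_eval f s = formal_eval f t) ->
  \pi_tensor s = \pi_tensor t.
Proof. by move=> h; apply/eqmodP/asboolP. Qed.

Lemma formal_eval_repr (W : lmodType k) (f : U -> V -> W) s :
  bilin f -> formal_eval f (repr (\pi_tensor s)) = formal_eval f s.
Proof.
move=> hf.
have : repr (\pi_tensor s) = s %[mod tensor] by rewrite reprK.
by move/eqmodP/asboolP => /(_ W f hf).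
Qed.

Lemma formal_eval_cat (W : lmodType k) (f : U -> V -> W) s t :
  formal_eval f (s ++ t) = formal_eval f s + formal_eval f t.
Proof. by rewrite /formal_eval big_cat. Qed.

Definition formal_scale (a : k) (s : seq (U * V)) : seq (U * V) :=
  [seq (a *: p.1, p.2) | p <- s].

Lemma bilinZl (W : lmodType k) (f : U -> V -> W) a u v :
  bilin f -> f (a *: u) v = a *: f u v.
Proof. by case=> h _; exact: (linearZ_LR (mklin (h v)) a u). Qed.

Lemma formal_eval_scale (W : lmodType k) (f : U -> V -> W) a s :
  bilin f -> formal_eval f (formal_scale a s) = a *: formal_eval f s.
Proof.
move=> hf; rewrite /formal_eval big_map scaler_sumr.
by apply: eq_bigr => p _ /=; rewrite bilinZl.
Qed.

Definition tadd (x y : tensor) : tensor := \pi_tensor (repr x ++ repr y).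
Definition tscale (a : k) (x : tensor) : tensor :=
  \pi_tensor (formal_scale a (repr x)).
Definition topp := tscale (-1).
Definition tzero : tensor := \pi_tensor [::].

Ltac tsolve :=
  apply: tensor_piP; let W := fresh "W" in let f := fresh "f" in
  let hf := fresh "hf" in intros W f hf;
  do ?[rewrite formal_eval_cat | rewrite (formal_eval_repr _ hf)
      | rewrite (formal_eval_scale _ _ hf)].

Lemma taddA : associative tadd.
Proof. by move=> x y z; tsolve; rewrite addrA. Qed.
Lemma taddC : commutative tadd.
Proof. by move=> x y; tsolve; rewrite addrC. Qed.
Lemma tadd0 : left_id tzero tadd.
Proof.
move=> x; rewrite -[RHS]reprK; tsolve.
by rewrite /formal_eval big_nil add0r.
Qed.
Lemma taddN : left_inverse tzero topp tadd.
Proof.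
by move=> x; tsolve; rewrite scaleN1r addNr /formal_eval big_nil.
Qed.
HB.instance Definition _ := GRing.isZmodule.Build tensor taddA taddC tadd0 taddN.

Lemma tscaleA a b x : tscale a (tscale b x) = tscale (a * b) x.
Proof. by tsolve; rewrite scalerA. Qed.
Lemma tscale1 : left_id 1 tscale.
Proof. by move=> x; rewrite -[RHS]reprK; tsolve; rewrite scale1r. Qed.
Lemma tscaleDr : right_distributive tscale +%R.
Proof. by move=> a x y; tsolve; rewrite scalerDr. Qed.
Lemma tscaleDl x : {morph tscale^~ x : a b / a + b}.
Proof. by move=> a b; tsolve; rewrite scalerDl. Qed.
HB.instance Definition _ :=
  GRing.Zmodule_isLmodule.Build k tensor tscaleA tscale1 tscaleDr tscaleDl.

Definition tens (u : U) (v : V) : tensor := \pi_tensor [:: (u, v)].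

Lemma formal_eval1 (W : lmodType k) (f : U -> V -> W) u v :
  formal_eval f [:: (u, v)] = f u v.
Proof. by rewrite /formal_eval big_seq1. Qed.

Lemma tens_bilin : bilin tens.
Proof.
split=> [v a u u'|u a v v']; tsolve; rewrite !formal_eval1.
  by case: hf => h _; rewrite h.
by case: hf => _ h; rewrite h.
Qed.

Lemma tensor_sum (x : tensor) : exists s : seq (U * V), x = \sum_(p <- s) tens p.1 p.2.
Proof.
have sumE (s : seq (U * V)) : \pi_tensor s = \sum_(p <- s) tens p.1 p.2.
  elim: s => [|[u v] s IHs]; first by rewrite big_nil.
  rewrite big_cons -IHs /= /tens; apply: tensor_piP => W f hf.
  by rewrite formal_eval_cat !formal_eval_repr // -formal_eval_cat.
by exists (repr x); rewrite -sumE reprK.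
Qed.

Section Lift.
Variables (W : lmodType k) (f : U -> V -> W) (hf : bilin f).

Lemma tlift_linear : linear (fun x : tensor => formal_eval f (repr x)).
Proof.
move=> a x y; rewrite formal_eval_repr // formal_eval_cat.
by rewrite formal_eval_repr // formal_eval_scale.
Qed.

Lemma tlift_exists :
  {g : {linear tensor -> W} | forall u v, g (tens u v) = f u v}.
Proof.
by exists (mklin tlift_linear) => u v; rewrite /= formal_eval_repr // formal_eval1.
Qed.

Definition tlift : {linear tensor -> W} := sval tlift_exists.

Lemma tliftE u v : tlift (tens u v) = f u v.
Proof. exact: (svalP tlift_exists). Qed.
End Lift.

Lemma tensor_ext (W : lmodType k) (g h : {linear tensor -> W}) :
  (forall u v, g (tens u v) = h (tens u v)) -> g =1 h.
Proof.
move=> e x; have [s ->] := tensor_sum x.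
by rewrite !raddf_sum; apply: eq_bigr => p _; apply: e.
Qed.

End Def.
End Tensor.

Notation "x ⊗ y" := (tens x y) (at level 40, left associativity).

Section TensorMaps.
Context {k : fieldType}.
Implicit Types U V W X : lmodType k.

Lemma tensDl U V (u u' : U) (v : V) : (u + u') ⊗ v = u ⊗ v + u' ⊗ v.
Proof. by have [h _] := tens_bilin U V; have := h v 1 u u'; rewrite !scale1r. Qed.
Lemma tensDr U V (u : U) (v v' : V) : u ⊗ (v + v') = u ⊗ v + u ⊗ v'.
Proof. by have [_ h] := tens_bilin U V; have := h u 1 v v'; rewrite !scale1r. Qed.
Lemma tensZl U V a (u : U) (v : V) : (a *: u) ⊗ v = a *: (u ⊗ v).
Proof. exact/bilinZl/tens_bilin. Qed.
Lemma tensZr U V a (u : U) (v : V) : u ⊗ (a *: v) = a *: (u ⊗ v).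
Proof.
by have [_ h] := tens_bilin U V; exact: (linearZ_LR (mklin (h u)) a v).
Qed.

Lemma tmap_bilin U V U' V' (f : {linear U -> U'}) (g : {linear V -> V'}) :
  bilin (fun u v => f u ⊗ g v).
Proof.
by split=> ? a ? ?; rewrite linearP ?tensDl ?tensDr ?tensZl ?tensZr.
Qed.

Definition tmap U V U' V' (f : {linear U -> U'}) (g : {linear V -> V'}) :
  {linear tensor U V -> tensor U' V'} := tlift (tmap_bilin f g).

Lemma tassoc_in_bilin U V W (w : W) : bilin (fun (u : U) (v : V) => u ⊗ (v ⊗ w)).
Proof. by split=> ? a ? ?; rewrite ?(tensDl, tensDr, tensZl, tensZr). Qed.

Lemma tassoc_bilin U V W :
  bilin (fun (t : tensor U V) (w : W) => tlift (tassoc_in_bilin U V w) t).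
Proof.
split=> [w|t] a x y; first exact: linearP.
pose L (z : W) := tlift (tassoc_in_bilin U V z).
suff e : L (a *: x + y) =1 ladd (lscale a (L x)) (L y) by exact: (e t).
apply: tensor_ext => u v.
by rewrite laddE lscaleE /L !tliftE !tensDr !tensZr.
Qed.

Definition tassoc U V W : {linear tensor (tensor U V) W -> tensor U (tensor V W)} :=
  tlift (tassoc_bilin U V W).

Lemma tassocE U V W (u : U) (v : V) (w : W) : tassoc U V W (u ⊗ v ⊗ w) = u ⊗ (v ⊗ w).
Proof. by rewrite /tassoc !tliftE. Qed.

Lemma tassocV_in_bilin U V W (u : U) : bilin (fun (v : V) (w : W) => u ⊗ v ⊗ w).
Proof. by split=> ? a ? ?; rewrite ?(tensDl, tensDr, tensZl, tensZr). Qed.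

Lemma tassocV_bilin U V W :
  bilin (fun (u : U) (t : tensor V W) => tlift (tassocV_in_bilin V W u) t).
Proof.
split=> [t|u] a x y; last exact: linearP.
pose L (z : U) := tlift (tassocV_in_bilin V W z).
suff e : L (a *: x + y) =1 ladd (lscale a (L x)) (L y) by exact: (e t).
apply: tensor_ext => v w.
by rewrite laddE lscaleE /L !tliftE !tensDl !tensZl.
Qed.

Definition tassocV U V W : {linear tensor U (tensor V W) -> tensor (tensor U V) W} :=
  tlift (tassocV_bilin U V W).

Lemma tassocVE U V W (u : U) (v : V) (w : W) : tassocV U V W (u ⊗ (v ⊗ w)) = u ⊗ v ⊗ w.
Proof. by rewrite /tassocV !tliftE. Qed.

Lemma tswap_bilin U V : bilin (fun (u : U) (v : V) => v ⊗ u).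
Proof. by split=> ? a ? ?; rewrite ?(tensDl, tensDr, tensZl, tensZr). Qed.

Definition tswap U V : {linear tensor U V -> tensor V U} := tlift (tswap_bilin U V).

Lemma tmapE U V U' V' (f : {linear U -> U'}) (g : {linear V -> V'}) u v :
  tmap f g (u ⊗ v) = f u ⊗ g v.
Proof. by rewrite /tmap tliftE. Qed.

End TensorMaps.

Arguments tassoc {k U V W}.
Arguments tassocV {k U V W}.
Arguments tswap {k U V}.

Section DirectSum.
Local Open Scope classical_set_scope.
Context {k : fieldType}.
Section Def.
Variables (I : choiceType) (M : I -> lmodType k).

Definition dsum_fin (f : forall i, M i) : bool :=
  `[< finite_set [set i | f i != 0] >].

Record dsum := Dsum { dproj :> forall i, M i; _ : dsum_fin dproj }.

HB.instance Definition _ := [isSub for dproj].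
HB.instance Definition _ := gen_eqMixin dsum.
HB.instance Definition _ := gen_choiceMixin dsum.

Lemma dsum_ext (x y : dsum) : (forall i, x i = y i) -> x = y.
Proof.
move=> h; apply: val_inj => /=; apply: functional_extensionality_dep; exact: h.
Qed.

Lemma dsumP (x : dsum) : finite_set [set i | x i != 0].
Proof. by case: x => f /= /asboolP. Qed.

Lemma dzero_fin : dsum_fin (fun i => 0).
Proof.
apply/asboolP; rewrite (_ : [set _ | _] = classical_sets.set0) //.
by apply/seteqP; split=> i //=; rewrite eqxx.
Qed.
Definition dzero := Dsum dzero_fin.

Lemma dlin_fin a (x y : dsum) : dsum_fin (fun i => a *: x i + y i).
Proof.
apply/asboolP; apply: (@sub_finite_set _ _ ([set i | x i != 0] `|` [set i | y i != 0])).
  move=> i /=; case: (eqVneq (x i) 0) => [->|]; last by left.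
  by rewrite scaler0 add0r; right.
by rewrite finite_setU; split; apply: dsumP.
Qed.
Definition dlin a x y := Dsum (dlin_fin a x y).
Definition dadd (x y : dsum) := dlin 1 x y.
Definition dscale a (x : dsum) := dlin a x dzero.
Definition dopp (x : dsum) := dscale (-1) x.

Lemma daddA : associative dadd.
Proof. by move=> x y z; apply: dsum_ext => i /=; rewrite !scale1r addrA. Qed.
Lemma daddC : commutative dadd.
Proof. by move=> x y; apply: dsum_ext => i /=; rewrite !scale1r addrC. Qed.
Lemma dadd0 : left_id dzero dadd.
Proof. by move=> x; apply: dsum_ext => i /=; rewrite scaler0 add0r. Qed.
Lemma daddN : left_inverse dzero dopp dadd.
Proof. by move=> x; apply: dsum_ext => i /=; rewrite scale1r scaleN1r addr0 addNr. Qed.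
HB.instance Definition _ := GRing.isZmodule.Build dsum daddA daddC dadd0 daddN.

Lemma dscaleA a b x : dscale a (dscale b x) = dscale (a * b) x.
Proof. by apply: dsum_ext => i /=; rewrite !addr0 scalerA. Qed.
Lemma dscale1 : left_id 1 dscale.
Proof. by move=> x; apply: dsum_ext => i /=; rewrite addr0 scale1r. Qed.
Lemma dscaleDr : right_distributive dscale +%R.
Proof. by move=> a x y; apply: dsum_ext => i /=; rewrite !scale1r !addr0 scalerDr. Qed.
Lemma dscaleDl x : {morph dscale^~ x : a b / a + b}.
Proof. by move=> a b; apply: dsum_ext => i /=; rewrite !scale1r !addr0 scalerDl. Qed.
HB.instance Definition _ :=
  GRing.Zmodule_isLmodule.Build k dsum dscaleA dscale1 dscaleDr dscaleDl.

Lemma dproj_linear i : linear (fun x : dsum => x i).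
Proof. by move=> a x y /=; rewrite scale1r addr0. Qed.

Definition din_fun i (m : M i) (j : I) : M j :=
  if pselect (i = j) is left e then ecast j (M j) e m else 0.

Lemma din_fin i (m : M i) : dsum_fin (din_fun m).
Proof.
apply/asboolP; apply: (@sub_finite_set _ _ [set i]); last exact: finite_set1.
by move=> j /=; rewrite /din_fun; case: pselect => [e|]; rewrite ?eqxx.
Qed.

Lemma din_linear i : linear (fun m => Dsum (@din_fin i m)).
Proof.
move=> a x y; apply: dsum_ext => j /=; rewrite scale1r addr0 /din_fun.
by case: pselect => [e|_]; [case: _ / e|rewrite scaler0 addr0].
Qed.

Definition din i : {linear M i -> dsum} := mklin (@din_linear i).

Lemma din_id i (m : M i) : din i m i = m.
Proof.
rewrite /= /din_fun; case: pselect => [e|//].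
by rewrite (Prop_irrelevance e (erefl i)).
Qed.

Lemma din_ne i j (m : M i) : i <> j -> din i m j = 0.
Proof. by rewrite /= /din_fun; case: pselect. Qed.

Section Lift.
Variables (W : lmodType k) (f : forall i, {linear M i -> W}).

Definition dlift_fun (x : dsum) : W := \sum_(i \in [set: I]) f i (x i).

Lemma dlift_funE (x : dsum) (s : seq I) :
  uniq s -> (forall i, x i != 0 -> i \in s) -> dlift_fun x = \sum_(i <- s) f i (x i).
Proof.
move=> us h; rewrite /dlift_fun (@fsbigE _ _ _ _ _ s) //.
  by apply: eq_bigl => i; rewrite in_setT.
move=> i _ ins; have [->|/h] := eqVneq (x i) 0; first by rewrite linear0.
by rewrite (negPf ins).
Qed.

Lemma dlift_linear : linear dlift_fun.
Proof.
move=> a x y.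
have /finite_seqP[s1 e1] := dsumP x; have /finite_seqP[s2 e2] := dsumP y.
pose s := undup (s1 ++ s2).
have us : uniq s by apply: undup_uniq.
have hx i : x i != 0 -> i \in s.
  move=> h; rewrite mem_undup mem_cat; apply/orP; left.
  by have : [set i | x i != 0] i by []; rewrite e1.
have hy i : y i != 0 -> i \in s.
  move=> h; rewrite mem_undup mem_cat; apply/orP; right.
  by have : [set i | y i != 0] i by []; rewrite e2.
have hxy i : (a *: x + y) i != 0 -> i \in s.
  rewrite dproj_linear; have [->|/hx //] := eqVneq (x i) 0.
  by rewrite scaler0 add0r => /hy.
rewrite !(@dlift_funE _ s) // scaler_sumr -big_split.
by apply: eq_bigr => i _; rewrite dproj_linear linearP.
Qed.

Lemma dlift_exists : {g : {linear dsum -> W} |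
  forall (x : dsum) (s : seq I),
    uniq s -> (forall i, x i != 0 -> i \in s) -> g x = \sum_(i <- s) f i (x i)}.
Proof. by exists (mklin dlift_linear) => x s; apply: dlift_funE. Qed.

Definition dlift : {linear dsum -> W} := sval dlift_exists.

Lemma dlift_sumE (x : dsum) (s : seq I) :
  uniq s -> (forall i, x i != 0 -> i \in s) -> dlift x = \sum_(i <- s) f i (x i).
Proof. exact: (svalP dlift_exists). Qed.

Lemma dliftE i (m : M i) : dlift (din i m) = f i m.
Proof.
rewrite (@dlift_sumE _ [:: i]) //.
  by rewrite big_seq1 din_id.
move=> j; rewrite inE; apply: contraR => /eqP ne; apply/eqP.
by apply: din_ne => e; apply: ne.
Qed.
End Lift.
End Def.

Definition dmap (I : choiceType) (M N : I -> lmodType k)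
    (f : forall i, {linear M i -> N i}) : {linear dsum M -> dsum N} :=
  dlift (fun i => din N i ∘ f i).

End DirectSum.

Section Kernel.
Context {k : fieldType}.
Section Def.
Variables (U V : lmodType k) (f : {linear U -> V}).

Definition kern_pred : {pred U} := fun x => f x == 0.

Lemma kern_closed : submod_closed kern_pred.
Proof.
split=> [|a x y]; rewrite !unfold_in /kern_pred ?linear0 // linearP.
by move=> /eqP-> /eqP->; rewrite scaler0 addr0.
Qed.
HB.instance Definition _ := GRing.isSubmodClosed.Build k U kern_pred kern_closed.

Record kern := Kern { kern_val : U; _ : kern_val \in kern_pred }.
HB.instance Definition _ := [isSub for kern_val].
HB.instance Definition _ := [Choice of kern by <:].
HB.instance Definition _ := [SubChoice_isSubLmodule of kern by <:].

Definition kincl : {linear kern -> U} := (val : {linear kern -> U}).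
End Def.
End Kernel.

Section KernelRetraction.
Context {k : fieldType}.
Variables (U V : lmodType k) (f : {linear U -> V}).
Local Open Scope classical_set_scope.

Let closedP (C : set U) : Prop := forall a x y, C x -> C y -> C (a *: x + y).
Let P (C : set U) : Prop := closedP C /\ forall x, C x -> f x = 0 -> x = 0.

Lemma kern_complement : exists C : set U,
  [/\ C 0, closedP C, forall x, C x -> f x = 0 -> x = 0
    & forall u, exists2 c, C c & f (u - c) = 0].
Proof.
have [A [[clA A0] maxA]] : exists A, P A /\ forall B, A `<` B -> ~ P B.
  apply: Zorn_bigcup => F FP Ftot; split.
    move=> a x y [X FX Xx] [Y FY Yy].
    have [XY|YX] := Ftot _ _ FX FY.
      by exists Y => //; have [h _] := FP _ FY; apply: h => //; apply: XY.
    by exists X => //; have [h _] := FP _ FX; apply: h => //; apply: YX.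
  by move=> x [X FX Xx]; have [_ h] := FP _ FX; apply: h.
pose C : set U := [set x | A x \/ x = 0].
have clC : closedP C.
  move=> a x y [Ax|->] [Ay|->].
  - by left; apply: clA.
  - left; rewrite addr0 (_ : a *: x = (a - 1) *: x + x); first exact: clA.
    by rewrite scalerBl scale1r subrK.
  - by left; rewrite scaler0 add0r.
  - by right; rewrite scaler0 addr0.
have C0 x : C x -> f x = 0 -> x = 0 by move=> [/A0|->].
exists C; split=> //; first by right.
move=> u; apply: contrapT => nu.
pose B : set U := [set x | exists a c, C c /\ x = a *: u + c].
apply: (maxA B); last first.
  split=> [b x y [a [c [Cc ->]]] [a' [c' [Cc' ->]]]|x [a [c [Cc ->]]]].
    exists (b * a + a'), (b *: c + c'); split; first exact: clC.
    by rewrite scalerDr scalerA scalerDl addrACA.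
  have [->|a0] := eqVneq a 0; first by rewrite scale0r add0r; apply: C0.
  move=> fx; case: nu; exists (- a^-1 *: c).
    by rewrite -[_ *: _]addr0; apply: clC => //; right.
  rewrite scaleNr opprK -[u]scale1r -(mulVf a0) -scalerA -scalerDr linearZ /=.
  by rewrite fx scaler0.
split=> [x Ax|/(_ u) BA].
  by exists 0, x; split; [left|rewrite scale0r add0r].
case: nu; exists u; last by rewrite subrr linear0.
by left; apply: BA; exists 1, 0; split; [right|rewrite scale1r addr0].
Qed.

Lemma kern_retr_ex : exists r : {linear U -> kern f}, forall x, r (val x) = x.
Proof.
have [C [C0 clC Cf exC]] := kern_complement.
pose c u := s2val (cid2 (exC u)).
have Cc u : C (c u) := s2valP (cid2 (exC u)).
have fc u : f (u - c u) = 0 := s2valP' (cid2 (exC u)).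
have kP u : u - c u \in kern_pred f by rewrite unfold_in /kern_pred fc.
have cuniq u x : C x -> f (u - x) = 0 -> x = c u.
  move=> Cx fx; have e : x - c u = (u - c u) - (u - x).
    by rewrite opprB [RHS]addrC addrA subrK.
  apply/eqP; rewrite -subr_eq0; apply/eqP; apply: Cf.
    by rewrite addrC -scaleN1r; apply: clC.
  by rewrite e linearB fx fc subr0.
have rlin : linear (fun u => Kern (kP u)).
  move=> a x y.
  have e : (a *: x + y) - (a *: c x + c y) = a *: (x - c x) + (y - c y).
    by rewrite opprD addrACA scalerBr.
  have ec : c (a *: x + y) = a *: c x + c y.
    by apply/esym/cuniq; [exact: clC|rewrite e linearP !fc scaler0 addr0].
  by apply: val_inj; rewrite linearP [LHS]/= ec e.
exists (mklin rlin) => x; apply: val_inj => /=.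
rewrite -(cuniq (val x) 0) ?subr0 //.
by apply/eqP; case: x.
Qed.

(* Some k-linear retraction of the kernel inclusion.  It is only ever applied
   to vectors lying in the kernel, in order to regard them as elements of kern f. *)
Definition kretr : {linear U -> kern f} := projT1 (cid kern_retr_ex).

Lemma kretrK (x : kern f) : kretr (val x) = x.
Proof. exact: (projT2 (cid kern_retr_ex)). Qed.

Lemma kretr_val (u : U) : f u = 0 -> val (kretr u) = u.
Proof.
move=> fu; have h : u \in kern_pred f by rewrite unfold_in /kern_pred fu.
by rewrite -[u]/(val (Kern h)) kretrK.
Qed.

End KernelRetraction.

Section DirectSumTensor.
Context {k : fieldType}.
Variables (I J : choiceType) (M : I -> lmodType k) (N : J -> lmodType k).
Variables (W : lmodType k) (f : forall i j, {linear tensor (M i) (N j) -> W}).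

Lemma tensl_linear (U V : lmodType k) (u : U) : linear (fun v : V => u ⊗ v).
Proof. by have [_ h] := tens_bilin U V. Qed.

Definition dlift2_row i (y : dsum N) (u : M i) : W :=
  dlift (fun j => f i j ∘ mklin (@tensl_linear _ (N j) u)) y.

Lemma dlift2_row_linear i y : linear (@dlift2_row i y).
Proof.
have /finite_seqP[s0 e0] := dsumP y; pose s := undup s0.
have us : uniq s by apply: undup_uniq.
have hs j : y j != 0 -> j \in s.
  move=> h; rewrite mem_undup.
  by have : [set j | y j != 0]%classic j by []; rewrite e0.
move=> a u v; rewrite /dlift2_row !(dlift_sumE _ us hs) scaler_sumr -big_split.
by apply: eq_bigr => j _; rewrite /= tensDl tensZl linearP.
Qed.

Lemma dlift2_bilin :
  bilin (fun (x : dsum M) (y : dsum N) => dlift (fun i => mklin (@dlift2_row_linear i y)) x).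
Proof.
split=> [y|x] a u v; first exact: linearP.
have /finite_seqP[s0 e0] := dsumP x; pose s := undup s0.
have us : uniq s by apply: undup_uniq.
have hs j : x j != 0 -> j \in s.
  move=> h; rewrite mem_undup.
  by have : [set j | x j != 0]%classic j by []; rewrite e0.
rewrite !(dlift_sumE _ us hs) scaler_sumr -big_split.
by apply: eq_bigr => j _; rewrite /= /dlift2_row linearP.
Qed.

Lemma dlift2_exists : {g : {linear tensor (dsum M) (dsum N) -> W} |
  forall i j (u : M i) (v : N j), g (din M i u ⊗ din N j v) = f i j (u ⊗ v)}.
Proof.
exists (tlift dlift2_bilin) => i j u v.
by rewrite tliftE dliftE /= /dlift2_row dliftE.
Qed.

Definition dlift2 : {linear tensor (dsum M) (dsum N) -> W} := sval dlift2_exists.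

Lemma dlift2E i j (u : M i) (v : N j) : dlift2 (din M i u ⊗ din N j v) = f i j (u ⊗ v).
Proof. exact: (svalP dlift2_exists). Qed.

End DirectSumTensor.

Section Contractions.
Context {k : fieldType}.
Variables (O V : lmodType k) (e : {linear O -> k^o}).

Lemma contractl_bilin : bilin (fun (o : O) (v : V) => (e o : k) *: v).
Proof.
split=> [v|o] a x y; first by rewrite linearP /= scalerDl scalerA.
by rewrite scalerDr !scalerA mulrC.
Qed.
Definition contractl : {linear tensor O V -> V} := tlift contractl_bilin.

Lemma contractr_bilin : bilin (fun (v : V) (o : O) => (e o : k) *: v).
Proof.
split=> [o|v] a x y; last by rewrite linearP /= scalerDl scalerA.
by rewrite scalerDr !scalerA mulrC.
Qed.
Definition contractr : {linear tensor V O -> V} := tlift contractr_bilin.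
End Contractions.

Section TensorAlgebra.
Context {k : fieldType}.
Variable R : comAlgType k.

Lemma mul_bilin : bilin (fun x y : R => x * y).
Proof.
split=> [v|u] a x y; first by rewrite mulrDl scalerAl.
by rewrite mulrDr scalerAr.
Qed.
Definition lmul : {linear tensor R R -> R} := tlift mul_bilin.

Definition tswap_mid (U V W X : lmodType k) :
  {linear tensor (tensor U V) (tensor W X) -> tensor (tensor U W) (tensor V X)} :=
  tassocV ∘ tmap (lid U) (tassoc ∘ tmap tswap (lid X) ∘ tassocV) ∘ tassoc.

(* The product (a ⊗ b)(c ⊗ d) = ac ⊗ bd of R ⊗ R. *)
Definition tmul (x y : tensor R R) : tensor R R :=
  tmap lmul lmul (tswap_mid R R R R (x ⊗ y)).
End TensorAlgebra.

(* An affine algebraic group S over k, given by its coordinate ring: a finitely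
   generated commutative Hopf algebra. *)
Record algGroup (k : fieldType) := AlgGroup {
  coord :> comAlgType k;
  comul : {linear coord -> tensor coord coord};
  counit : {linear coord -> k^o};
  antipode : {linear coord -> coord};
  comulA : forall x,
    tassoc (tmap comul (lid coord) (comul x)) = tmap (lid coord) comul (comul x);
  counit_comul : forall x, contractl coord counit (comul x) = x;
  comul_counit : forall x, contractr coord counit (comul x) = x;
  comulM : forall x y, comul (x * y) = tmul (comul x) (comul y);
  comul1 : comul 1 = 1 ⊗ 1;
  counitM : forall x y, counit (x * y) = counit x * counit y;
  counit1 : counit 1 = 1;
  antipodel : forall x,
    lmul coord (tmap antipode (lid coord) (comul x)) = (counit x : k) *: 1;
  antipoder : forall x,
    lmul coord (tmap (lid coord) antipode (comul x)) = (counit x : k) *: 1;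
  coord_fingen : exists s : seq coord, forall P : coord -> Prop,
    P 1 -> (forall a x y, P x -> P y -> P (a *: x + y)) ->
    (forall x y, P x -> P y -> P (x * y)) ->
    (forall x, x \in s -> P x) -> forall x, P x
}.

Arguments comul {k} a.
Arguments counit {k} a.
Arguments antipode {k} a.

Section Representations.
Context {k : fieldType}.
Variable S : algGroup k.

(* A representation on V = k^d with standard basis e_0, ..., e_(d-1), given by
   its matrix of coefficients c: the left coaction of V is
   e_i |-> \sum_j c_ij ⊗ e_j.  Vectors of V are written as rows, vectors of the
   dual right representation as columns, so that a linear map V -> V' is a
   matrix F acting by v |-> v *m F and composition with w : V' -> k is F *m w. *)
Record rep := Rep {
  rdim : nat;
  rmx : 'M[S]_rdim;
  rep_comul : forall i j, comul S (rmx i j) = \sum_l rmx i l ⊗ rmx l j;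
  rep_counit : forall i j, counit S (rmx i j) = (i == j)%:R
}.

Definition rvec (V : rep) : lmodType k := 'rV[k]_(rdim V).
Definition rdual (V : rep) : lmodType k := 'cV[k]_(rdim V).
Definition rhom (V V' : rep) : lmodType k := 'M[k]_(rdim V, rdim V').

Lemma coact_linear (V : rep) : linear (fun v : 'rV[k]_(rdim V) =>
  \sum_i \sum_j (v 0 i *: rmx V i j) ⊗ (delta_mx 0 j : 'rV[k]_(rdim V))).
Proof.
move=> a x y; rewrite scaler_sumr -big_split; apply: eq_bigr => i _.
rewrite scaler_sumr -big_split; apply: eq_bigr => j _.
by rewrite !mxE scalerDl tensDl -scalerA tensZl.
Qed.
Definition coact (V : rep) : {linear rvec V -> tensor S (rvec V)} :=
  mklin (@coact_linear V).

(* e_j^* |-> \sum_i e_i^* ⊗ c_ij *)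
Lemma coact_dual_linear (V : rep) : linear (fun w : 'cV[k]_(rdim V) =>
  \sum_i \sum_j (delta_mx i 0 : 'cV[k]_(rdim V)) ⊗ (w j 0 *: rmx V i j)).
Proof.
move=> a x y; rewrite scaler_sumr -big_split; apply: eq_bigr => i _.
rewrite scaler_sumr -big_split; apply: eq_bigr => j _.
by rewrite !mxE scalerDl tensDr -scalerA tensZr.
Qed.
Definition coact_dual (V : rep) : {linear rdual V -> tensor (rdual V) S} :=
  mklin (@coact_dual_linear V).

(* The embedding of bicomodules V ⊗ V^dual -> O, v ⊗ w |-> (1 ⊗ w)(coact v). *)
Lemma coef_bilin (V : rep) : bilin (fun (v : 'rV[k]_(rdim V)) (w : 'cV[k]_(rdim V)) =>
  \sum_i \sum_j (v 0 i * w j 0) *: rmx V i j).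
Proof.
split=> [w|v] a x y; rewrite scaler_sumr -big_split; apply: eq_bigr => i _;
  rewrite scaler_sumr -big_split; apply: eq_bigr => j _.
  by rewrite !mxE mulrDl scalerDl -mulrA scalerA.
by rewrite !mxE mulrDr scalerDl mulrCA scalerA.
Qed.
Definition coef (V : rep) : {linear tensor (rvec V) (rdual V) -> S} :=
  tlift (@coef_bilin V).

Definition rep_iso (V V' : rep) : Prop :=
  exists (P : 'M[k]_(rdim V, rdim V')) (Q : 'M[k]_(rdim V', rdim V)),
    [/\ P *m Q = 1%:M, Q *m P = 1%:M &
        rmx V *m map_mx (in_alg S) P = map_mx (in_alg S) P *m rmx V'].

(* The row space of W is a subrepresentation of the base change of V to K: it
   is stable under S(R) for every commutative K-algebra R. *)
Definition subrep_over (K : fieldType) (iota : {rmorphism k -> K}) (V : rep)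
    (m : nat) (W : 'M[K]_(m, rdim V)) : Prop :=
  forall (R : comAlgType K) (g : {rmorphism S -> R}),
    (forall (a : k) (x : S), g (a *: x) = iota a *: g x) ->
    exists X : 'M[R]_m,
      map_mx (in_alg R) W *m map_mx g (rmx V) = X *m map_mx (in_alg R) W.

Definition irreducible_over (K : fieldType) (iota : {rmorphism k -> K}) (V : rep) :=
  (0 < rdim V)%N /\
  forall m (W : 'M[K]_(m, rdim V)), subrep_over iota W -> W = 0 \/ row_full W.

Definition irreducible (V : rep) : Prop :=
  irreducible_over (idfun : {rmorphism k -> k}) V.

Definition absolutely_irreducible (V : rep) : Prop :=
  forall (K : fieldType) (iota : {rmorphism k -> K}), irreducible_over iota V.

Definition split_group : Prop :=
  forall V : rep, irreducible V -> absolutely_irreducible V.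

(* Representatives V^a of the isomorphism classes a in Irr(S). *)
Record irrSystem (I : choiceType) := IrrSystem {
  irr :> I -> rep;
  irr_irreducible : forall a, irreducible (irr a);
  irr_inj : forall a b, rep_iso (irr a) (irr b) -> a = b;
  irr_exhaust : forall V, irreducible V -> exists a, rep_iso V (irr a)
}.

(* The product of two R-valued points of S, as maps on coordinate rings. *)
Definition point_mul (R : comAlgType k) (g h : {linear S -> R}) : {linear S -> R} :=
  lmul R ∘ tmap g h ∘ comul S.

Definition connected_group : Prop := forall e : S, e * e = e -> e = 0 \/ e = 1.

(* Every nonzero representation has a nonzero fixed vector. *)
Definition unipotent_group : Prop :=
  forall V : rep, (0 < rdim V)%N -> exists2 v : rvec V, v != 0 & coact V v = 1 ⊗ v.

Definition trivial_group : Prop := forall x : S, x = (counit S x : k) *: 1.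

End Representations.

Section Reductive.
Context {k : fieldType}.
Variable S : algGroup k.

Record closedSubgroup := ClosedSubgroup {
  csub :> algGroup k;
  csub_res : {lrmorphism S -> csub};
  csub_surj : forall y, exists x, csub_res x = y;
  csub_comul : forall x,
    comul csub (csub_res x) = tmap csub_res csub_res (comul S x);
  csub_counit : forall x, counit csub (csub_res x) = counit S x
}.

(* N(R) is normal in S(R) for every commutative k-algebra R. *)
Definition normal_subgroup (N : closedSubgroup) : Prop :=
  forall (R : comAlgType k) (g : {lrmorphism S -> R}) (h : {lrmorphism N -> R}),
  exists h' : {lrmorphism N -> R}, forall x,
    point_mul (point_mul g (h ∘ csub_res N)) (g ∘ antipode S) x
    = h' (csub_res N x).

(* The unipotent radical is trivial; over a field of characteristic zero it
   commutes with extension of the base field, and closed subgroups are smooth. *)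
Definition reductive : Prop :=
  forall N : closedSubgroup, normal_subgroup N ->
    connected_group N -> unipotent_group N -> trivial_group N.

End Reductive.

Section Bicomodules.
Context {k : fieldType}.
Variable S : algGroup k.

(* The data of a complex of O-bicomodules, O = coord S.  A graded space is its
   total space bcar together with the predicates bdeg p of homogeneity of degree
   p; bsgn is the operator x |-> (-1)^|x| x that enters the Koszul sign rule. *)
Record bicpx := Bicpx {
  bcar :> lmodType k;
  bdif : {linear bcar -> bcar};
  bdeg : int -> bcar -> Prop;
  bsgn : {linear bcar -> bcar};
  bleft : {linear bcar -> tensor S bcar};
  bright : {linear bcar -> tensor bcar S}
}.

Arguments bdif : clear implicits.
Arguments bdeg : clear implicits.
Arguments bsgn : clear implicits.
Arguments bleft : clear implicits.
Arguments bright : clear implicits.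

Definition deg0 (M : lmodType k) (p : int) (x : M) : Prop := p = 0 \/ x = 0.

(* The part of degree n of the tensor product of two graded spaces. *)
Definition tdeg (M N : lmodType k) (dM : int -> M -> Prop) (dN : int -> N -> Prop)
    (n : int) (t : tensor M N) : Prop :=
  exists s : seq (M * N),
    (forall z, z \in s -> exists p q, [/\ p + q = n, dM p z.1 & dN q z.2]) /\
    t = \sum_(z <- s) z.1 ⊗ z.2.

Record is_bicpx (X : bicpx) : Prop := IsBicpx {
  bdeg_lin : forall p a x y, bdeg X p x -> bdeg X p y -> bdeg X p (a *: x + y);
  bdeg_zero : forall p, bdeg X p 0;
  bdeg_span : forall x, exists (s : seq int) (f : int -> X),
    (forall p, bdeg X p (f p)) /\ x = \sum_(p <- s) f p;
  bdeg_direct : forall (s : seq int) (f : int -> X), uniq s ->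
    (forall p, p \in s -> bdeg X p (f p)) -> \sum_(p <- s) f p = 0 ->
    forall p, p \in s -> f p = 0;
  bsgnE : forall p x, bdeg X p x -> bsgn X x = (-1) ^+ `|p|%N *: x;
  bdif_deg : forall p x, bdeg X p x -> bdeg X (p + 1) (bdif X x);
  bdif_sq : forall x, bdif X (bdif X x) = 0;
  bleftA : forall x,
    tassoc (tmap (comul S) (lid X) (bleft X x)) = tmap (lid S) (bleft X) (bleft X x);
  bleft1 : forall x, contractl X (counit S) (bleft X x) = x;
  brightA : forall x,
    tassoc (tmap (bright X) (lid S) (bright X x)) = tmap (lid X) (comul S) (bright X x);
  bright1 : forall x, contractr X (counit S) (bright X x) = x;
  bleft_right : forall x,
    tassoc (tmap (bleft X) (lid S) (bright X x)) = tmap (lid S) (bright X) (bleft X x);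
  bleft_dif : forall x, bleft X (bdif X x) = tmap (lid S) (bdif X) (bleft X x);
  bright_dif : forall x, bright X (bdif X x) = tmap (bdif X) (lid S) (bright X x);
  bleft_deg : forall p x, bdeg X p x -> tdeg (@deg0 S) (bdeg X) p (bleft X x);
  bright_deg : forall p x, bdeg X p x -> tdeg (bdeg X) (@deg0 S) p (bright X x)
}.

Record is_bihom (X Y : bicpx) (f : {linear X -> Y}) : Prop := IsBihom {
  bihom_deg : forall p x, bdeg X p x -> bdeg Y p (f x);
  bihom_dif : forall x, f (bdif X x) = bdif Y (f x);
  bihom_left : forall x, bleft Y (f x) = tmap (lid S) f (bleft X x);
  bihom_right : forall x, bright Y (f x) = tmap f (lid S) (bright X x)
}.

Definition bi_unit : bicpx := Bicpx \0 (@deg0 S) (lid S) (comul S) (comul S).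

(* The cotensor product M ⊗_O N = ker (Delta_M ⊗ 1 - 1 ⊗ Delta_N). *)
Section Cotensor.
Variables X Y : bicpx.

Definition coteq : {linear tensor X Y -> tensor X (tensor S Y)} :=
  (tassoc ∘ tmap (bright X) (lid Y)) \- tmap (lid X) (bleft Y).

Definition cot : lmodType k := kern coteq.
Definition cotval : {linear cot -> tensor X Y} := kincl coteq.
Definition cotretr : {linear tensor X Y -> cot} := kretr coteq.

Definition cotensor : bicpx := Bicpx (bcar := cot)
  (cotretr ∘ ladd (tmap (bdif X) (lid Y)) (tmap (bsgn X) (bdif Y)) ∘ cotval)
  (fun n t => tdeg (bdeg X) (bdeg Y) n (cotval t))
  (cotretr ∘ tmap (bsgn X) (bsgn Y) ∘ cotval)
  (tmap (lid S) cotretr ∘ tassoc ∘ tmap (bleft X) (lid Y) ∘ cotval)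
  (tmap cotretr (lid S) ∘ tassocV ∘ tmap (lid X) (bright Y) ∘ cotval).

End Cotensor.

Notation "X □ Y" := (cotensor X Y) (at level 40, left associativity).

(* f ⊗_O g *)
Definition cotmap (X Y X' Y' : bicpx) (f : {linear X -> X'}) (g : {linear Y -> Y'}) :
  {linear X □ Y -> X' □ Y'} := cotretr X' Y' ∘ tmap f g ∘ cotval X Y.

Definition cotassocV (X Y Z : bicpx) : {linear X □ (Y □ Z) -> (X □ Y) □ Z} :=
  cotretr (X □ Y) Z ∘ tmap (cotretr X Y) (lid Z) ∘ tassocV
  ∘ tmap (lid X) (cotval Y Z) ∘ cotval X (Y □ Z).

(* The identifications O ⊗_O X = X = X ⊗_O O. *)
Definition cotunitl (X : bicpx) : {linear bi_unit □ X -> X} :=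
  contractl X (counit S) ∘ cotval bi_unit X.
Definition cotunitl_inv (X : bicpx) : {linear X -> bi_unit □ X} :=
  cotretr bi_unit X ∘ bleft X.
Definition cotunitr (X : bicpx) : {linear X □ bi_unit -> X} :=
  contractr X (counit S) ∘ cotval X bi_unit.
Definition cotunitr_inv (X : bicpx) : {linear X -> X □ bi_unit} :=
  cotretr X bi_unit ∘ bright X.

Record relDGA := RelDGA {
  dga :> bicpx;
  dga_bicpx : is_bicpx dga;
  dga_one : {linear bi_unit -> dga};
  dga_one_hom : is_bihom dga_one;
  dga_mul : {linear dga □ dga -> dga};
  dga_mul_hom : is_bihom dga_mul;
  dga_mulA : forall t : dga □ (dga □ dga),
    dga_mul (cotmap dga_mul (lid dga) (cotassocV dga dga dga t))
    = dga_mul (cotmap (lid dga) dga_mul t);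
  dga_mul1l : forall x : dga,
    dga_mul (cotmap dga_one (lid dga) (cotunitl_inv dga x)) = x;
  dga_mul1r : forall x : dga,
    dga_mul (cotmap (lid dga) dga_one (cotunitr_inv dga x)) = x
}.

Section Augmentation.
Variables (I : choiceType) (V : irrSystem S I).

(* Hom_k(O, O), the sum over (a, b) of V^a ⊗ Hom_k(V^a, V^b) ⊗ bV. *)
Definition hom_summand (p : I * I) : lmodType k :=
  tensor (rvec (V p.1)) (tensor (rhom (V p.1) (V p.2)) (rdual (V p.2))).

Definition homOO : lmodType k := dsum hom_summand.

Definition hom_in (a b : I) (v : rvec (V a)) (F : rhom (V a) (V b)) (w : rdual (V b)) :
  homOO := din hom_summand (a, b) (v ⊗ (F ⊗ w)).

Definition hom_left : {linear homOO -> tensor S homOO} :=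
  dlift (fun p => tmap (lid S) (din hom_summand p) ∘ tassoc
                  ∘ tmap (coact (V p.1)) (lid _)).

Definition hom_right : {linear homOO -> tensor homOO S} :=
  dlift (fun p => tmap (din hom_summand p) (lid S) ∘ tassocV
                  ∘ tmap (lid _) (tassocV ∘ tmap (lid _) (coact_dual (V p.2)))).

Definition bi_hom : bicpx := Bicpx (bcar := homOO) \0 (@deg0 homOO) (lid _) hom_left hom_right.

(* The sum over a of V^a ⊗ aV and its identification with O. *)
Definition pw_summand (a : I) : lmodType k := tensor (rvec (V a)) (rdual (V a)).
Definition pw_sum : lmodType k := dsum pw_summand.
Definition pw_coef : {linear pw_sum -> S} := dlift (fun a => coef (V a)).

Lemma hom_act_bilin (a b : I) : bilin (fun (v : rvec (V a)) (F : rhom (V a) (V b)) =>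
  (v *m F : rvec (V b))).
Proof.
by split=> [F|v] c x y; rewrite ?mulmxDl ?mulmxDr -?scalemxAl -?scalemxAr.
Qed.

Lemma hom_pull_bilin (a b : I) : bilin (fun (F : rhom (V a) (V b)) (w : rdual (V b)) =>
  (F *m w : rdual (V a))).
Proof.
by split=> [F|v] c x y; rewrite ?mulmxDl ?mulmxDr -?scalemxAl -?scalemxAr.
Qed.

(* v ⊗ F ⊗ w |-> F(v) ⊗ w and v ⊗ F ⊗ w |-> v ⊗ (w o F) *)
Definition hom_evr : {linear homOO -> pw_sum} :=
  dlift (fun p => din pw_summand p.2 ∘ tmap (tlift (hom_act_bilin p.1 p.2)) (lid _)
                  ∘ tassocV).
Definition hom_evl : {linear homOO -> pw_sum} :=
  dlift (fun p => din pw_summand p.1 ∘ tmap (lid _) (tlift (hom_pull_bilin p.1 p.2))).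

Lemma hom_rank1_bilin (a c : I) : bilin (fun (w : rdual (V a)) (v : rvec (V c)) =>
  (w *m v : rhom (V a) (V c))).
Proof.
by split=> [F|v] b x y; rewrite ?mulmxDl ?mulmxDr -?scalemxAl -?scalemxAr.
Qed.

Definition hom_glue : {linear tensor pw_sum pw_sum -> homOO} :=
  dlift2 (M := pw_summand) (N := pw_summand) (fun a c => din hom_summand (a, c)
    ∘ tmap (lid _) (tmap (tlift (hom_rank1_bilin a c)) (lid _) ∘ tassocV)
    ∘ tassoc).

(* The product of Hom_k(O, O) given by composition Hom_k(V^a, V^b) ⊗
   Hom_k(V^b, V^c) -> Hom_k(V^a, V^c), (F, G) |-> G o F.  On pure tensors
   the formula is
     (v ⊗ F ⊗ w)(v' ⊗ G ⊗ w') = v ⊗ (x |-> w(F x) G v') ⊗ w',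
   which on the canonical element \sum_i e_i^* ⊗ e_i spanning bV ⊗_O V^b is the
   composition: see hom_mulE. *)
Definition hom_mul : {linear bi_hom □ bi_hom -> bi_hom} :=
  hom_glue ∘ tmap hom_evl hom_evr ∘ cotval bi_hom bi_hom.

Lemma hom_mulE (a b c : I) (v : rvec (V a)) (F : rhom (V a) (V b))
    (G : rhom (V b) (V c)) (w : rdual (V c)) (t : bi_hom □ bi_hom) :
  cotval bi_hom bi_hom t =
    \sum_i hom_in v F (delta_mx i 0 : rdual (V b))
           ⊗ hom_in (delta_mx 0 i : rvec (V b)) G w ->
  hom_mul t = hom_in v (F *m G : rhom (V a) (V c)) w.
Proof.
move=> tE; have -> : hom_mul t = hom_glue (tmap hom_evl hom_evr (cotval _ _ t)) by [].
rewrite tE !linear_sum.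
transitivity (\sum_i hom_in v (F *m (delta_mx i 0 : rdual (V b)) *m
    ((delta_mx 0 i : rvec (V b)) *m G) : rhom (V a) (V c)) w).
  apply: eq_bigr => i _.
  rewrite tmapE /hom_evl /hom_evr /hom_in !dliftE !lcompE tassocVE !tmapE !tliftE.
  apply: etrans (dlift2E _ _ _) _.
  by rewrite !lcompE tassocE tmapE lcompE tassocVE tmapE tliftE.
transitivity (hom_in v (\sum_i (F *m (delta_mx i 0 : rdual (V b)) *m
    ((delta_mx 0 i : rvec (V b)) *m G)) : rhom (V a) (V c)) w).
  pose L (F' : rhom (V a) (V c)) := hom_in v F' w.
  have L_linear : linear L.
    by move=> x M N; rewrite /L /hom_in tensDl tensZl tensDr tensZr linearP.
  by rewrite -[RHS]/(mklin L_linear _) linear_sum.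
congr (hom_in v _ w); rewrite -[in RHS](mulmx1 F) -[RHS]mulmxA mx1_sum_delta.
rewrite mulmx_suml mulmx_sumr; apply: eq_bigr => i _.
by rewrite !mulmxA -(mulmxA F) mul_delta_mx.
Qed.



Record relAug (A : relDGA) := RelAug {
  aug :> {linear A -> bi_hom};
  aug_hom : is_bihom aug;
  aug_mul : forall t : A □ A, aug (dga_mul A t) = hom_mul (cotmap aug aug t);
  (* epsilon (1_a) = id; the element v ⊗ w of V^a ⊗ aV is coef (v ⊗ w) in O *)
  aug_one : forall (a : I) (v : rvec (V a)) (w : rdual (V a)),
    aug (dga_one A (coef (V a) (v ⊗ w))) = hom_in v (1%:M : rhom (V a) (V a)) w
}.

Section Bar.
Variables (A : relDGA) (eps : relAug A).

Definition aug_r : {linear A -> bi_unit} := pw_coef ∘ hom_evr ∘ eps.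
Definition aug_l : {linear A -> bi_unit} := pw_coef ∘ hom_evl ∘ eps.

(* A ⊗_O ... ⊗_O A with n + 1 factors. *)
Fixpoint cotpow (n : nat) : bicpx :=
  if n is n'.+1 then A □ cotpow n' else A.

Definition bar (n : nat) : bicpx :=
  if n is n'.+1 then cotpow n' else bi_unit.

(* x_1 ⊗ y |-> epsilon^r(x_1) ⊗ y *)
Definition face_first (M : bicpx) : {linear A □ M -> M} :=
  cotunitl M ∘ cotmap aug_r (lid M).

(* x_1 ⊗ x_2 ⊗ y |-> x_1 x_2 ⊗ y *)
Definition face_mul (M : bicpx) : {linear A □ (A □ M) -> A □ M} :=
  cotmap (dga_mul A) (lid M) ∘ cotassocV A A M.

(* The face number i + 1 of x_1 ⊗ ... ⊗ x_(n+2), 0 <= i <= n + 1: it multiplies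
   x_(i+1) and x_(i+2) when i <= n, and applies epsilon^l to x_(n+2) when i = n + 1. *)
Fixpoint face_next (n i : nat) : {linear cotpow n.+1 -> cotpow n} :=
  match n return {linear cotpow n.+1 -> cotpow n} with
  | 0 => if i is 0 then dga_mul A else cotunitr A ∘ cotmap (lid A) aug_l
  | n'.+1 => if i is i'.+1 then cotmap (lid A) (face_next n' i')
             else face_mul (cotpow n')
  end.

Definition face (n i : nat) : {linear bar n.+1 -> bar n} :=
  match n return {linear bar n.+1 -> bar n} with
  | 0 => if i is 0 then aug_r else aug_l
  | n'.+1 => if i is i'.+1 then face_next n' i' else face_first (cotpow n')
  end.

End Bar.
End Augmentation.
End Bicomodules.

Arguments bdif {k S} b.
Arguments bdeg {k S} b p x.
Arguments bsgn {k S} b.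
Arguments bleft {k S} b.
Arguments bright {k S} b.

(* Double complexes concentrated in outer degrees n >= 0, the outer differential
   dcx_out lowering n and the inner one dcx_in raising the inner degree. *)
Section DoubleComplex.
Context {k : fieldType}.

Record dcx := Dcx {
  dcx_car :> nat -> lmodType k;
  dcx_out : forall n, {linear dcx_car n.+1 -> dcx_car n};
  dcx_in : forall n, {linear dcx_car n -> dcx_car n};
  dcx_deg : forall n, int -> dcx_car n -> Prop
}.

Record is_dcx (X : dcx) : Prop := IsDcx {
  dcx_out_sq : forall n (x : X n.+2), dcx_out X n (dcx_out X n.+1 x) = 0;
  dcx_in_sq : forall n (x : X n), dcx_in X n (dcx_in X n x) = 0;
  dcx_out_in : forall n (x : X n.+1),
    dcx_out X n (dcx_in X n.+1 x) = dcx_in X n (dcx_out X n x);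
  dcx_out_deg : forall n p (x : X n.+1), dcx_deg p x -> dcx_deg p (dcx_out X n x);
  dcx_in_deg : forall n p (x : X n), dcx_deg p x -> dcx_deg (p + 1) (dcx_in X n x)
}.

Record is_dcx_hom (X Y : dcx) (f : forall n, {linear X n -> Y n}) : Prop := IsDcxHom {
  dcx_hom_out : forall n (x : X n.+1), f n (dcx_out X n x) = dcx_out Y n (f n.+1 x);
  dcx_hom_in : forall n (x : X n), f n (dcx_in X n x) = dcx_in Y n (f n x);
  dcx_hom_deg : forall n p (x : X n), dcx_deg p x -> dcx_deg p (f n x)
}.

(* The associated simple complex: outer degree n counts for -n, and the total
   differential is dcx_out + (-1)^n dcx_in on X n. *)
Definition tot (X : dcx) : lmodType k := dsum X.

Definition tot_dif (X : dcx) : {linear tot X -> tot X} :=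
  dlift (fun n => ladd
    (match n return {linear X n -> tot X} with
     | 0 => \0
     | n'.+1 => din X n' ∘ dcx_out X n'
     end)
    (din X n ∘ lscale ((-1) ^+ n) (dcx_in X n))).

Definition tot_deg (X : dcx) (m : int) (x : tot X) : Prop :=
  forall n : nat, dcx_deg (m + n%:Z) ((x : dsum X) n).

Definition tot_map (X Y : dcx) (f : forall n, {linear X n -> Y n}) :
  {linear tot X -> tot Y} := dmap f.

Definition cycle (X : dcx) (m : int) (x : tot X) : Prop :=
  tot_deg m x /\ tot_dif X x = 0.

Definition boundary (X : dcx) (m : int) (x : tot X) : Prop :=
  exists2 y, tot_deg (m - 1) y & tot_dif X y = x.

(* Bijectivity of H^m (tot X) -> H^m (tot Y) for every m. *)
Definition quasi_iso (X Y : dcx) (f : forall n, {linear X n -> Y n}) : Prop :=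
  forall m : int,
    (forall x, cycle m x -> boundary m (tot_map f x) -> boundary m x) /\
    (forall y, cycle m y -> exists2 x, cycle m x & boundary m (y - tot_map f x)).

End DoubleComplex.

(* Strictly increasing sequences alpha_0 < ... < alpha_n of integers. *)
Definition incseq_pred (n : nat) : {pred seq int} :=
  fun s => (size s == n.+1) && sorted <%R s.

Record incseq (n : nat) := Incseq { inc_seq :> seq int; _ : incseq_pred n inc_seq }.

HB.instance Definition _ n := [isSub for @inc_seq n].
HB.instance Definition _ n := [Choice of incseq n by <:].

Definition omit (i : nat) (s : seq int) : seq int := take i s ++ drop i.+1 s.

Lemma omit_subproof n (i : 'I_n.+2) (s : incseq n.+1) : incseq_pred n (omit i s).
Proof.
case: s => s /= /andP[/eqP sz srt]; apply/andP; split.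
  rewrite size_cat size_take size_drop sz ltn_ord subSS.
  by rewrite subnKC // -ltnS ltn_ord.
apply: (subseq_sorted Order.POrderTheory.lt_trans _ srt).
rewrite -[X in subseq _ X](cat_take_drop i s); apply: cat_subseq => //.
by rewrite -[i.+1]add1n -drop_drop; apply: drop_subseq.
Qed.

Definition inc_omit n (i : 'I_n.+2) (s : incseq n.+1) : incseq n :=
  Incseq (omit_subproof i s).

Section BarComplexes.
Context {k : fieldType} {S : algGroup k} {I : choiceType} {V : irrSystem S I}.
Variables (A : relDGA S) (eps : relAug V A).

Definition Bar : dcx := Dcx (dcx_car := fun n => bcar (bar A n))
  (fun n => lalt n.+1 (face eps n))
  (fun n => bdif (bar A n))
  (fun n => bdeg (bar A n)).

Definition simp_car (n : nat) : lmodType k :=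
  dsum (fun _ : incseq n => bcar (bar A n)).

Definition simp_out (n : nat) : {linear simp_car n.+1 -> simp_car n} :=
  dlift (fun alpha : incseq n.+1 =>
    lalt n.+1 (fun i => din _ (inc_omit (inord i) alpha) ∘ face eps n i)).

Definition Bar_simp : dcx := Dcx (dcx_car := simp_car)
  simp_out
  (fun n => dmap (fun _ : incseq n => bdif (bar A n)))
  (fun n p (x : dsum (fun _ : incseq n => bcar (bar A n))) =>
     forall alpha, bdeg (bar A n) p (x alpha)).

Definition sigma (n : nat) : {linear Bar_simp n -> Bar n} :=
  dlift (fun _ : incseq n => lid (bar A n)).

End BarComplexes.

(* Main.v *)
From HB Require Import structures.
From mathcomp Require Import all_boot all_order all_algebra.
From mathcomp Require Import all_classical.
Require Import Defs.

Set Implicit Arguments.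
Unset Strict Implicit.
Unset Printing Implicit Defensive.

Import GRing.Theory.
Local Open Scope ring_scope.

(** The bar construction is the alternating complex of a simplicial object X, with
    X_n = Bar_n: its faces are the products and the one-sided augmentations, and its
    degeneracies insert the unit of A.  The simplicial variant is the sum of one
    copy of X_n for every strictly increasing sequence of n + 1 integers, and
    [sigma] forgets the sequence.  So the theorem has two halves: a statement on
    arbitrary simplicial objects ([forget_quasi_iso]), and the verification of the
    simplicial identities ([bar_simplicial]).

    For the first half, let M be smaller than all entries of the sequences that
    occur.  Inserting M, M + 1, ... in front of the successive entries of a
    sequence, by means of the degeneracies, gives a homotopy from the identity to
    the map that projects a chain x onto the normalized chains and moves it to the
    sequence M < M + 1 < ... < M + n ([homotopy_identity]).  The result depends only
    on sigma(x): the homotopy ends at tau_M sigma, where tau_M is a chain map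
    ([section_run]).  A cycle x with finite support therefore is homologous to
    tau_M sigma(x), and bounds if sigma(x) does.  Applying sigma to the homotopy
    shows that sigma tau_M is homotopic to the identity as well.  Total complexes are
    direct sums and A may be unbounded in both directions, so that exactness in the
    outer direction would not be enough; but the homotopies are made of faces and
    degeneracies, commute with the inner differential, and pass to the total
    complexes ([tot_shift_homotopyS]).

    For the second half, a functional s on O acts on left comodules by [lact] and on
    right comodules by [ract], and A ⊗_O M consists of the elements of A ⊗ M on which
    the two actions agree.  The evaluations [ev] of the last factor at functionals
    are left colinear and separate points, and reduce the identities that involve
    the product to identities in A ([ev_face_mul]).  The identities that involve the
    augmentation reduce to properties of a single functional e on A, the composite
    of either one-sided augmentation with the counit ([aug_eval]): it is
    multiplicative on A ⊗_O A, and its composite with the unit O -> A is the counit.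
    The definition of an augmentation gives the last point only on the matrix
    coefficients of the irreducible representations.  But the difference of the two
    functionals is idempotent for convolution and vanishes on these coefficients.
    So it acts on every finite-dimensional representation by a matrix that is
    idempotent and, by induction on the dimension, of square zero; as every element
    of O is a coefficient of such a representation, the difference is zero
    ([aug_eval_one]). *)

Local Notation "X □ Y" := (cotensor X Y) (at level 40, left associativity).

(** * Linear functionals separate points of tensor products *)

Section Functionals.
Local Open Scope classical_set_scope.
Context {k : fieldType}.
Implicit Types U V W : lmodType k.

Lemma lin_ext U V (f g : {linear U -> V}) : f =1 g -> f = g.
Proof.
case: f g => f [[a1] [b1]] [g [[a2] [b2]]] /= /funext e.
by move: a1 b1; rewrite e => a1 b1; congr GRing.Linear.Pack;
  congr GRing.Linear.Class; congr (_ _); exact: Prop_irrelevance.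
Qed.

(** A subspace maximal among those avoiding [u] is a hyperplane complementary
    to the line of [u]; the functional is the coordinate along that line. *)
Lemma functional_exists U (u : U) : u != 0 -> exists s : {linear U -> k^o}, s u = 1.
Proof.
move=> u0.
pose closedP (C : set U) : Prop := forall a x y, C x -> C y -> C (a *: x + y).
pose P (C : set U) : Prop := closedP C /\ ~ C u.
have [A [[clA Au] maxA]] : exists A, P A /\ forall B, A `<` B -> ~ P B.
  apply: Zorn_bigcup => F FP Ftot; split.
    move=> a x y [X FX Xx] [Y FY Yy].
    have [XY|YX] := Ftot _ _ FX FY.
      by exists Y => //; have [h _] := FP _ FY; apply: h => //; apply: XY.
    by exists X => //; have [h _] := FP _ FX; apply: h => //; apply: YX.
  by move=> [X FX Xu]; have [_ h] := FP _ FX; apply: h.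
have A0 : A 0.
  apply: contrapT => nA0; apply: (maxA (A `|` [set 0])); last first.
    split=> [a x y [Ax|->] [Ay|->]|[//|/= e]]; last by rewrite e eqxx in u0.
    - by left; apply: clA.
    - left; rewrite addr0 (_ : a *: x = (a - 1) *: x + x); first exact: clA.
      by rewrite scalerBl scale1r subrK.
    - by left; rewrite scaler0 add0r.
    - by right; rewrite scaler0 addr0.
  by split=> [x|/(_ 0)]; [left|move=> h; apply: nA0; apply: h; right].
have clZ a x : A x -> A (a *: x) by move=> Ax; rewrite -[_ *: _]addr0; apply: clA.
have ex v : exists a, A (v - a *: u).
  apply: contrapT => nv.
  pose B : set U := [set x | exists a c, A c /\ x = a *: v + c].
  apply: (maxA B); split.
  - by move=> x Ax; exists 0, x; split=> //; rewrite scale0r add0r.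
  - move=> /(_ v) BA; apply: nv; exists 0; rewrite scale0r subr0; apply: BA.
    by exists 1, 0; split=> //; rewrite scale1r addr0.
  - move=> a x y [b [c [Ac ->]]] [b' [c' [Ac' ->]]].
    exists (a * b + b'), (a *: c + c'); split; first exact: clA.
    by rewrite scalerDr scalerA scalerDl addrACA.
  - move=> [a [c [Ac e]]]; apply: nv.
    have [a0|a0] := eqVneq a 0; first by case: Au; rewrite e a0 scale0r add0r.
    exists a^-1; rewrite (_ : _ - _ = - a^-1 *: c); first exact: clZ.
    by rewrite e scalerDr scalerA mulVf // scale1r opprD addrA subrr add0r scaleNr.
have uniq v a b : A (v - a *: u) -> A (v - b *: u) -> a = b.
  move=> ha hb; apply/eqP; rewrite -subr_eq0; apply/eqP; apply: contrapT => /eqP ab.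
  apply: Au; rewrite -[u]scale1r -(mulVf ab) -scalerA; apply: clZ.
  rewrite (_ : _ *: u = -1 *: (v - a *: u) + (v - b *: u)); first exact: clA.
  by rewrite scaleN1r opprB addrA subrK scalerBl.
pose s v := projT1 (cid (ex v)).
have sP v : A (v - s v *: u) := projT2 (cid (ex v)).
have slin : linear (s : U -> k^o).
  move=> a x y; apply: (uniq (a *: x + y)) => //.
  rewrite (_ : _ - _ = a *: (x - s x *: u) + (y - s y *: u)); first exact: clA.
  by rewrite scalerBr addrACA -opprD scalerDl scalerA.
exists (mklin slin); apply: (uniq u) => //; last by rewrite scale1r subrr.
Qed.

Lemma funct_sep U (u : U) : (forall s : {linear U -> k^o}, s u = 0) -> u = 0.
Proof.
move=> h; apply/eqP; apply: contrapT => /negP /functional_exists [s].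
by rewrite h => /eqP; rewrite eq_sym oner_eq0.
Qed.

Lemma funct_ext U (u v : U) : (forall s : {linear U -> k^o}, s u = s v) -> u = v.
Proof.
move=> h; apply/eqP; rewrite -subr_eq0; apply/eqP/funct_sep => s.
by rewrite linearB h subrr.
Qed.

End Functionals.

Section Slices.
Context {k : fieldType}.
Implicit Types U V W : lmodType k.

Lemma contractlE U V (s : {linear U -> k^o}) u (v : V) :
  contractl V s (u ⊗ v) = (s u : k) *: v.
Proof. exact: tliftE. Qed.

Lemma contractrE U V (s : {linear V -> k^o}) (u : U) v :
  contractr U s (u ⊗ v) = (s v : k) *: u.
Proof. exact: tliftE. Qed.

Lemma tmap_comp U V U' V' U'' V'' (f : {linear U -> U'}) (f' : {linear U' -> U''})
    (g : {linear V -> V'}) (g' : {linear V' -> V''}) t :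
  tmap f' g' (tmap f g t) = tmap (f' ∘ f) (g' ∘ g) t.
Proof.
by apply: (tensor_ext (g := tmap f' g' ∘ tmap f g)) => u v; rewrite lcompE !tmapE.
Qed.

Lemma tmap_ext U V U' V' (f f' : {linear U -> U'}) (g g' : {linear V -> V'}) t :
  f =1 f' -> g =1 g' -> tmap f g t = tmap f' g' t.
Proof. by move=> /lin_ext-> /lin_ext->. Qed.

Lemma tmap_id U V (t : tensor U V) : tmap (lid U) (lid V) t = t.
Proof. by apply: (tensor_ext (h := lid _)) => u v; rewrite tmapE. Qed.

Lemma contractl_tmap U V U' V' (f : {linear U -> U'}) (g : {linear V -> V'}) s t :
  contractl V' s (tmap f g t) = g (contractl V (s ∘ f) t).
Proof.
apply: (tensor_ext (g := contractl V' s ∘ tmap f g) (h := g ∘ contractl V (s ∘ f))).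
by move=> u v; rewrite !lcompE tmapE !contractlE linearZ.
Qed.

Lemma contractr_tmap U V U' V' (f : {linear U -> U'}) (g : {linear V -> V'}) s t :
  contractr U' s (tmap f g t) = f (contractr U (s ∘ g) t).
Proof.
apply: (tensor_ext (g := contractr U' s ∘ tmap f g) (h := f ∘ contractr U (s ∘ g))).
by move=> u v; rewrite !lcompE tmapE !contractrE linearZ.
Qed.

Lemma contractl_tmapr U V V' (g : {linear V -> V'}) (s : {linear U -> k^o}) t :
  contractl V' s (tmap (lid U) g t) = g (contractl V s t).
Proof. by rewrite contractl_tmap (lin_ext (f := s ∘ lid U) (g := s)). Qed.

Lemma contractr_tmapl U U' V (f : {linear U -> U'}) (s : {linear V -> k^o}) t :
  contractr U' s (tmap f (lid V) t) = f (contractr U s t).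
Proof. by rewrite contractr_tmap (lin_ext (f := s ∘ lid V) (g := s)). Qed.

(** A finite family has a basis of its span together with biorthogonal
    functionals on the whole space.  When a vector [u] is added, the new
    functional has to see only the component of [u] outside the previous span. *)
Lemma dual_basis U (us : seq U) :
  exists (n : nat) (b : 'I_n -> U) (c : 'I_n -> {linear U -> k^o}),
    [/\ forall i j, c i (b j) = (i == j)%:R,
        forall u, u \in us -> u = \sum_i (c i u : k) *: b i
      & forall C : U -> Prop, (forall a x y, C x -> C y -> C (a *: x + y)) -> C 0 ->
          (forall u, u \in us -> C u) -> forall i, C (b i)].
Proof.
elim: us => [|u us [n [b [c [cb spanb bC]]]]].
  by exists 0, (fun=> 0), (fun=> \0); split=> // -[].
have P_linear : linear (fun x : U => \sum_i (c i x : k) *: b i).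
  move=> a x y; rewrite scaler_sumr -big_split; apply: eq_bigr => i _.
  by rewrite linearP scalerDl scalerA.
pose P := mklin P_linear; pose r := u - P u.
have {}bC (C : U -> Prop) : (forall a x y, C x -> C y -> C (a *: x + y)) -> C 0 ->
    (forall x, x \in u :: us -> C x) -> forall i, C (b i).
  by move=> h h0 hu; apply: bC => // x xus; apply: hu; rewrite inE xus orbT.
have [r0|/functional_exists[t tr]] := eqVneq r 0.
  exists n, b, c; split=> // x; rewrite inE => /predU1P[->|/spanb//].
  by apply/eqP; rewrite -subr_eq0 -[X in _ == X]r0.
have Pb j : P (b j) = b j.
  rewrite /= (bigD1 j) //= cb eqxx scale1r big1 ?addr0 // => i ij.
  by rewrite cb (negPf ij) scale0r.
have cP i x : c i (P x) = c i x.
  rewrite linear_sum (bigD1 i) //= linearZ big1 ?addr0 => [|j ji].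
    by rewrite cb eqxx; apply: mulr1.
  by rewrite linearZ /= cb eq_sym (negPf ji); apply: mulr0.
have Pr : P r = 0.
  rewrite /r linearB [X in _ - X](_ : _ = P u) ?subrr //.
  by apply: eq_bigr => i _; rewrite cP.
pose t' : {linear U -> k^o} := t ∘ ladd (lid U) (lscale (-1) P).
have t'E x : t' x = t (x - P x) by rewrite /t' lcompE laddE lscaleE scaleN1r.
exists n.+1, (fun i => if unlift ord0 i is Some j then b j else r),
  (fun i => if unlift ord0 i is Some j then c j else t'); split.
- move=> i j; case: (unliftP ord0 i) => [i'|] ->; case: (unliftP ord0 j) => [j'|] ->.
  + by rewrite cb (inj_eq lift_inj).
  + by rewrite /r linearB cP subrr.
  + by rewrite t'E Pb subrr linear0.
  + by rewrite t'E Pr subr0 tr eqxx.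
- have sumE x : \sum_i (((if unlift ord0 i is Some j then c j else t') x : k) *:
      (if unlift ord0 i is Some j then b j else r)) = (t' x : k) *: r + P x.
    rewrite big_ord_recl unlift_none; congr (_ + _).
    by apply: eq_bigr => i _; rewrite liftK.
  move=> x; rewrite sumE inE => /predU1P[->|/spanb xE].
    by rewrite t'E tr scale1r subrK.
  have Px : P x = x by rewrite [RHS]xE.
  by rewrite t'E Px subrr linear0 scale0r add0r.
- move=> C h h0 hu i; have hC := bC C h h0 hu; case: (unliftP ord0 i) => [j|] _ //.
  rewrite /r -scaleN1r addrC; apply: (h); last by apply: hu; rewrite inE eqxx.
  rewrite /=; elim/big_ind: _ => [||j _]; first exact: h0.
    by move=> x y hx hy; rewrite -[x]scale1r; apply: h.
  by rewrite -[_ *: _]addr0; apply: h.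
Qed.

Lemma dual_family U (us : seq U) : exists w : seq ({linear U -> k^o} * U),
  forall u, u \in us -> u = \sum_(p <- w) (p.1 u : k) *: p.2.
Proof.
have [n [b [c [_ h _]]]] := dual_basis us.
by exists [seq (c i, b i) | i <- enum 'I_n] => u /h {1}->; rewrite big_map big_enum.
Qed.

Lemma tens_suml U V (J : Type) (r : seq J) (F : J -> U) (v : V) :
  (\sum_(j <- r) F j) ⊗ v = \sum_(j <- r) F j ⊗ v.
Proof. exact: (raddf_sum (mklin (proj1 (tens_bilin U V) v))). Qed.

Lemma tens_sumr U V (J : Type) (r : seq J) (F : J -> V) (u : U) :
  u ⊗ (\sum_(j <- r) F j) = \sum_(j <- r) u ⊗ F j.
Proof. exact: (raddf_sum (mklin (tensl_linear (V := V) u))). Qed.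

Lemma tensor_slicel U V (t : tensor U V) : exists w : seq ({linear U -> k^o} * U),
  t = \sum_(p <- w) p.2 ⊗ contractl V p.1 t.
Proof.
have [s ->] := tensor_sum t.
have [w wE] := dual_family [seq p.1 | p <- s]; exists w.
transitivity (\sum_(q <- s) \sum_(p <- w) ((p.1 q.1 : k) *: p.2) ⊗ q.2).
  rewrite !big_seq; apply: eq_bigr => q qs.
  by rewrite -tens_suml -wE ?map_f.
rewrite exchange_big; apply: eq_bigr => p _.
rewrite linear_sum tens_sumr; apply: eq_bigr => q _.
by rewrite contractlE tensZl tensZr.
Qed.

Lemma contractl_swap U V s (t : tensor U V) :
  contractl U s (tswap t) = contractr U s t.
Proof.
apply: (tensor_ext (g := contractl U s ∘ tswap)) => u v.
by rewrite lcompE /tswap tliftE contractlE contractrE.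
Qed.

Lemma tswapK U V : cancel (@tswap k U V) tswap.
Proof.
move=> t; apply: (tensor_ext (g := tswap ∘ tswap) (h := lid _)) => u v.
by rewrite lcompE /tswap !tliftE.
Qed.

Lemma contractl_sep U V (t t' : tensor U V) :
  (forall s, contractl V s t = contractl V s t') -> t = t'.
Proof.
move=> h; apply/eqP; rewrite -subr_eq0; apply/eqP.
have [w ->] := tensor_slicel (t - t'); rewrite big1 // => p _.
rewrite linearB h subrr; by rewrite -(scale0r 0) tensZr scale0r.
Qed.

Lemma contractr_sep U V (t t' : tensor U V) :
  (forall s, contractr U s t = contractr U s t') -> t = t'.
Proof.
move=> h; apply: (can_inj (@tswapK U V)).
by apply: contractl_sep => s; rewrite !contractl_swap.
Qed.

End Slices.

(** * Comodules as modules over the linear functionals of the coordinate ring *)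

Section TripleTensors.
Context {k : fieldType}.
Implicit Types U V W : lmodType k.

Lemma tensor3_ext U V W (X : lmodType k) (g h : {linear tensor (tensor U V) W -> X}) :
  (forall u v w, g (u ⊗ v ⊗ w) = h (u ⊗ v ⊗ w)) -> g =1 h.
Proof.
move=> e; apply: tensor_ext => x w.
pose i := mklin (proj1 (tens_bilin (tensor U V) W) w).
by apply: (tensor_ext (g := g ∘ i) (h := h ∘ i)) x => u v; apply: e.
Qed.

Lemma tensor3_extV U V W (X : lmodType k) (g h : {linear tensor U (tensor V W) -> X}) :
  (forall u v w, g (u ⊗ (v ⊗ w)) = h (u ⊗ (v ⊗ w))) -> g =1 h.
Proof.
move=> e; apply: tensor_ext => u x.
pose i := mklin (tensl_linear (V := tensor V W) u).
by apply: (tensor_ext (g := g ∘ i) (h := h ∘ i)) x => v w; apply: e.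
Qed.

Lemma contractl_tassoc U V W s (t : tensor (tensor U V) W) :
  contractl (tensor V W) s (tassoc t) = tmap (contractl V s) (lid W) t.
Proof.
apply: (tensor3_ext (g := contractl (tensor V W) s ∘ tassoc)) => u v w.
by rewrite lcompE tassocE tmapE !contractlE tensZl.
Qed.

Lemma contract_mid_tassoc U V W s (t : tensor (tensor U V) W) :
  tmap (lid U) (contractl W s) (tassoc t) = tmap (contractr U s) (lid W) t.
Proof.
apply: (tensor3_ext (g := tmap (lid U) (contractl W s) ∘ tassoc)) => u v w.
by rewrite lcompE tassocE !tmapE contractlE contractrE tensZl tensZr.
Qed.

Lemma contractr_tassocV U V W s (t : tensor U (tensor V W)) :
  contractr (tensor U V) s (tassocV t) = tmap (lid U) (contractr V s) t.
Proof.
apply: (tensor3_extV (g := contractr (tensor U V) s ∘ tassocV)) => u v w.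
by rewrite lcompE tassocVE tmapE !contractrE tensZr.
Qed.

Lemma contract_fubini U V (s : {linear U -> k^o}) (r : {linear V -> k^o}) t :
  r (contractl V s t) = s (contractr U r t).
Proof.
apply: (tensor_ext (g := r ∘ contractl V s) (h := s ∘ contractr U r)) => u v.
rewrite !lcompE contractlE contractrE !linearZ /=.
exact: (mulrC (s u : k)).
Qed.

End TripleTensors.

Section Operators.
Context {k : fieldType}.
Variable S : algGroup k.
Implicit Types X Y M N : bicpx S.

(** The operators x |-> s(x_(-1)) x_0 and x |-> x_0 s(x_1).  Since functionals
    separate points, they carry the same information as the coactions, and
    identities between them involve no reassociation of tensor products. *)
Definition lact M (s : {linear S -> k^o}) : {linear M -> M} :=
  contractl M s ∘ bleft M.
Definition ract M (s : {linear S -> k^o}) : {linear M -> M} :=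
  contractr M s ∘ bright M.

Definition lcolin M N (f : {linear M -> N}) :=
  forall s x, f (lact M s x) = lact N s (f x).
Definition rcolin M N (f : {linear M -> N}) :=
  forall s x, f (ract M s x) = ract N s (f x).
Arguments lcolin : clear implicits.
Arguments rcolin : clear implicits.

Lemma bleft_lcolin M N (f : {linear M -> N}) :
  (forall x, bleft N (f x) = tmap (lid S) f (bleft M x)) -> lcolin M N f.
Proof.
by move=> h s x; rewrite /lact !lcompE h contractl_tmapr.
Qed.

Lemma bright_rcolin M N (f : {linear M -> N}) :
  (forall x, bright N (f x) = tmap f (lid S) (bright M x)) -> rcolin M N f.
Proof.
by move=> h s x; rewrite /ract !lcompE h contractr_tmapl.
Qed.

Lemma lcolin_comp M N (P : bicpx S) (f : {linear M -> N}) (g : {linear N -> P}) :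
  lcolin M N f -> lcolin N P g -> lcolin M P (g ∘ f).
Proof. by move=> hf hg s x; apply: etrans (hg s (f x)); congr (g _); apply: hf. Qed.

Lemma counit_lact s (x : bi_unit S) : counit S (lact (bi_unit S) s x) = s x.
Proof. by rewrite /lact lcompE contract_fubini comul_counit. Qed.

Lemma counit_ract s (x : bi_unit S) : counit S (ract (bi_unit S) s x) = s x.
Proof. by rewrite /ract lcompE -contract_fubini counit_comul. Qed.

Lemma lact_ract_unit (s r : {linear S -> k^o}) (x : S) : r (lact (bi_unit S) s x) = s (ract (bi_unit S) r x).
Proof. exact: contract_fubini. Qed.

Definition act_comm X :=
  forall s r (x : X), lact X s (ract X r x) = ract X r (lact X s x).

Lemma bicpx_act_comm X : is_bicpx X -> act_comm X.
Proof.
move=> hX s r x; rewrite /lact /ract !lcompE.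
have := congr1 (fun t => contractr X r (contractl _ s t)) (bleft_right hX x).
rewrite contractl_tassoc tmap_comp contractr_tmap contractl_tmapr.
by rewrite (lin_ext (f := r ∘ (lid S ∘ lid S)) (g := r)).
Qed.

Lemma bicpx_lactM X (s r : {linear S -> k^o}) (x : X) : is_bicpx X ->
  lact X s (lact X r x) = lact X (s ∘ lact (bi_unit S) r) x.
Proof.
move=> hX; rewrite /lact !lcompE.
have := congr1 (fun t => contractl X s (contractl _ r t)) (bleftA hX x).
rewrite contractl_tassoc tmap_comp contractl_tmap contractl_tmapr.
by move=> <-.
Qed.

Section CotensorProduct.
Variables X Y : bicpx S.

Lemma cotval_inj : injective (cotval X Y).
Proof. exact: val_inj. Qed.

(** The functionals are applied to the middle factor of X ⊗ O ⊗ Y. *)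
Lemma coteq_sep (t : tensor X Y) :
  (forall s, tmap (ract X s) (lid Y) t = tmap (lid X) (lact Y s) t) <-> coteq X Y t = 0.
Proof.
have midE s : tmap (lid X) (contractl Y s) (coteq X Y t) =
    tmap (ract X s) (lid Y) t - tmap (lid X) (lact Y s) t.
  rewrite /coteq /= linearB contract_mid_tassoc !tmap_comp.
  by congr (_ - _); apply: tmap_ext.
split=> [h|h s]; last by apply/eqP; rewrite -subr_eq0 -midE h linear0.
apply: contractl_sep => s; apply: contractl_sep => r.
transitivity (contractl Y s (tmap (lid X) (contractl Y r) (coteq X Y t))).
  by rewrite contractl_tmapr.
by rewrite midE h subrr !linear0.
Qed.

Lemma cotvalP (t : X □ Y) s :
  tmap (ract X s) (lid Y) (cotval X Y t) = tmap (lid X) (lact Y s) (cotval X Y t).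
Proof.
have /coteq_sep h : coteq X Y (cotval X Y t) = 0 by apply/eqP; case: t.
exact: h.
Qed.

Lemma cotretrK (t : tensor X Y) :
  (forall s, tmap (ract X s) (lid Y) t = tmap (lid X) (lact Y s) t) ->
  cotval X Y (cotretr X Y t) = t.
Proof. by move/coteq_sep; apply: kretr_val. Qed.

Lemma cotvalK (t : X □ Y) : cotretr X Y (cotval X Y t) = t.
Proof. exact: kretrK. Qed.

Lemma bleft_cotE (t : X □ Y) : bleft (X □ Y) t =
  tmap (lid S) (cotretr X Y) (tassoc (tmap (bleft X) (lid Y) (cotval X Y t))).
Proof. by []. Qed.

Lemma bright_cotE (t : X □ Y) : bright (X □ Y) t =
  tmap (cotretr X Y) (lid S) (tassocV (tmap (lid X) (bright Y) (cotval X Y t))).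
Proof. by []. Qed.

(** The coactions of [X □ Y] are defined with the help of a retraction onto a
    kernel.  They are the expected ones because the operators of one side commute
    with those of the other, hence preserve the equation of the cotensor product. *)
Lemma cotval_lact : act_comm X ->
  forall s t, cotval X Y (lact (X □ Y) s t) = tmap (lact X s) (lid Y) (cotval X Y t).
Proof.
move=> hX s t.
have -> : lact (X □ Y) s t = cotretr X Y (tmap (lact X s) (lid Y) (cotval X Y t)).
  rewrite /lact lcompE bleft_cotE contractl_tmapr.
  by rewrite contractl_tassoc tmap_comp; congr (cotretr _ _ _); apply: tmap_ext.
rewrite cotretrK // => r; rewrite !tmap_comp.
transitivity (tmap (lact X s) (lid Y) (tmap (ract X r) (lid Y) (cotval X Y t))).
  by rewrite tmap_comp; apply: tmap_ext => // x; rewrite [RHS]hX.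
by rewrite cotvalP tmap_comp; apply: tmap_ext.
Qed.

Lemma cotval_ract : act_comm Y ->
  forall s t, cotval X Y (ract (X □ Y) s t) = tmap (lid X) (ract Y s) (cotval X Y t).
Proof.
move=> hY s t.
have -> : ract (X □ Y) s t = cotretr X Y (tmap (lid X) (ract Y s) (cotval X Y t)).
  rewrite /ract lcompE bright_cotE contractr_tmapl.
  by rewrite contractr_tassocV tmap_comp; congr (cotretr _ _ _); apply: tmap_ext.
rewrite cotretrK // => r; rewrite !tmap_comp.
transitivity (tmap (lid X) (ract Y s) (tmap (lid X) (lact Y r) (cotval X Y t))).
  by rewrite -cotvalP tmap_comp; apply: tmap_ext.
by rewrite tmap_comp; apply: tmap_ext => // y; rewrite [RHS]hY.
Qed.

End CotensorProduct.

Lemma cotval_cotmap X Y X' Y' (f : {linear X -> X'}) (g : {linear Y -> Y'}) t :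
  rcolin X X' f -> lcolin Y Y' g ->
  cotval X' Y' (cotmap f g t) = tmap f g (cotval X Y t).
Proof.
move=> hf hg; rewrite /cotmap !lcompE cotretrK // => s; rewrite !tmap_comp.
transitivity (tmap f g (tmap (ract X s) (lid Y) (cotval X Y t))).
  by rewrite tmap_comp; apply: tmap_ext => // x; rewrite [RHS]hf.
by rewrite cotvalP tmap_comp; apply: tmap_ext => // y; rewrite [LHS]hg.
Qed.

End Operators.

Arguments lcolin {k S} M N f.
Arguments rcolin {k S} M N f.

(** * Gradings *)

Section Gradings.
Context {k : fieldType} {S : algGroup k}.
Implicit Types X : bicpx S.

Definition decomp X (x : X) (s : seq int) (f : int -> X) : Prop :=
  [/\ uniq s, forall p, bdeg X p (f p), forall p, p \notin s -> f p = 0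
    & x = \sum_(p <- s) f p].

Lemma decomp_widen X (x : X) s f u : decomp x s f -> uniq u -> {subset s <= u} ->
  decomp x u f.
Proof.
move=> [us df f0 xE] uu su; split=> // [p pu|].
  by apply: f0; apply: contra pu; apply: su.
rewrite xE [RHS](bigID (mem s)) /= [X in _ = _ + X]big1 ?addr0 => [|p /f0//].
rewrite -[RHS]big_filter; apply: perm_big; apply: uniq_perm => // [|p].
  exact: filter_uniq.
by rewrite mem_filter; have [/su->|] := boolP (p \in s).
Qed.

Lemma absz_sign_succ (p : int) : (-1) ^+ absz (p + 1)%R = - (-1) ^+ absz p :> k.
Proof.
case: p => [n|n]; first by rewrite -PoszD addn1 !absz_nat exprS mulN1r.
rewrite (_ : Negz n + 1 = - n%:Z); last by rewrite NegzE -addn1 PoszD opprD addrNK.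
by rewrite abszN NegzE abszN !absz_nat exprS mulN1r opprK.
Qed.

Variables (X : bicpx S) (hX : is_bicpx X).

Lemma bdegD p x y : bdeg X p x -> bdeg X p y -> bdeg X p (x + y).
Proof. by move=> hx hy; rewrite -[x]scale1r; apply: (bdeg_lin hX). Qed.

Lemma bdegZ p a x : bdeg X p x -> bdeg X p (a *: x).
Proof. by move=> hx; rewrite -[_ *: _]addr0; apply: (bdeg_lin hX) => //; apply: (bdeg_zero hX). Qed.

Lemma decomp_exists (x : X) : exists f, exists s, decomp x s f.
Proof.
have [s [f [df ->]]] := bdeg_span hX x.
exists (fun p => f p *+ count_mem p s), (undup s); split=> [|p|p|].
- exact: undup_uniq.
- by rewrite -scaler_nat; apply: bdegZ.
- by rewrite mem_undup => /count_memPn->.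
- by rewrite big_undup_iterop_count.
Qed.

Lemma decomp_unique (x : X) s f s' f' : decomp x s f -> decomp x s' f' -> f =1 f'.
Proof.
move=> hf hf'; pose u := undup (s ++ s').
have uu : uniq u by apply: undup_uniq.
have [|_ df f0 xE] := decomp_widen hf uu; first by move=> p ps; rewrite mem_undup mem_cat ps.
have [|_ df' f0' xE'] := decomp_widen hf' uu.
  by move=> p ps; rewrite mem_undup mem_cat ps orbT.
move=> p; have [pu|pu] := boolP (p \in u); last by rewrite f0 // f0'.
apply/eqP; rewrite -subr_eq0; apply/eqP.
apply: (bdeg_direct (f := fun p => f p - f' p) hX uu) => // [q _|].
  by rewrite -scaleN1r addrC; apply: (bdeg_lin hX).
by rewrite sumrB -xE -xE' subrr.
Qed.

Definition component (x : X) : int -> X := projT1 (cid (decomp_exists x)).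

Lemma componentP x : exists s, decomp x s (component x).
Proof. exact: (projT2 (cid (decomp_exists x))). Qed.

Lemma component_linear p : linear (fun x => component x p).
Proof.
move=> a x y; have [s hx] := componentP x; have [s' hy] := componentP y.
have [s'' hxy] := componentP (a *: x + y).
pose u := undup (s ++ s'); have uu : uniq u by apply: undup_uniq.
have [|_ dx x0 xE] := decomp_widen hx uu; first by move=> q qs; rewrite mem_undup mem_cat qs.
have [|_ dy y0 yE] := decomp_widen hy uu.
  by move=> q qs; rewrite mem_undup mem_cat qs orbT.
apply: (decomp_unique (f' := fun p => a *: component x p + component y p) hxy (s' := u)).
split=> // [q|q qu|].
- by apply: (bdeg_lin hX).
- by rewrite x0 // y0 // scaler0 addr0.
- by rewrite big_split -scaler_sumr -xE -yE.
Qed.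

Definition gproj p : {linear X -> X} := mklin (component_linear p).

Lemma gproj_deg p x : bdeg X p (gproj p x).
Proof. by have [s []] := componentP x. Qed.

Lemma gproj_homog p q x : bdeg X q x -> gproj p x = if p == q then x else 0.
Proof.
move=> hx; have [s hs] := componentP x.
apply: (decomp_unique (f' := fun p => if p == q then x else 0) hs (s' := [:: q])).
split=> // [r|r|]; last by rewrite big_seq1 eqxx.
  by case: eqP => [->//|_]; apply: (bdeg_zero hX).
by rewrite inE => /negPf->.
Qed.

Lemma gproj_sum (x : X) : exists s : seq int, forall u, uniq u -> {subset s <= u} ->
  x = \sum_(p <- u) gproj p x.
Proof.
have [s hs] := componentP x; exists s => u uu su.
by have [] := decomp_widen hs uu su.
Qed.

Lemma homog_ext (W : lmodType k) (f g : {linear X -> W}) :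
  (forall p x, bdeg X p x -> f x = g x) -> f =1 g.
Proof.
move=> h x; have [s /(_ (undup s) (undup_uniq s))] := gproj_sum x.
move=> -> => [|p]; last by rewrite mem_undup.
by rewrite !linear_sum; apply: eq_bigr => p _; apply: h (gproj_deg _ _).
Qed.

Lemma lact_deg s p x : bdeg X p x -> bdeg X p (lact X s x).
Proof.
move=> /(bleft_deg hX) [t [ht e]]; rewrite /lact lcompE e linear_sum big_seq.
elim/big_ind: _ => [|y z|z zt]; [exact: (bdeg_zero hX)|exact: bdegD|].
rewrite contractlE; have [q [r [<- [->|->] hr]]] := ht z zt.
  by rewrite add0r; apply: bdegZ.
by rewrite linear0 scale0r; apply: (bdeg_zero hX).
Qed.

Lemma ract_deg s p x : bdeg X p x -> bdeg X p (ract X s x).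
Proof.
move=> /(bright_deg hX) [t [ht e]]; rewrite /ract lcompE e linear_sum big_seq.
elim/big_ind: _ => [|y z|z zt]; [exact: (bdeg_zero hX)|exact: bdegD|].
rewrite contractrE; have [q [r [<- hr [->|->]]]] := ht z zt.
  by rewrite addr0; apply: bdegZ.
by rewrite linear0 scale0r; apply: (bdeg_zero hX).
Qed.

Lemma gproj_rcolin p : rcolin X X (gproj p).
Proof.
move=> s; apply: (homog_ext (f := gproj p ∘ ract X s) (g := ract X s ∘ gproj p)) => q x hx.
rewrite -[LHS]/(gproj p (ract X s x)) -[RHS]/(ract X s (gproj p x)).
rewrite (gproj_homog _ hx) (gproj_homog _ (ract_deg s hx)).
by case: eqP; rewrite ?linear0.
Qed.

Lemma gproj_lcolin p : lcolin X X (gproj p).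
Proof.
move=> s; apply: (homog_ext (f := gproj p ∘ lact X s) (g := lact X s ∘ gproj p)) => q x hx.
rewrite -[LHS]/(gproj p (lact X s x)) -[RHS]/(lact X s (gproj p x)).
rewrite (gproj_homog _ hx) (gproj_homog _ (lact_deg s hx)).
by case: eqP; rewrite ?linear0.
Qed.

Lemma bsgn_deg p x : bdeg X p x -> bdeg X p (bsgn X x).
Proof. by move=> hx; rewrite (bsgnE hX hx); apply: bdegZ. Qed.

Lemma bsgn_rcolin : rcolin X X (bsgn X).
Proof.
move=> s; apply: (homog_ext (f := bsgn X ∘ ract X s) (g := ract X s ∘ bsgn X)) => q x hx.
rewrite -[LHS]/(bsgn X (ract X s x)) -[RHS]/(ract X s (bsgn X x)).
by rewrite (bsgnE hX hx) (bsgnE hX (ract_deg s hx)) linearZ.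
Qed.

Lemma bsgn_lcolin : lcolin X X (bsgn X).
Proof.
move=> s; apply: (homog_ext (f := bsgn X ∘ lact X s) (g := lact X s ∘ bsgn X)) => q x hx.
rewrite -[LHS]/(bsgn X (lact X s x)) -[RHS]/(lact X s (bsgn X x)).
by rewrite (bsgnE hX hx) (bsgnE hX (lact_deg s hx)) linearZ.
Qed.

Lemma bsgn_bdif x : bsgn X (bdif X x) = - bdif X (bsgn X x).
Proof.
rewrite -[RHS]scaleN1r.
apply: (homog_ext (f := bsgn X ∘ bdif X) (g := lscale (-1) (bdif X ∘ bsgn X))) => p y hy.
rewrite lcompE lscaleE lcompE (bsgnE hX hy) (bsgnE hX (bdif_deg hX hy)) linearZ.
by rewrite absz_sign_succ scalerA mulN1r.
Qed.

End Gradings.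

Section TensorDegree.
Context {k : fieldType}.
Implicit Types M N : lmodType k.

Lemma tdeg0 M N (dM : int -> M -> Prop) (dN : int -> N -> Prop) n : tdeg dM dN n 0.
Proof. by exists [::]; rewrite big_nil. Qed.

Lemma tdegP M N (dM : int -> M -> Prop) (dN : int -> N -> Prop) n a t t' :
  (forall p b x, dM p x -> dM p (b *: x)) ->
  tdeg dM dN n t -> tdeg dM dN n t' -> tdeg dM dN n (a *: t + t').
Proof.
move=> hZ [s [hs ->]] [s' [hs' ->]].
exists ([seq (a *: z.1, z.2) | z <- s] ++ s'); split=> [z|].
  rewrite mem_cat => /orP[/mapP[y /hs[p [q [<- hp hq]]] ->]|/hs'//].
  by exists p, q; split=> //; apply: hZ.
rewrite big_cat big_map scaler_sumr; congr (_ + _).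
by apply: eq_bigr => z _; rewrite tensZl.
Qed.

Lemma tdeg_tmap M N M' N' (dM : int -> M -> Prop) (dN : int -> N -> Prop)
    (dM' : int -> M' -> Prop) (dN' : int -> N' -> Prop)
    (f : {linear M -> M'}) (g : {linear N -> N'}) i j n t :
  (forall p x, dM p x -> dM' (p + i) (f x)) ->
  (forall q y, dN q y -> dN' (q + j) (g y)) ->
  tdeg dM dN n t -> tdeg dM' dN' (n + (i + j)) (tmap f g t).
Proof.
move=> hf hg [s [hs ->]]; exists [seq (f z.1, g z.2) | z <- s]; split=> [z|].
  move=> /mapP[y /hs[p [q [<- hp hq]]] ->].
  by exists (p + i), (q + j); split; [rewrite addrACA|apply: hf|apply: hg].
by rewrite linear_sum big_map; apply: eq_bigr => z _; rewrite tmapE.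
Qed.

Lemma tdeg_tmap0 M N M' N' (dM : int -> M -> Prop) (dN : int -> N -> Prop)
    (dM' : int -> M' -> Prop) (dN' : int -> N' -> Prop)
    (f : {linear M -> M'}) (g : {linear N -> N'}) n t :
  (forall p x, dM p x -> dM' p (f x)) -> (forall q y, dN q y -> dN' q (g y)) ->
  tdeg dM dN n t -> tdeg dM' dN' n (tmap f g t).
Proof.
move=> hf hg ht; rewrite -[n]addr0 -[X in n + X]addr0; apply: tdeg_tmap ht.
- by move=> p x; rewrite addr0; apply: hf.
- by move=> q y; rewrite addr0; apply: hg.
Qed.

Lemma tdeg_contractl M N (dM : int -> M -> Prop) (dN : int -> N -> Prop)
    (s : {linear M -> k^o}) n t :
  (forall p a x y, dN p x -> dN p y -> dN p (a *: x + y)) -> (forall p, dN p 0) ->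
  (forall p x, p <> 0 -> dM p x -> s x = 0) ->
  tdeg dM dN n t -> dN n (contractl N s t).
Proof.
move=> hlin h0 hs [z [hz ->]]; rewrite linear_sum big_seq.
elim/big_ind: _ => [|x y hx hy|y /hz[p [q [<- hp hq]]]].
- exact: h0.
- by rewrite -[x]scale1r; apply: hlin.
- have [p0|/eqP p0] := eqVneq p 0; last by rewrite contractlE (hs p) // scale0r.
  by rewrite p0 add0r contractlE -[_ *: _]addr0; apply: hlin.
Qed.

Lemma tdeg_contractr M N (dM : int -> M -> Prop) (dN : int -> N -> Prop)
    (s : {linear N -> k^o}) n t :
  (forall p a x y, dM p x -> dM p y -> dM p (a *: x + y)) -> (forall p, dM p 0) ->
  (forall p x, p <> 0 -> dN p x -> s x = 0) ->
  tdeg dM dN n t -> dM n (contractr M s t).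
Proof.
move=> hlin h0 hs [z [hz ->]]; rewrite linear_sum big_seq.
elim/big_ind: _ => [|x y hx hy|y /hz[q [p [<- hq hp]]]].
- exact: h0.
- by rewrite -[x]scale1r; apply: hlin.
- have [p0|/eqP p0] := eqVneq p 0; last by rewrite contractrE (hs p) // scale0r.
  by rewrite p0 addr0 contractrE -[_ *: _]addr0; apply: hlin.
Qed.

End TensorDegree.

(** * Complexes of left comodules *)

Section LeftComplexes.
Context {k : fieldType} {S : algGroup k}.
Implicit Types X M N : bicpx S.

(** The structure that A ⊗_O M inherits from A and from the same structure on M,
    and that can therefore be carried along the powers of A. *)
Record lcpx M : Prop := Lcpx {
  lcpx_counit : forall x, lact M (counit S) x = x;
  lcpx_mul : forall s r x, lact M s (lact M r x) = lact M (s ∘ lact (bi_unit S) r) x;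
  lcpx_dif : lcolin M M (bdif M);
  lcpx_deg : forall p s x, bdeg M p x -> bdeg M p (lact M s x);
  lcpx_lin : forall p a x y, bdeg M p x -> bdeg M p y -> bdeg M p (a *: x + y);
  lcpx_zero : forall p, bdeg M p 0;
  lcpx_dif_deg : forall p x, bdeg M p x -> bdeg M (p + 1) (bdif M x);
  lcpx_dif_sq : forall x, bdif M (bdif M x) = 0
}.

Lemma lcpx_bicpx X : is_bicpx X -> lcpx X.
Proof.
move=> hX; split.
- by move=> x; rewrite /lact lcompE (bleft1 hX).
- by move=> s r x; apply: bicpx_lactM.
- by apply: bleft_lcolin; apply: (bleft_dif hX).
- by move=> p s x; apply: lact_deg.
- exact: (bdeg_lin hX).
- exact: (bdeg_zero hX).
- exact: (bdif_deg hX).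
- exact: (bdif_sq hX).
Qed.


Lemma lcpx_unit : lcpx (bi_unit S).
Proof.
have Zdeg0 p a (x : S) : deg0 p x -> deg0 p (a *: x).
  by move=> [->|->]; [left|right; rewrite scaler0].
split=> //.
- by move=> x; rewrite /lact lcompE counit_comul.
- move=> s r x; rewrite /lact !lcompE.
  have := congr1 (fun t => contractl S s (contractl _ r t)) (comulA x).
  by rewrite contractl_tassoc tmap_comp contractl_tmap contractl_tmapr => <-.
- by move=> s x; rewrite linear0.
- by move=> p s x [->|->]; [left|right; rewrite linear0].
- by move=> p a x y [->|->] [e|->]; [left|left|left|right; rewrite scaler0 addr0].
- by right.
- by right.
Qed.

Lemma cot_bdeg X M p (t : X □ M) :
  bdeg (X □ M) p t = tdeg (bdeg X) (bdeg M) p (cotval X M t).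
Proof. by []. Qed.

Section CotensorComplex.
Variables (X M : bicpx S) (hX : is_bicpx X) (hM : lcpx M).

Lemma cotval_bdif (t : X □ M) : cotval X M (bdif (X □ M) t) =
  tmap (bdif X) (lid M) (cotval X M t) + tmap (bsgn X) (bdif M) (cotval X M t).
Proof.
apply: (cotretrK (t := _ + _)) => s; rewrite !linearD; congr (_ + _).
  transitivity (tmap (bdif X) (lid M) (tmap (ract X s) (lid M) (cotval X M t))).
    rewrite !tmap_comp; apply: tmap_ext => // x.
    by apply: esym; apply: bright_rcolin; apply: (bright_dif hX).
  by rewrite cotvalP !tmap_comp; apply: tmap_ext.
transitivity (tmap (bsgn X) (bdif M) (tmap (ract X s) (lid M) (cotval X M t))).
  rewrite !tmap_comp; apply: tmap_ext => // x.
  by apply: esym; apply: bsgn_rcolin.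
rewrite cotvalP !tmap_comp; apply: tmap_ext => // x; exact: (lcpx_dif hM).
Qed.

Lemma lcpx_cotensor : lcpx (X □ M).
Proof.
have cX := bicpx_act_comm hX; have lX := lcpx_bicpx hX.
have lactE s t := cotval_lact (Y := M) cX s t.
have Zdeg p b (x : X) : bdeg X p x -> bdeg X p (b *: x) by apply: bdegZ.
split.
- move=> t; apply: cotval_inj; rewrite lactE -[RHS]tmap_id.
  by apply: tmap_ext => // x; apply: (lcpx_counit lX).
- move=> s r t; apply: cotval_inj; rewrite !lactE tmap_comp.
  by apply: tmap_ext => // x; apply: (lcpx_mul lX).
- move=> s t; apply: cotval_inj; rewrite lactE !cotval_bdif !lactE linearD !tmap_comp.
  congr (_ + _); apply: tmap_ext => // x; first exact: (lcpx_dif lX).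
  exact: bsgn_lcolin.
- move=> p s t; rewrite !cot_bdeg => ht; rewrite lactE; apply: tdeg_tmap0 ht => // q x.
  exact: lact_deg.
- by move=> p a x y; rewrite !cot_bdeg linearP; apply: tdegP.
- by move=> p; rewrite !cot_bdeg linear0; apply: tdeg0.
- move=> p t; rewrite !cot_bdeg cotval_bdif => ht.
  rewrite -[X in tdeg _ _ _ (X + _)]scale1r; apply: tdegP => //.
    rewrite -[X in tdeg _ _ (p + X)]addr0; apply: tdeg_tmap ht; last by move=> q x; rewrite addr0.
    exact: (bdif_deg hX).
  rewrite -[X in tdeg _ _ (p + X)]add0r; apply: tdeg_tmap ht; last exact: (lcpx_dif_deg hM).
  by move=> q x; rewrite addr0; apply: bsgn_deg.
- move=> t; apply: cotval_inj; rewrite cotval_bdif cotval_bdif !linearD !tmap_comp linear0.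
  rewrite [X in X + _ + _](_ : _ = 0); last first.
    rewrite (lin_ext (f := bdif X ∘ bdif X) (g := \0)) => [|x]; last exact: (bdif_sq hX).
    apply: (tensor_ext (h := \0)) => x m; rewrite tmapE /=.
    by rewrite -(scale0r 0) tensZl scale0r.
  rewrite [X in _ + (_ + X)](_ : _ = 0); last first.
    rewrite (lin_ext (f := bdif M ∘ bdif M) (g := \0)) => [|x]; last exact: (lcpx_dif_sq hM).
    apply: (tensor_ext (h := \0)) => x m; rewrite tmapE /=.
    by rewrite -(scale0r 0) tensZr scale0r.
  rewrite add0r addr0.
  apply: (tensor_ext (g := ladd (tmap (bdif X ∘ bsgn X) (lid M ∘ bdif M))
    (tmap (bsgn X ∘ bdif X) (bdif M ∘ lid M))) (h := \0)) => x m.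
  rewrite laddE !tmapE !lcompE (bsgn_bdif hX) -scaleN1r tensZl.
  by rewrite scaleN1r subrr.
Qed.

End CotensorComplex.

Record lhom M N (f : {linear M -> N}) : Prop := Lhom {
  lhom_lin : lcolin M N f;
  lhom_dif : forall x, f (bdif M x) = bdif N (f x);
  lhom_deg : forall p x, bdeg M p x -> bdeg N p (f x)
}.

End LeftComplexes.

(** * The augmentation as a linear functional *)

Section DirectSums.
Context {k : fieldType}.
Variables (J : choiceType) (M : J -> lmodType k).

Lemma dsumD (x y : dsum M) i : (x + y) i = x i + y i.
Proof. exact: (linearD (mklin (@dproj_linear _ _ M i))). Qed.

Lemma dsumZ c (x : dsum M) i : (c *: x) i = c *: x i.
Proof. exact: (linearZ_LR (mklin (@dproj_linear _ _ M i))). Qed.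

Lemma dsum_finite (x : dsum M) : exists2 s : seq J, uniq s & forall i, x i != 0 -> i \in s.
Proof.
have /finite_seqP[s e] := dsumP x; exists (undup s) => [|i h]; first exact: undup_uniq.
by rewrite mem_undup; have : [set i | x i != 0]%classic i by []; rewrite e.
Qed.

Lemma dsum_sum (x : dsum M) (s : seq J) : uniq s -> (forall i, x i != 0 -> i \in s) ->
  x = \sum_(i <- s) din M i (x i).
Proof.
move=> us hs; apply: dsum_ext => j.
rewrite -[RHS]/(mklin (@dproj_linear _ _ M j) _) linear_sum.
have [js|js] := boolP (j \in s); last first.
  rewrite big_seq big1 => [|i si].
    by apply/eqP; apply: contraNT js; apply: hs.
  by apply: din_ne => e; rewrite -e si in js.
rewrite (big_rem j) //= -[din_fun _ _]/(din M j (x j) j) din_id.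
rewrite big_seq big1 ?addr0 // => i; rewrite mem_rem_uniq // inE => /andP[/eqP ij _].
exact: din_ne.
Qed.

Lemma dsum_lin_ext (W : lmodType k) (f g : {linear dsum M -> W}) :
  (forall i m, f (din M i m) = g (din M i m)) -> f =1 g.
Proof.
move=> h x; have [s us hs] := dsum_finite x.
by rewrite (dsum_sum us hs) !linear_sum; apply: eq_bigr => i _; apply: h.
Qed.

End DirectSums.

Section HomOO.
Context {k : fieldType} {S : algGroup k} {I : choiceType} (V : irrSystem S I).
Local Notation bi_hom := (bi_hom V).

Lemma homOO_ext (W : lmodType k) (f g : {linear homOO V -> W}) :
  (forall a b (v : rvec (V a)) (F : rhom (V a) (V b)) (w : rdual (V b)),
    f (hom_in v F w) = g (hom_in v F w)) -> f =1 g.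
Proof.
move=> h; apply: dsum_lin_ext => -[a b] m.
apply: (tensor3_extV (g := f ∘ din (hom_summand V) (a, b))
  (h := g ∘ din (hom_summand V) (a, b))) => v F w.
exact: h.
Qed.

Lemma hom_evr_in a b (v : rvec (V a)) (F : rhom (V a) (V b)) (w : rdual (V b)) :
  hom_evr V (hom_in v F w) = din (pw_summand V) b ((v *m F : rvec (V b)) ⊗ w).
Proof. by rewrite /hom_evr /hom_in dliftE !lcompE tassocVE tmapE tliftE. Qed.

Lemma hom_evl_in a b (v : rvec (V a)) (F : rhom (V a) (V b)) (w : rdual (V b)) :
  hom_evl V (hom_in v F w) = din (pw_summand V) a (v ⊗ (F *m w : rdual (V a))).
Proof. by rewrite /hom_evl /hom_in dliftE !lcompE tmapE tliftE. Qed.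

Lemma pw_coef_din a t : pw_coef V (din (pw_summand V) a t) = coef (V a) t.
Proof. exact: dliftE. Qed.

Lemma functional_coef (R : rep S) (s : {linear S -> k^o}) (v : rvec R) (w : rdual R) :
  s (coef R (v ⊗ w)) = (v *m map_mx s (rmx R) *m w) 0 0.
Proof.
rewrite tliftE linear_sum -mulmxA !mxE; apply: eq_bigr => i _.
rewrite linear_sum !mxE mulr_sumr; apply: eq_bigr => j _.
rewrite linearZ !mxE -[LHS]/(v 0 i * w j 0 * (s (rmx R i j) : k)).
by rewrite -mulrA [w j 0 * _]mulrC.
Qed.

Lemma counit_rmx (R : rep S) : map_mx (counit S) (rmx R) = 1%:M.
Proof. by apply/matrixP => i j; rewrite !mxE rep_counit. Qed.

Lemma counit_coef (R : rep S) (v : rvec R) (w : rdual R) :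
  counit S (coef R (v ⊗ w)) = (v *m w) 0 0.
Proof. by rewrite functional_coef counit_rmx mulmx1. Qed.

Lemma contractr_coact_dual (R : rep S) s (w : rdual R) :
  contractr (rdual R) s (coact_dual R w) = map_mx s (rmx R) *m w.
Proof.
apply/matrixP => i z; rewrite (ord1 z).
rewrite linear_sum summxE (bigD1 i) //= [X in _ + X]big1 ?addr0 => [|l li].
  rewrite linear_sum summxE !mxE; apply: eq_bigr => j _.
  by rewrite contractrE !mxE !eqxx mulr1 linearZ; apply: mulrC.
rewrite linear_sum summxE big1 // => j _.
by rewrite contractrE !mxE eq_sym (negPf li) mulr0.
Qed.

Lemma contractl_coact (R : rep S) s (v : rvec R) :
  contractl (rvec R) s (coact R v) = v *m map_mx s (rmx R).
Proof.
apply/matrixP => z j; rewrite (ord1 z).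
rewrite linear_sum summxE !mxE; apply: eq_bigr => i _.
rewrite linear_sum summxE (bigD1 j) //= [X in _ + X]big1 ?addr0 => [|l lj].
  by rewrite contractlE !mxE !eqxx mulr1 linearZ.
by rewrite contractlE !mxE eq_sym (negPf lj) andbF mulr0.
Qed.

Lemma ract_hom_in s a b (v : rvec (V a)) (F : rhom (V a) (V b)) (w : rdual (V b)) :
  ract bi_hom s (hom_in v F w) = hom_in v F (map_mx s (rmx (V b)) *m w : rdual (V b)).
Proof.
rewrite /ract lcompE /= /hom_right /hom_in dliftE !lcompE tmapE lcompE tmapE.
by rewrite contractr_tmapl contractr_tassocV tmapE contractr_tassocV tmapE contractr_coact_dual.
Qed.

Lemma lact_hom_in s a b (v : rvec (V a)) (F : rhom (V a) (V b)) (w : rdual (V b)) :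
  lact bi_hom s (hom_in v F w) = hom_in (v *m map_mx s (rmx (V a)) : rvec (V a)) F w.
Proof.
rewrite /lact lcompE /= /hom_left /hom_in dliftE !lcompE tmapE.
by rewrite contractl_tmapr contractl_tassoc tmapE contractl_coact.
Qed.

(** The functional v ⊗ F ⊗ w |-> w(F(v)). *)
Definition hom_eval : {linear homOO V -> k^o} := counit S ∘ (pw_coef V ∘ hom_evr V).

Lemma hom_eval_in a b (v : rvec (V a)) (F : rhom (V a) (V b)) (w : rdual (V b)) :
  hom_eval (hom_in v F w) = (v *m F *m w) 0 0.
Proof. by rewrite /hom_eval !lcompE hom_evr_in pw_coef_din counit_coef. Qed.

Lemma functional_evr (s : {linear S -> k^o}) h :
  s (pw_coef V (hom_evr V h)) = hom_eval (ract bi_hom s h).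
Proof.
apply: (homOO_ext (f := s ∘ (pw_coef V ∘ hom_evr V)) (g := hom_eval ∘ ract bi_hom s)).
move=> a b v F w; rewrite 3!lcompE -[RHS]/(hom_eval (ract bi_hom s (hom_in v F w))).
by rewrite ract_hom_in hom_eval_in hom_evr_in pw_coef_din functional_coef !mulmxA.
Qed.

Lemma functional_evl (s : {linear S -> k^o}) h :
  s (pw_coef V (hom_evl V h)) = hom_eval (lact bi_hom s h).
Proof.
apply: (homOO_ext (f := s ∘ (pw_coef V ∘ hom_evl V)) (g := hom_eval ∘ lact bi_hom s)).
move=> a b v F w; rewrite 3!lcompE -[RHS]/(hom_eval (lact bi_hom s (hom_in v F w))).
by rewrite lact_hom_in hom_eval_in hom_evl_in pw_coef_din functional_coef !mulmxA.
Qed.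

(** On v ⊗ F ⊗ w and v' ⊗ G ⊗ w' both sides are w(F(v)) w'(G(v')). *)
Lemma hom_eval_glue (h h' : homOO V) :
  hom_eval (hom_glue V (tmap (hom_evl V) (hom_evr V) (h ⊗ h'))) =
  (hom_eval h : k) * hom_eval h'.
Proof.
pose m1 := hom_eval ∘ (hom_glue V ∘ tmap (hom_evl V) (hom_evr V)).
pose l1 h' : {linear homOO V -> k^o} :=
  m1 ∘ mklin (proj1 (tens_bilin (homOO V) (homOO V)) h').
pose l2 h : {linear homOO V -> k^o} := m1 ∘ mklin (tensl_linear (V := homOO V) h).
apply: etrans (mulrC (hom_eval h' : k) (hom_eval h)).
apply: (homOO_ext (f := l1 h') (g := lscale (hom_eval h' : k) hom_eval)) => a b v F w.
rewrite lscaleE; apply: etrans (mulrC (hom_eval (hom_in v F w) : k) (hom_eval h')).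
apply: (homOO_ext (f := l2 (hom_in v F w)) (g := lscale (hom_eval (hom_in v F w) : k) hom_eval)).
move=> c d v' G w'; rewrite lscaleE -[LHS]/(hom_eval (hom_glue V (tmap (hom_evl V) (hom_evr V)
  (hom_in v F w ⊗ hom_in v' G w')))).
transitivity (hom_eval (hom_in v ((F *m w) *m (v' *m G) : rhom (V a) (V d)) w')).
  congr (GRing.Linear.sort _ _).
  rewrite tmapE hom_evl_in hom_evr_in /hom_glue dlift2E !lcompE tassocE tmapE lcompE.
  by rewrite tassocVE tmapE tliftE.
rewrite !hom_eval_in (_ : _ *m _ *m w' = (v *m F *m w) *m (v' *m G *m w')).
  by rewrite mxE big_ord1.
by rewrite !mulmxA.
Qed.

End HomOO.

(** * The operations on cotensor products behind the bar construction *)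

Section CotensorMaps.
Context {k : fieldType} {S : algGroup k}.
Implicit Types X M N : bicpx S.

Lemma lcolin_bleft M N (f : {linear M -> N}) : lcolin M N f ->
  forall x, bleft N (f x) = tmap (lid S) f (bleft M x).
Proof.
move=> hf x; apply: contractl_sep => s.
by rewrite contractl_tmapr; apply/esym: (hf s x).
Qed.

Lemma tassocV_nat (U V W U' V' W' : lmodType k) (f : {linear U -> U'}) (g : {linear V -> V'})
    (h : {linear W -> W'}) (t : tensor U (tensor V W)) :
  tmap (tmap f g) h (tassocV t) = tassocV (tmap f (tmap g h) t).
Proof.
apply: (tensor3_extV (g := tmap (tmap f g) h ∘ tassocV)
  (h := tassocV ∘ tmap f (tmap g h))) => u v w.
by rewrite !lcompE tassocVE !tmapE tassocVE.
Qed.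

Lemma cotval_bsgn X Y (t : X □ Y) : is_bicpx X -> is_bicpx Y ->
  cotval X Y (bsgn (X □ Y) t) = tmap (bsgn X) (bsgn Y) (cotval X Y t).
Proof. by move=> hX hY; apply: cotval_cotmap; [apply: bsgn_rcolin|apply: bsgn_lcolin]. Qed.

Variables (X : bicpx S) (hX : is_bicpx X).
Let cX : act_comm X := bicpx_act_comm hX.

(** Evaluation of the last factor: [ev s (x ⊗ m) = s m *: x].  These maps are
    left colinear whatever [s] is, and separate the points of [X □ M]. *)
Definition ev M (s : {linear M -> k^o}) : {linear X □ M -> X} :=
  contractr X s ∘ cotval X M.

Lemma evE M s (t : X □ M) : ev s t = contractr X s (cotval X M t).
Proof. by []. Qed.

Lemma ev_lcolin M (s : {linear M -> k^o}) : lcolin (X □ M) X (ev s).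
Proof. by move=> r t; rewrite !evE cotval_lact // contractr_tmapl. Qed.

Lemma ev_sep M (t t' : X □ M) : (forall s, ev s t = ev s t') -> t = t'.
Proof. by move=> h; apply: cotval_inj; apply: contractr_sep. Qed.

Definition cotr M N (f : {linear M -> N}) : {linear X □ M -> X □ N} :=
  cotmap (lid X) f.

Lemma cotval_cotr M N (f : {linear M -> N}) t : lcolin M N f ->
  cotval X N (cotr f t) = tmap (lid X) f (cotval X M t).
Proof. by move=> hf; apply: cotval_cotmap. Qed.

Lemma ev_cotr M N (f : {linear M -> N}) s t : lcolin M N f ->
  ev s (cotr f t) = ev (s ∘ f) t.
Proof. by move=> hf; rewrite !evE cotval_cotr // contractr_tmap. Qed.

Lemma cotr_ext M N (f g : {linear M -> N}) t : f =1 g -> cotr f t = cotr g t.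
Proof. by move=> /lin_ext->. Qed.

Lemma cotr_comp M N (P : bicpx S) (f : {linear M -> N}) (g : {linear N -> P}) t :
  lcolin M N f -> lcolin N P g -> cotr g (cotr f t) = cotr (g ∘ f) t.
Proof.
move=> hf hg; apply: cotval_inj; rewrite !cotval_cotr //; last first.
  exact: lcolin_comp hg.
by rewrite tmap_comp; apply: tmap_ext.
Qed.

Lemma cotr_id M t : cotr (lid M) t = t.
Proof. by apply: cotval_inj; rewrite cotval_cotr // tmap_id. Qed.

Lemma cotr_lcolin M N (f : {linear M -> N}) : lcolin M N f ->
  lcolin (X □ M) (X □ N) (cotr f).
Proof.
move=> hf s t; apply: cotval_inj; rewrite cotval_cotr // !cotval_lact //.
by rewrite cotval_cotr // !tmap_comp; apply: tmap_ext.
Qed.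

Lemma cotr_lhom M N (f : {linear M -> N}) : lcpx M -> lcpx N -> lhom f -> lhom (cotr f).
Proof.
move=> hM hN [hf df gf]; split; first exact: cotr_lcolin.
- move=> t; apply: cotval_inj.
  rewrite cotval_cotr // !cotval_bdif // cotval_cotr // linearD !tmap_comp.
  by congr (_ + _); apply: tmap_ext.
- by move=> p t; rewrite !cot_bdeg cotval_cotr //; apply: tdeg_tmap0.
Qed.

End CotensorMaps.

Arguments cotr {k S} X {M N} f.

Section Reassociation.
Context {k : fieldType} {S : algGroup k}.
Variables (X Y M : bicpx S) (hX : is_bicpx X) (hY : is_bicpx Y).

(** Reassociation on cotensor products is the restriction of that on tensor
    products; to see that its value lies in [(X □ Y) ⊗ M], evaluate at all the
    functionals of [M]. *)
Lemma cotval_cotassocV (t : X □ (Y □ M)) :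
  tmap (cotval X Y) (lid M) (cotval (X □ Y) M (cotassocV X Y M t)) =
  tassocV (tmap (lid X) (cotval Y M) (cotval X (Y □ M) t)).
Proof.
set w := tassocV _.
have wE : tmap (cotval X Y) (lid M) (tmap (cotretr X Y) (lid M) w) = w.
  apply: contractr_sep => s; rewrite !contractr_tmapl.
  have -> : contractr (tensor X Y) s w =
      cotval X Y (cotr X (ev Y s) t).
    rewrite contractr_tassocV tmap_comp cotval_cotr; first by apply: tmap_ext.
    exact: ev_lcolin.
  by rewrite cotvalK.
suff -> : cotval (X □ Y) M (cotassocV X Y M t) = tmap (cotretr X Y) (lid M) w by [].
apply: cotretrK => s; apply: (can_inj (g := tmap (cotretr X Y) (lid M))
  (f := tmap (cotval X Y) (lid M))) => [z|].
  by rewrite tmap_comp -[RHS]tmap_id; apply: tmap_ext => // x; apply: cotvalK.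
transitivity (tmap (tmap (lid X) (ract Y s)) (lid M) w).
  rewrite -[in RHS]wE !tmap_comp; apply: tmap_ext => // x.
  by rewrite !lcompE cotval_ract //; apply: bicpx_act_comm.
transitivity (tmap (tmap (lid X) (lid Y)) (lact M s) w); last first.
  rewrite -[in LHS]wE !tmap_comp; apply: tmap_ext => // x.
  by rewrite !lcompE tmap_id.
rewrite !tassocV_nat !tmap_comp; congr (GRing.Linear.sort _ _).
by apply: tmap_ext => // y; apply: cotvalP.
Qed.

Lemma ev_cotassocV (t : X □ (Y □ M)) s :
  ev (X □ Y) s (cotassocV X Y M t) = cotr X (ev Y s) t.
Proof.
apply: cotval_inj; rewrite evE -contractr_tmapl cotval_cotassocV.
rewrite contractr_tassocV tmap_comp cotval_cotr; first by apply: tmap_ext.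
exact: ev_lcolin.
Qed.

End Reassociation.

Section Bihomogeneous.
Context {k : fieldType} {S : algGroup k}.
Variables (X Y : bicpx S) (hX : is_bicpx X) (hY : is_bicpx Y).

Definition bihom_proj p q : {linear X □ Y -> X □ Y} :=
  cotmap (gproj hX p) (gproj hY q).

Lemma cotval_bihom_proj p q t :
  cotval X Y (bihom_proj p q t) = tmap (gproj hX p) (gproj hY q) (cotval X Y t).
Proof. by apply: cotval_cotmap; [apply: gproj_rcolin|apply: gproj_lcolin]. Qed.

Lemma sum2_linear (U W : lmodType k) (F : int -> int -> {linear U -> W}) (u : seq int) :
  linear (fun x => \sum_(p <- u) \sum_(q <- u) F p q x).
Proof.
move=> a x y; rewrite scaler_sumr -big_split; apply: eq_bigr => p _.
by rewrite scaler_sumr -big_split; apply: eq_bigr => q _; rewrite linearP.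
Qed.

(** Asking for all larger lists of degrees, rather than for some list, lets finitely
    many elements be decomposed over the same list. *)
Definition eventually (P : seq int -> Prop) : Prop :=
  exists s : seq int, forall u, uniq u -> {subset s <= u} -> P u.

Lemma eventually_ex P : eventually P -> exists u, P u.
Proof.
by move=> [s hs]; exists (undup s); apply: hs => [|p]; rewrite ?undup_uniq ?mem_undup.
Qed.

Lemma eventually_all (T : eqType) (z : seq T) (P : T -> seq int -> Prop) :
  (forall x, eventually (P x)) -> eventually (fun u => {in z, forall x, P x u}).
Proof.
move=> h; elim: z => [|x z [s hs]]; first by exists [::].
have [s' hs'] := h x; exists (s' ++ s) => u uu su y; rewrite inE => /predU1P[->|].
  by apply: hs' => // p ps; apply: su; rewrite mem_cat ps.
by apply: hs => // p ps; apply: su; rewrite mem_cat ps orbT.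
Qed.

Lemma tmap_gproj_sum (t : tensor X Y) : eventually (fun u =>
  t = \sum_(p <- u) \sum_(q <- u) tmap (gproj hX p) (gproj hY q) t).
Proof.
have [z ->] := tensor_sum t.
have [s hs] := eventually_all z (fun y => gproj_sum hX y.1).
have [s' hs'] := eventually_all z (fun y => gproj_sum hY y.2).
exists (s ++ s') => u uu su.
have {}hs : {in z, forall y, y.1 = \sum_(p <- u) gproj hX p y.1}.
  by apply: hs => // p ps; apply: su; rewrite mem_cat ps.
have {}hs' : {in z, forall y, y.2 = \sum_(p <- u) gproj hY p y.2}.
  by apply: hs' => // p ps; apply: su; rewrite mem_cat ps orbT.
rewrite -[RHS]/(mklin (sum2_linear (fun p q => tmap (gproj hX p) (gproj hY q)) u) _).
rewrite linear_sum !big_seq; apply: eq_bigr => y yz /=.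
rewrite {1}(hs y yz) tens_suml; apply: eq_bigr => p _.
by rewrite {1}(hs' y yz) tens_sumr; apply: eq_bigr => q _; rewrite tmapE.
Qed.

Lemma bihom_proj_sum (t : X □ Y) : eventually (fun u =>
  t = \sum_(p <- u) \sum_(q <- u) bihom_proj p q t).
Proof.
have [s hs] := tmap_gproj_sum (cotval X Y t); exists s => u uu su.
apply: cotval_inj; rewrite [LHS](hs u uu su) linear_sum; apply: eq_bigr => p _.
by rewrite linear_sum; apply: eq_bigr => q _; rewrite cotval_bihom_proj.
Qed.

Lemma tmap_bihom_proj_sum (M : lmodType k) (t : tensor (X □ Y) M) : exists u : seq int,
  t = \sum_(p <- u) \sum_(q <- u) tmap (bihom_proj p q) (lid M) t.
Proof.
have [z ->] := tensor_sum t.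
have /eventually_ex[u hu] := eventually_all z (fun y => bihom_proj_sum y.1).
exists u; rewrite -[RHS]/(mklin (sum2_linear (fun p q => tmap (bihom_proj p q) (lid M)) u) _).
rewrite linear_sum !big_seq; apply: eq_bigr => y yz /=.
rewrite {1}(hu y yz) tens_suml; apply: eq_bigr => p _.
by rewrite tens_suml; apply: eq_bigr => q _; rewrite tmapE.
Qed.

Lemma bihom_proj_idem p q t : bihom_proj p q (bihom_proj p q t) = bihom_proj p q t.
Proof.
apply: cotval_inj; rewrite !cotval_bihom_proj tmap_comp.
by apply: tmap_ext => x; rewrite lcompE (gproj_homog _ _ (gproj_deg _ _ _)) eqxx.
Qed.

Lemma bihom_proj_deg p q t : bdeg (X □ Y) (p + q) (bihom_proj p q t).
Proof.
rewrite cot_bdeg cotval_bihom_proj; have [z ->] := tensor_sum (cotval X Y t).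
exists [seq (gproj hX p y.1, gproj hY q y.2) | y <- z]; split=> [y|].
  move=> /mapP[x _ ->]; exists p, q; split=> //; exact: gproj_deg.
by rewrite linear_sum big_map; apply: eq_bigr => y _; rewrite tmapE.
Qed.

Lemma bsgn_bihom_proj p q t :
  bsgn (X □ Y) (bihom_proj p q t) = ((-1) ^+ absz (p + q)%R : k) *: bihom_proj p q t.
Proof.
apply: cotval_inj; rewrite cotval_bsgn // linearZ cotval_bihom_proj tmap_comp.
apply: (tensor_ext (g := tmap (bsgn X ∘ gproj hX p) (bsgn Y ∘ gproj hY q))
  (h := lscale ((-1) ^+ absz (p + q)%R) (tmap (gproj hX p) (gproj hY q)))) => x y.
rewrite lscaleE !tmapE !lcompE (bsgnE hX (gproj_deg hX p x)).
rewrite (bsgnE hY (gproj_deg hY q y)) tensZl tensZr scalerA; congr (_ *: _).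
have signE (r : int) : (-1) ^+ absz r = (-1) ^ r :> k.
  by case: r => n //; rewrite NegzE abszN absz_nat -exprnN invr_sign.
by rewrite !signE expfzDr // oppr_eq0 oner_eq0.
Qed.

End Bihomogeneous.

(** * Face and degeneracy maps *)

Section DGAMaps.
Context {k : fieldType} {S : algGroup k}.
Variable A : relDGA S.
Implicit Types M N : bicpx S.
Let hA : is_bicpx A := dga_bicpx A.
Let cA : act_comm A := bicpx_act_comm hA.
Let lA : lcpx A := lcpx_bicpx hA.
Local Notation mul := (dga_mul A).
Local Notation one := (dga_one A).
Local Notation "'L' f" := (cotr A f) (at level 10, f at level 9).

Lemma mul_lcolin : lcolin (A □ A) A mul.
Proof. apply: bleft_lcolin; exact: (bihom_left (dga_mul_hom A)). Qed.

Lemma mul_rcolin : rcolin (A □ A) A mul.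
Proof. apply: bright_rcolin; exact: (bihom_right (dga_mul_hom A)). Qed.

Lemma one_lcolin : lcolin (bi_unit S) A one.
Proof. apply: bleft_lcolin; exact: (bihom_left (dga_one_hom A)). Qed.

Lemma one_rcolin : rcolin (bi_unit S) A one.
Proof. apply: bright_rcolin; exact: (bihom_right (dga_one_hom A)). Qed.

Lemma one_deg (s : S) : bdeg A 0 (one s).
Proof. by apply: (bihom_deg (dga_one_hom A)); left. Qed.

Lemma dif_one (s : S) : bdif A (one s) = 0.
Proof. by rewrite -(bihom_dif (dga_one_hom A)) linear0. Qed.

Lemma bsgn_one (s : S) : bsgn A (one s) = one s.
Proof. by rewrite (bsgnE hA (one_deg s)) scale1r. Qed.

Lemma mul_deg p t : bdeg (A □ A) p t -> bdeg A p (mul t).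
Proof. exact: (bihom_deg (dga_mul_hom A)). Qed.

Lemma mul_dif t : mul (bdif (A □ A) t) = bdif A (mul t).
Proof. exact: (bihom_dif (dga_mul_hom A)). Qed.

(** The multiplication preserves degrees, and the cotensor product is spanned by
    its bihomogeneous elements. *)
Lemma mul_bsgn t : mul (bsgn (A □ A) t) = bsgn A (mul t).
Proof.
have [u ->] := eventually_ex (bihom_proj_sum hA hA t); rewrite !linear_sum; apply: eq_bigr => p _.
rewrite !linear_sum; apply: eq_bigr => q _; rewrite bsgn_bihom_proj linearZ.
by rewrite (bsgnE hA (mul_deg (bihom_proj_deg hA hA p q t))).
Qed.

Lemma lhom_mul : lhom mul.
Proof. split; [exact: mul_lcolin|exact: mul_dif|exact: mul_deg]. Qed.

Lemma lhom_one : lhom one.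
Proof.
split; first exact: one_lcolin.
- by move=> x; rewrite dif_one linear0.
- by move=> p x; apply: (bihom_deg (dga_one_hom A)).
Qed.

Lemma cotval_face_mul M (t : A □ (A □ M)) :
  cotval A M (face_mul A M t) =
  tmap mul (lid M) (cotval (A □ A) M (cotassocV A A M t)).
Proof. by rewrite /face_mul lcompE cotval_cotmap //; apply: mul_rcolin. Qed.

(** This reduces every identity between products to one in [A] itself. *)
Lemma ev_face_mul M s (t : A □ (A □ M)) :
  ev A s (face_mul A M t) = mul (L (ev A s) t).
Proof. by rewrite evE cotval_face_mul contractr_tmapl -ev_cotassocV. Qed.

Lemma face_mul_lcolin M : lcolin (A □ (A □ M)) (A □ M) (face_mul A M).
Proof.
move=> s t; apply: ev_sep => r; rewrite (ev_lcolin hA) !ev_face_mul.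
by rewrite -mul_lcolin (cotr_lcolin hA) //; apply: ev_lcolin.
Qed.

Lemma face_mul_cotr M N (f : {linear M -> N}) t : lcolin M N f ->
  face_mul A N (L (L f) t) = L f (face_mul A M t).
Proof.
move=> hf; apply: ev_sep => s; rewrite ev_face_mul ev_cotr // ev_face_mul.
rewrite (cotr_comp _ (cotr_lcolin hA hf)) //; last exact: ev_lcolin.
by congr (mul _); apply: cotr_ext => x; rewrite lcompE ev_cotr.
Qed.

(** Evaluation of the last factor turns both sides into threefold products in [A]. *)
Lemma face_mul_assoc M (t : A □ (A □ (A □ M))) :
  face_mul A M (L (face_mul A M) t) = face_mul A M (face_mul A (A □ M) t).
Proof.
have hev M' (s : {linear bcar M' -> k^o}) := ev_lcolin hA s.
apply: ev_sep => s; rewrite !ev_face_mul.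
rewrite (cotr_comp _ (@face_mul_lcolin M)) //.
rewrite -(face_mul_cotr _ (hev M s)).
transitivity (mul (L mul (L (L (ev A s)) t))).
  rewrite (cotr_comp _ (cotr_lcolin hA (hev M s)) mul_lcolin).
  by congr (mul _); apply: cotr_ext => x; apply: ev_face_mul.
exact/esym/dga_mulA.
Qed.

Lemma cotassocV_dif M (t : A □ (A □ M)) : lcpx M ->
  cotval (A □ A) M (cotassocV A A M (bdif (A □ (A □ M)) t)) =
  tmap (bdif (A □ A)) (lid M) (cotval (A □ A) M (cotassocV A A M t)) +
  tmap (bsgn (A □ A)) (bdif M) (cotval (A □ A) M (cotassocV A A M t)).
Proof.
move=> hM; have hAM := lcpx_cotensor hA hM.
have inj : injective (tmap (cotval A A) (lid M)).
  apply: (can_inj (g := tmap (cotretr A A) (lid M))) => z.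
  by rewrite tmap_comp -[RHS]tmap_id; apply: tmap_ext => // x; apply: cotvalK.
apply: inj; rewrite cotval_cotassocV // cotval_bdif // linearD.
set v := cotval A (A □ M) t; set z := cotval _ _ (cotassocV A A M t).
have zE : tmap (cotval A A) (lid M) z = tassocV (tmap (lid A) (cotval A M) v).
  exact: cotval_cotassocV.
pose dA := bdif A; pose sA := bsgn A; pose dM := bdif M.
transitivity (tmap (ladd (tmap dA (lid A)) (tmap sA dA)) (lid M) (tmap (cotval A A) (lid M) z)
  + tmap (tmap sA sA) dM (tmap (cotval A A) (lid M) z)); last first.
  rewrite linearD !tmap_comp; congr (_ + _); apply: tmap_ext => // x.
    by rewrite !lcompE cotval_bdif.
  by rewrite !lcompE cotval_bsgn.
rewrite zE !tmap_comp.
transitivity (tassocV (tmap dA (tmap (lid A) (lid M)) (tmap (lid A) (cotval A M) v)) +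
  (tassocV (tmap sA (tmap dA (lid M)) (tmap (lid A) (cotval A M) v)) +
   tassocV (tmap sA (tmap sA dM) (tmap (lid A) (cotval A M) v)))).
  rewrite linearD; congr (_ + _).
    rewrite tmap_comp; congr (GRing.Linear.sort _ _); apply: tmap_ext => // x.
    by rewrite !lcompE tmap_id.
  rewrite -linearD !tmap_comp; congr (GRing.Linear.sort _ _).
  rewrite (lin_ext (f := cotval A M ∘ bdif (A □ M))
    (g := ladd (tmap dA (lid M) ∘ cotval A M) (tmap sA dM ∘ cotval A M))); last first.
    by move=> x; rewrite lcompE cotval_bdif.
  apply: (tensor_ext (h := ladd (tmap (sA ∘ lid A) (tmap dA (lid M) ∘ cotval A M))
    (tmap (sA ∘ lid A) (tmap sA dM ∘ cotval A M)))) => x y.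
  by rewrite laddE !tmapE laddE tensDr.
rewrite addrA; congr (_ + _); last by rewrite tassocV_nat.
rewrite -!tassocV_nat.
apply: (tensor3_ext (g := ladd (tmap (tmap dA (lid A)) (lid M)) (tmap (tmap sA dA) (lid M)))) => x y m.
by rewrite laddE !tmapE laddE !tmapE tensDl.
Qed.

Lemma face_mul_dif M (t : A □ (A □ M)) : lcpx M ->
  face_mul A M (bdif (A □ (A □ M)) t) = bdif (A □ M) (face_mul A M t).
Proof.
move=> hM; apply: cotval_inj; rewrite cotval_face_mul cotassocV_dif //.
rewrite cotval_bdif // cotval_face_mul linearD !tmap_comp.
congr (_ + _); apply: tmap_ext => // x; first exact: mul_dif.
exact: mul_bsgn.
Qed.

(** The total degree of an element of A ⊗ (A ⊗ M) is also that of its image in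
    (A ⊗ A) ⊗ M; inside the cotensor product this is seen on the parts that are
    homogeneous in the first two factors separately. *)
Lemma cotassocV_deg M n (t : A □ (A □ M)) : lcpx M -> bdeg (A □ (A □ M)) n t ->
  tdeg (bdeg (A □ A)) (bdeg M) n (cotval (A □ A) M (cotassocV A A M t)).
Proof.
move=> hM [s [hs tE]]; set z := cotval _ _ _.
have Zdeg p b (x : A □ A) : bdeg (A □ A) p x -> bdeg (A □ A) p (b *: x).
  move=> hx; rewrite -[_ *: _]addr0; apply: (lcpx_lin (lcpx_cotensor hA lA)) => //.
  exact: (lcpx_zero (lcpx_cotensor hA lA)).
have tdegD (x y : tensor (A □ A) M) : tdeg (bdeg (A □ A)) (bdeg M) n x ->
    tdeg (bdeg (A □ A)) (bdeg M) n y -> tdeg (bdeg (A □ A)) (bdeg M) n (x + y).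
  by move=> hx hy; rewrite -[x]scale1r; apply: tdegP.
have [u ->] := tmap_bihom_proj_sum hA hA z.
elim/big_ind: _ => [||p _]; [exact: tdeg0|exact: tdegD|].
elim/big_ind: _ => [||q _]; [exact: tdeg0|exact: tdegD|].
set P := bihom_proj hA hA p q; set zpq := tmap P _ z.
have [w wE] := tensor_slicel zpq.
have -> : zpq = tmap P (lid M) zpq.
  by rewrite /zpq tmap_comp; apply: tmap_ext => // x; rewrite lcompE bihom_proj_idem.
rewrite [X in tmap _ _ X]wE linear_sum.
elim/big_ind: _ => [||r _]; [exact: tdeg0|exact: tdegD|].
rewrite tmapE; exists [:: (P r.2, contractl M r.1 zpq)]; split; last by rewrite big_seq1.
move=> y; rewrite inE => /eqP-> /=; exists (p + q), (n - (p + q)).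
split; [by rewrite addrC subrK|exact: bihom_proj_deg|].
pose r' := r.1 ∘ cotretr A A.
have -> : contractl M r.1 zpq = contractl M r' (tmap (cotval A A) (lid M) zpq).
  rewrite contractl_tmap; congr (GRing.Linear.sort _ _); congr contractl.
  by apply: lin_ext => x; rewrite !lcompE cotvalK.
have -> : tmap (cotval A A) (lid M) zpq = tmap (tmap (gproj hA p) (gproj hA q)) (lid M)
    (tmap (cotval A A) (lid M) z).
  by rewrite !tmap_comp; apply: tmap_ext => // x; rewrite !lcompE cotval_bihom_proj.
rewrite cotval_cotassocV // tE !linear_sum big_seq.
have MD x y' : bdeg M (n - (p + q)) x -> bdeg M (n - (p + q)) y' ->
    bdeg M (n - (p + q)) (x + y').
  by move=> hx hy; rewrite -[x]scale1r; apply: (lcpx_lin hM).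
elim/big_ind: _ => [||[a b] /hs[i [j [ij hi]]]]; [exact: (lcpx_zero hM)|exact: MD|].
rewrite cot_bdeg => -[s' [hs' bE]]; rewrite tmapE bE tens_sumr !linear_sum big_seq.
elim/big_ind: _ => [||[c m] /hs'[j' [l [jl hj hl]]]]; [exact: (lcpx_zero hM)|exact: MD|].
rewrite tassocVE !tmapE contractlE (gproj_homog hA p hi) (gproj_homog hA q hj).
case: eqP => [pi|_]; last by rewrite -(scale0r 0) tensZl scale0r linear0 scale0r; apply: (lcpx_zero hM).
case: eqP => [qj|_]; last by rewrite -(scale0r 0) tensZr scale0r linear0 scale0r; apply: (lcpx_zero hM).
have -> : n - (p + q) = l by rewrite -ij -jl pi qj addrA [_ + l]addrC addrK.
by rewrite -[_ *: _]addr0; apply: (lcpx_lin hM) => //; apply: (lcpx_zero hM).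
Qed.

Lemma lhom_face_mul M : lcpx M -> lhom (face_mul A M).
Proof.
move=> hM; split; [exact: face_mul_lcolin|by move=> t; apply: face_mul_dif|].
move=> n t ht; rewrite cot_bdeg cotval_face_mul.
by apply: tdeg_tmap0 (cotassocV_deg hM ht) => // p x; apply: mul_deg.
Qed.

End DGAMaps.

Section Coactions.
Context {k : fieldType} {S : algGroup k}.

(** By coassociativity the coactions take values in O ⊗_O M and X ⊗_O O. *)
Lemma bleft_cotensor (M : bicpx S) s (m : M) : lcpx M ->
  tmap (ract (bi_unit S) s) (lid M) (bleft M m) = tmap (lid S) (lact M s) (bleft M m).
Proof.
move=> hM; apply: contractl_sep => r.
rewrite contractl_tmapr contractl_tmap -[RHS]/(lact M s (lact M r m)) (lcpx_mul hM).
rewrite -[LHS]/(lact M (r ∘ ract (bi_unit S) s) m).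
suff -> : r ∘ ract (bi_unit S) s = s ∘ lact (bi_unit S) r by [].
by apply: lin_ext => x; rewrite !lcompE -(lact_ract_unit r s).
Qed.

Lemma bright_cotensor (X : bicpx S) s (x : X) : is_bicpx X ->
  tmap (ract X s) (lid S) (bright X x) = tmap (lid X) (lact (bi_unit S) s) (bright X x).
Proof.
move=> hX; have := congr1 (tmap (lid X) (contractl S s)) (brightA hX x).
rewrite contract_mid_tassoc !tmap_comp => e.
by apply: etrans (etrans e _); apply: tmap_ext.
Qed.

End Coactions.

Section Degeneracies.
Context {k : fieldType} {S : algGroup k}.
Variable A : relDGA S.
Implicit Types M N : bicpx S.
Let hA : is_bicpx A := dga_bicpx A.
Let cA : act_comm A := bicpx_act_comm hA.
Let lA : lcpx A := lcpx_bicpx hA.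
Local Notation mul := (dga_mul A).
Local Notation one := (dga_one A).
Local Notation "'L' f" := (cotr A f) (at level 10, f at level 9).

(** Insertion of the unit in front, m |-> 1 ⊗ m, through M = O ⊗_O M. *)
Definition unit_first M : {linear M -> A □ M} :=
  cotretr A M ∘ (tmap one (lid M) ∘ bleft M).

(** Insertion of the unit behind, x |-> x ⊗ 1, through A = A ⊗_O O. *)
Definition unit_last : {linear A -> A □ A} :=
  cotretr A A ∘ (tmap (lid A) one ∘ bright A).

Lemma cotval_unit_first M (m : M) : lcpx M ->
  cotval A M (unit_first M m) = tmap one (lid M) (bleft M m).
Proof.
move=> hM; apply: cotretrK => s.
transitivity (tmap one (lid M) (tmap (ract (bi_unit S) s) (lid M) (bleft M m))).
  by rewrite !tmap_comp; apply: tmap_ext => // x; rewrite [RHS]one_rcolin.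
transitivity (tmap one (lid M) (tmap (lid S) (lact M s) (bleft M m))); last first.
  by rewrite !tmap_comp; apply: tmap_ext.
by congr (GRing.Linear.sort _ _); apply: bleft_cotensor.
Qed.

Lemma cotval_unit_last (x : A) :
  cotval A A (unit_last x) = tmap (lid A) one (bright A x).
Proof.
apply: cotretrK => s.
transitivity (tmap (lid A) one (tmap (lid A) (lact (bi_unit S) s) (bright A x))); last first.
  by rewrite !tmap_comp; apply: tmap_ext => // y; apply: one_lcolin.
transitivity (tmap (lid A) one (tmap (ract A s) (lid S) (bright A x))).
  by rewrite !tmap_comp; apply: tmap_ext.
by congr (GRing.Linear.sort _ _); apply: bright_cotensor.
Qed.

Lemma ev_unit_first M s (m : M) : lcpx M ->
  ev A s (unit_first M m) = one (contractr S s (bleft M m)).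
Proof. by move=> hM; rewrite evE cotval_unit_first // contractr_tmapl. Qed.

Lemma ev_unit_last s (x : A) : ev A s (unit_last x) = ract A (s ∘ one) x.
Proof. by rewrite evE cotval_unit_last contractr_tmap. Qed.

Lemma lhom_unit_first M : lcpx M -> lhom (unit_first M).
Proof.
move=> hM; split.
- move=> s m; apply: cotval_inj; rewrite cotval_lact // !cotval_unit_first // tmap_comp.
  transitivity (tmap one (lid M) (tmap (lact (bi_unit S) s) (lid M) (bleft M m))).
    congr (GRing.Linear.sort _ _); apply: contractl_sep => r.
    by rewrite contractl_tmap -[LHS]/(lact M r (lact M s m)) (lcpx_mul hM).
  by rewrite tmap_comp; apply: tmap_ext => // x; apply: one_lcolin.
- move=> m; apply: cotval_inj; rewrite cotval_bdif // !cotval_unit_first // !tmap_comp.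
  rewrite (lcolin_bleft (lcpx_dif hM)) tmap_comp.
  rewrite [X in _ = X + _](_ : _ = 0) ?add0r.
    by apply: tmap_ext => // x; rewrite !lcompE bsgn_one.
  apply: (tensor_ext (h := \0)) => x y; rewrite tmapE lcompE dif_one.
  by rewrite -(scale0r 0) tensZl scale0r.
- move=> p m hm; rewrite cot_bdeg cotval_unit_first //.
  apply: (tdeg_tmap0 (dM := @deg0 _ S) (dN := bdeg M)) => [q x|//|].
    exact: (lhom_deg (lhom_one A)).
  have [w ->] := tensor_slicel (bleft M m).
  elim/big_ind: _ => [||r _]; first exact: tdeg0.
    move=> x y hx hy; rewrite -[x]scale1r; apply: tdegP => // q b z.
    by move=> [->|->]; [left|right; rewrite scaler0].
  exists [:: (r.2, lact M r.1 m)]; split; last by rewrite big_seq1.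
  move=> y; rewrite inE => /eqP->; exists 0, p; split; [exact: add0r|by left|].
  exact: (lcpx_deg hM).
Qed.

Lemma lhom_unit_last : lhom unit_last.
Proof.
split.
- move=> s x; apply: cotval_inj; rewrite cotval_lact // !cotval_unit_last tmap_comp.
  transitivity (tmap (lid A) one (tmap (lact A s) (lid S) (bright A x))).
    congr (GRing.Linear.sort _ _); apply: contractr_sep => r.
    by rewrite contractr_tmapl; exact: (esym (cA s r x)).
  by rewrite tmap_comp; apply: tmap_ext.
- move=> x; apply: cotval_inj; rewrite cotval_bdif // !cotval_unit_last !tmap_comp.
  rewrite (bright_dif hA) tmap_comp [X in _ = _ + X](_ : _ = 0) ?addr0.
    by apply: tmap_ext.
  apply: (tensor_ext (h := \0)) => y s; rewrite tmapE !lcompE dif_one.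
  by rewrite -(scale0r 0) tensZr scale0r.
- move=> p x hx; rewrite cot_bdeg cotval_unit_last.
  apply: tdeg_tmap0 (bright_deg hA hx) => // q y; exact: (lhom_deg (lhom_one A)).
Qed.

Lemma cotr_unit_first M N (f : {linear M -> N}) m : lcpx M -> lcpx N -> lcolin M N f ->
  L f (unit_first M m) = unit_first N (f m).
Proof.
move=> hM hN hf; apply: cotval_inj; rewrite cotval_cotr // !cotval_unit_first //.
by rewrite (lcolin_bleft hf) !tmap_comp; apply: tmap_ext.
Qed.

Lemma mul_unit_first (x : A) : mul (unit_first A x) = x.
Proof.
rewrite -[RHS](dga_mul1l x); congr (mul _); apply: cotval_inj.
rewrite cotval_unit_first // cotval_cotmap //; last exact: one_rcolin.
rewrite /cotunitl_inv lcompE cotretrK // => s; exact: bleft_cotensor.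
Qed.

Lemma mul_unit_last (x : A) : mul (unit_last x) = x.
Proof.
rewrite -[RHS](dga_mul1r x); congr (mul _); apply: cotval_inj.
rewrite cotval_unit_last cotval_cotmap //; last exact: one_lcolin.
rewrite /cotunitr_inv lcompE cotretrK // => s; exact: bright_cotensor.
Qed.

Lemma face_mul_unit_first M (t : A □ M) : lcpx M ->
  face_mul A M (unit_first (A □ M) t) = t.
Proof.
move=> hM; have hAM := lcpx_cotensor hA hM; apply: ev_sep => s.
rewrite ev_face_mul cotr_unit_first //; last exact: ev_lcolin.
exact: mul_unit_first.
Qed.

(** The unit inserted between x and m may be written to the right of x instead of
    to the left of m, by the equation of the cotensor product. *)
Lemma face_mul_cotr_unit_first M (t : A □ M) : lcpx M ->
  face_mul A M (L (unit_first M) t) = t.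
Proof.
move=> hM; apply: ev_sep => s; rewrite ev_face_mul.
have hu := lhom_lin (lhom_unit_first hM).
rewrite cotr_comp //; last exact: ev_lcolin.
rewrite -[RHS]mul_unit_last; congr (mul _); apply: ev_sep => r.
rewrite ev_cotr; last by apply: lcolin_comp hu _; apply: ev_lcolin.
rewrite ev_unit_last evE -contractr_tmapl.
have e : r ∘ (ev A s ∘ unit_first M) =1 s ∘ lact M (r ∘ one).
  move=> m; rewrite -[LHS]/(r (ev A s (unit_first M m))) ev_unit_first //.
  by rewrite -[LHS]/((r ∘ one) _) -contract_fubini.
by rewrite (lin_ext e) cotvalP contractr_tmap.
Qed.

Lemma face_mul_cotr_unit_last (t : A □ A) :
  face_mul A A (L unit_last t) = unit_last (mul t).
Proof.
apply: ev_sep => s; rewrite ev_face_mul.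
rewrite (cotr_comp _ (lhom_lin lhom_unit_last)); last exact: ev_lcolin.
rewrite ev_unit_last -mul_rcolin; congr (mul _).
have hr : lcolin A A (ract A (s ∘ one)) by move=> r x; rewrite cA.
apply: cotval_inj; rewrite cotval_ract // -cotval_cotr //; congr (cotval _ _ _).
by apply: cotr_ext => x; apply: ev_unit_last.
Qed.

End Degeneracies.

Section AugmentationFunctional.
Context {k : fieldType} {S : algGroup k} {I : choiceType} {V : irrSystem S I}.
Variables (A : relDGA S) (eps : relAug V A).
Implicit Types M N : bicpx S.
Let hA : is_bicpx A := dga_bicpx A.
Let cA : act_comm A := bicpx_act_comm hA.
Let lA : lcpx A := lcpx_bicpx hA.
Local Notation mul := (dga_mul A).
Local Notation one := (dga_one A).

(** The composite of either one-sided augmentation with the counit.  Conversely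
    both are recovered from it, as x |-> e(x_0) x_1 and x |-> x_(-1) e(x_0), and the
    faces that involve the augmentation are contractions with it. *)
Definition aug_eval : {linear A -> k^o} := hom_eval V ∘ eps.
Local Notation e := aug_eval.

Lemma aug_lcolin : lcolin A (bi_hom V) eps.
Proof. apply: bleft_lcolin; exact: (bihom_left (aug_hom eps)). Qed.

Lemma aug_rcolin : rcolin A (bi_hom V) eps.
Proof. apply: bright_rcolin; exact: (bihom_right (aug_hom eps)). Qed.

Lemma functional_aug_r (s : {linear S -> k^o}) x : s (aug_r eps x) = e (ract A s x).
Proof.
rewrite -[LHS]/(s (pw_coef V (hom_evr V (eps x)))) functional_evr.
by rewrite -[RHS]/(hom_eval V (eps (ract A s x))) aug_rcolin.
Qed.

Lemma functional_aug_l (s : {linear S -> k^o}) x : s (aug_l eps x) = e (lact A s x).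
Proof.
rewrite -[LHS]/(s (pw_coef V (hom_evl V (eps x)))) functional_evl.
by rewrite -[RHS]/(hom_eval V (eps (lact A s x))) aug_lcolin.
Qed.

Lemma aug_rE x : aug_r eps x = contractl S e (bright A x).
Proof.
apply: (funct_ext (U := S)) => s; rewrite functional_aug_r.
exact/esym/contract_fubini.
Qed.

Lemma aug_lE x : aug_l eps x = contractr S e (bleft A x).
Proof.
apply: (funct_ext (U := S)) => s; rewrite functional_aug_l; exact: contract_fubini.
Qed.


Lemma aug_eval_mul t : e (mul t) = e (ev A e t).
Proof.
rewrite -[LHS]/(hom_eval V (eps (mul t))) (aug_mul eps).
rewrite -[LHS]/(hom_eval V (hom_glue V (tmap (hom_evl V) (hom_evr V)
  (cotval (bi_hom V) (bi_hom V) (cotmap eps eps t))))).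
rewrite cotval_cotmap; [|exact: aug_rcolin|exact: aug_lcolin].
rewrite -[RHS]/(hom_eval V (eps (contractr A (hom_eval V ∘ eps) (cotval A A t)))).
rewrite -contractr_tmap; move: (tmap eps eps _).
apply: (tensor_ext (g := hom_eval V ∘ (hom_glue V ∘ tmap (hom_evl V) (hom_evr V)))
  (h := hom_eval V ∘ contractr (homOO V) (hom_eval V))) => h h'.
rewrite -[LHS]/(hom_eval V (hom_glue V (tmap (hom_evl V) (hom_evr V) (h ⊗ h')))).
rewrite hom_eval_glue -[RHS]/(hom_eval V (contractr (homOO V) (hom_eval V) (h ⊗ h'))).
by rewrite contractrE linearZ; apply: mulrC.
Qed.

Lemma aug_eval_dif x : e (bdif A x) = 0.
Proof. by rewrite -[LHS]/(hom_eval V (eps _)) (bihom_dif (aug_hom eps)) linear0. Qed.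

Lemma aug_eval_deg p x : p <> 0 -> bdeg A p x -> e x = 0.
Proof.
move=> p0 /(bihom_deg (aug_hom eps)) [//|ex].
by rewrite -[LHS]/(hom_eval V (eps _)) ex linear0.
Qed.

Lemma aug_eval_bsgn x : e (bsgn A x) = e x.
Proof.
apply: (homog_ext hA (f := e ∘ bsgn A)) => p y hy.
rewrite -[LHS]/(e (bsgn A y)) (bsgnE hA hy) linearZ.
have [->|/eqP p0] := eqVneq p 0; first by rewrite absz0; apply: scale1r.
by rewrite (aug_eval_deg p0 hy); apply: scaler0.
Qed.

Lemma aug_eval_one_coef a (v : rvec (V a)) (w : rdual (V a)) :
  e (one (coef (V a) (v ⊗ w))) = counit S (coef (V a) (v ⊗ w)).
Proof.
by rewrite -[LHS]/(hom_eval V (eps _)) aug_one hom_eval_in counit_coef mulmx1.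
Qed.

(** Since 1 x = x, the functional composed with the unit is a convolution
    idempotent: this is the relation for x in the image of the unit. *)
Lemma aug_eval_one_idem s : e (one s) = e (one (lact (bi_unit S) (e ∘ one) s)).
Proof.
rewrite -{1}(mul_unit_first (one s)) aug_eval_mul ev_unit_first //.
rewrite -[LHS]/((e ∘ one) _) -contract_fubini; congr (e _).
exact/esym/one_lcolin.
Qed.

End AugmentationFunctional.

(** * Functionals vanishing on the irreducible matrix coefficients *)

(** [B] is a basis of the row space of [W] and [Q] gives coordinates on the quotient
    by it; the last clause says that the kernel of [Q] is not larger. *)
Lemma sub_quotient_mx (k : fieldType) (m n : nat) (W : 'M[k]_(m, n)) :
  exists d q (B : 'M[k]_(d, n)) (B' : 'M[k]_(n, d)) (Q : 'M[k]_(n, q)) (L : 'M[k]_(q, n)),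
  [/\ d = \rank W /\ q = (n - \rank W)%N, [/\ B *m B' = 1%:M, L *m Q = 1%:M & B *m Q = 0],
      exists C, B = C *m W, exists D, W = D *m B
    & forall p (Y : 'M[k]_(p, n)), Y *m Q = 0 -> exists E, Y = E *m B].
Proof.
pose K := cokermx (row_base W).
exists (\rank W), (\rank K), (row_base W), (pinvmx (row_base W)), (col_base K).
exists (pinvmx (col_base K)); split.
- by rewrite mxrank_coker (eqP (row_base_free W)).
- split; [apply: mulmxVp; exact: row_base_free|apply: mulVpmx; exact: col_base_full|].
  have -> : col_base K = K *m pinvmx (row_base K).
    apply: etrans (congr1 (mulmx^~ _) (mulmx_base K)).
    by rewrite -mulmxA mulmxVp ?mulmx1 //; apply: row_base_free.
  by rewrite mulmxA mulmx_coker mul0mx.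
- by apply/submxP; rewrite eq_row_base.
- by apply/submxP; rewrite eq_row_base.
- move=> p Y YQ; apply/submxP; rewrite submxE -/K -(mulmx_base K) mulmxA YQ.
  by rewrite mul0mx.
Qed.

Section MatrixCoefficients.
Context {k : fieldType} {S : algGroup k}.
Implicit Types s r : {linear S -> k^o}.

(** x |-> s(x_1) r(x_2) *)
Definition conv s r : {linear S -> k^o} := r ∘ lact (bi_unit S) s.

Definition eval_mx (m n : nat) s (X : 'M[S]_(m, n)) : 'M[k]_(m, n) := map_mx s X.

Lemma eval_mx_scalel (p m n : nat) s (P : 'M[k]_(p, m)) (X : 'M[S]_(m, n)) :
  eval_mx s (map_mx (in_alg S) P *m X) = P *m eval_mx s X.
Proof.
apply/matrixP => i j; rewrite !mxE linear_sum; apply: eq_bigr => l _.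
by rewrite !mxE /= -scalerAl mul1r linearZ.
Qed.

Lemma eval_mx_scaler (m n p : nat) s (X : 'M[S]_(m, n)) (P : 'M[k]_(n, p)) :
  eval_mx s (X *m map_mx (in_alg S) P) = eval_mx s X *m P.
Proof.
apply/matrixP => i j; rewrite !mxE linear_sum; apply: eq_bigr => l _.
by rewrite !mxE /= -scalerAr mulr1 linearZ; apply: mulrC.
Qed.

(** Contraction with functionals turns the comultiplication of a matrix of functions
    into the multiplication of scalar matrices. *)
Lemma comul_conv (n : nat) (X : 'M[S]_n) :
  (forall i j, comul S (X i j) = \sum_l X i l ⊗ X l j) <->
  (forall s r, eval_mx (conv s r) X = eval_mx s X *m eval_mx r X).
Proof.
have E s r i j : r (contractl S s (\sum_l X i l ⊗ X l j)) =
    (eval_mx s X *m eval_mx r X) i j.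
  rewrite !linear_sum !mxE; apply: eq_bigr => l _.
  by rewrite contractlE linearZ !mxE.
split=> [h s r|h i j].
  by apply/matrixP => i j; rewrite -E -h mxE.
apply: contractl_sep => s; apply: funct_ext => r.
by rewrite E -h mxE.
Qed.

Lemma rep_conv (R : rep S) s r :
  eval_mx (conv s r) (rmx R) = eval_mx s (rmx R) *m eval_mx r (rmx R).
Proof. by move: s r; apply/comul_conv; apply: rep_comul. Qed.

Lemma conv_rep (n : nat) (X : 'M[S]_n) :
  (forall s r, eval_mx (conv s r) X = eval_mx s X *m eval_mx r X) ->
  eval_mx (counit S) X = 1%:M -> exists R : rep S,
    exists e : rdim R = n, castmx (e, e) (rmx R) = X.
Proof.
move=> /comul_conv h /matrixP h1.
have h1' i j : counit S (X i j) = (i == j)%:R by have := h1 i j; rewrite !mxE.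
by exists (Rep h h1'), (erefl n); rewrite castmx_id.
Qed.

Section IdempotentFunctional.
Variable w : {linear S -> k^o}.
Hypothesis w_idem : forall x, w x = conv w w x.
Hypothesis w_irr : forall R : rep S, irreducible R -> eval_mx w (rmx R) = 0.

(** [w] acts on every representation as an idempotent matrix.  On a reducible
    one it acts as zero on a proper subrepresentation and on the quotient by it,
    so that its square is zero. *)
Lemma eval_mx_idempotent_rep n (R : rep S) : (rdim R <= n)%N -> eval_mx w (rmx R) = 0.
Proof.
elim: n R => [|n IHn] R.
  by rewrite leqn0 => /eqP d0; apply/matrixP => i; have := ltn_ord i; rewrite {2}d0.
move=> Rn; have [//|nirr] := pselect (irreducible R); first exact: w_irr.
have [d0|d0] := posnP (rdim R).
  by apply/matrixP => i; have := ltn_ord i; rewrite {2}d0.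
have IH (m : nat) (X : 'M[S]_m) : (m <= n)%N ->
    (forall s r, eval_mx (conv s r) X = eval_mx s X *m eval_mx r X) ->
    eval_mx (counit S) X = 1%:M -> eval_mx w X = 0.
  move=> mn h h1; have [Q [e QX]] := conv_rep h h1.
  by case: _ / e X QX mn {h h1} => X; rewrite castmx_id => <- mn; apply: IHn.
have [m [W [subW W0 Wfull]]] : exists m (W : 'M[k]_(m, rdim R)),
    [/\ subrep_over (idfun : {rmorphism k -> k}) W, W != 0 & ~~ row_full W].
  apply: contrapT => nW; apply: nirr; split=> // m W hW.
  have [->|W0] := eqVneq W 0; first by left.
  right; apply: contrapT => /negP Wfull; apply: nW.
  by exists m, W.
have [X WX] : exists X : 'M[S]_m, map_mx (in_alg S) W *m rmx R = X *m map_mx (in_alg S) W.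
  have [//|X e] := subW S (idfun : {rmorphism S -> S}); exists X.
  by rewrite -e; congr (_ *m _); apply/matrixP => i j; rewrite mxE.
have [d [q [B [B' [Q [L [[dE qE] [BB' LQ BQ] [C BC] [D WD] leB]]]]]]] := sub_quotient_mx W.
have d_lt : (d < rdim R)%N by rewrite dE ltn_neqAle rank_leq_col andbT.
have d_gt : (0 < d)%N by rewrite dE lt0n mxrank_eq0.
pose rho s := eval_mx s (rmx R).
have rhoM s r : rho (conv s r) = rho s *m rho r by apply: rep_conv.
have rho1 : rho (counit S) = 1%:M by apply: counit_rmx.
pose sub s := B *m rho s *m B'.
have subE s : B *m rho s = sub s *m B.
  have e : W *m rho s = eval_mx s X *m W.
    by rewrite -eval_mx_scalel WX eval_mx_scaler.
  have e' : B *m rho s = (C *m eval_mx s X *m D) *m B.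
    by rewrite {1}BC -!mulmxA e -WD.
  by rewrite /sub e' -(mulmxA _ B) BB' mulmx1.
have sub0 : sub w = 0.
  pose Xsub := map_mx (in_alg S) B *m rmx R *m map_mx (in_alg S) (B').
  have XsubE s : eval_mx s Xsub = sub s by rewrite eval_mx_scaler eval_mx_scalel.
  rewrite -XsubE; apply: IH; first exact: leq_trans d_lt Rn.
    move=> s r; rewrite !XsubE [sub r]/sub !mulmxA.
    by rewrite -subE /sub rhoM !mulmxA.
  by rewrite XsubE /sub rho1 mulmx1.
have [E EB] : exists E, 1%:M - Q *m L = E *m B.
  by apply: leB; rewrite mulmxBl mul1mx -mulmxA LQ mulmx1 subrr.
pose quo s := L *m rho s *m Q.
have quoE s : rho s *m Q = Q *m quo s.
  have : (1%:M - Q *m L) *m rho s *m Q = 0.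
    by rewrite EB -(mulmxA E) subE -!mulmxA BQ !mulmx0.
  by rewrite !mulmxBl mul1mx /quo !mulmxA => /subr0_eq.
have quo0 : quo w = 0.
  pose Xquo := map_mx (in_alg S) L *m rmx R *m map_mx (in_alg S) Q.
  have XquoE s : eval_mx s Xquo = quo s by rewrite eval_mx_scaler eval_mx_scalel.
  rewrite -XquoE; apply: IH.
  - by rewrite qE -dE leq_subLR (leq_trans Rn) // -add1n leq_add2r.
  - by move=> s r; rewrite !XquoE [quo s]/quo -mulmxA -quoE /quo rhoM !mulmxA.
  - by rewrite XquoE /quo rho1 mulmx1.
have [F FB] := leB _ (rho w) (etrans (quoE w) (etrans (congr1 _ quo0) (mulmx0 _ _))).
have -> : eval_mx w (rmx R) = rho w *m rho w.
  by rewrite -rhoM; apply/matrixP => i j; rewrite !mxE.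
by rewrite {1}FB -mulmxA subE sub0 mul0mx mulmx0.
Qed.

(** The left translates of [x] span a finite-dimensional space, on which the
    group acts by a representation that has [x] among its coefficients. *)
Lemma idempotent_functional_eq0 x : w x = 0.
Proof.
pose lt s := lact (bi_unit S) s.
have ltM s r y : lt r (lt s y) = lt (conv s r) y.
  exact: (lcpx_mul lcpx_unit r s y).
have lt1 y : lt (counit S) y = y by apply: counit_comul.
have [z zE] := tensor_slicel (comul S x).
have [n [b [c [cb spanb bC]]]] := dual_basis [seq lt p.1 x | p <- z].
have P_linear : linear (fun y : bi_unit S => \sum_i (c i y : k) *: b i).
  move=> a y y'; rewrite scaler_sumr -big_split; apply: eq_bigr => i _.
  by rewrite linearP scalerDl scalerA.
pose P := mklin P_linear.
have Plt s : P (lt s x) = lt s x.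
  have -> : lt s x = \sum_(p <- z) (s p.2 : k) *: lt p.1 x.
    rewrite -[LHS]/(contractl S s (comul S x)) [X in contractl _ _ X]zE linear_sum.
    by apply: eq_bigr => p _; rewrite contractlE.
  have {spanb} : forall u, u \in [seq lt p.1 x | p <- z] -> P u = u.
    by move=> u /spanb {2}->.
  elim: z {zE bC} => [|p z IHz] Pz; first by rewrite big_nil linear0.
  rewrite big_cons linearD IHz => [|u uz]; last by apply: Pz; rewrite inE uz orbT.
  by rewrite linearZ Pz // inE eqxx.
have bE i : exists s, b i = lt s x.
  apply: (bC (fun y => exists s, y = lt s x)).
  - move=> a y y' [s ->] [r ->]; exists (ladd (lscale a s) r).
    apply: (tensor_ext (g := ladd (lscale a (contractl S s)) (contractl S r))) => u v.
    by rewrite laddE lscaleE !contractlE scalerDl scalerA.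
  - exists \0; apply: esym; apply: (tensor_ext (g := contractl S \0) (h := \0)) => u v.
    by rewrite contractlE scale0r.
  - elim: z {zE spanb bC Plt} => // p z IHz u; rewrite inE => /predU1P[->|/IHz//].
    by exists p.1.
pose X : 'M[S]_n := \matrix_(i, j) ract (bi_unit S) (c j) (b i).
have XE s i j : eval_mx s X i j = c j (lt s (b i)).
  by rewrite !mxE [RHS]lact_ract_unit.
have ltb s i : lt s (b i) = \sum_j eval_mx s X i j *: b j.
  have [r rE] := bE i; rewrite {1}rE ltM -Plt -ltM -rE.
  by apply: eq_bigr => j _; rewrite XE.
have X0 : eval_mx w X = 0.
  have [s r||R [e <-]] := @conv_rep n X.
  - apply/matrixP => i j; rewrite XE -ltM ltb !linear_sum !mxE.
    by apply: eq_bigr => l _; rewrite !linearZ -XE.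
  - by apply/matrixP => i j; rewrite XE lt1 cb mxE eq_sym.
  - case: _ / e; rewrite castmx_id; exact: (eval_mx_idempotent_rep (leqnn _)).
have ltx : lt w x = 0.
  have -> : x = \sum_i (c i x : k) *: b i by rewrite -{1}[x]lt1 -Plt lt1.
  rewrite linear_sum big1 // => i _; rewrite linearZ ltb big1 => [|j _]; first exact: scaler0.
  by rewrite X0 mxE scale0r.
by rewrite -(counit_lact w x) -[lact _ _ _]/(lt w x) ltx linear0.
Qed.

End IdempotentFunctional.
End MatrixCoefficients.

Section AugmentationOfUnit.
Context {k : fieldType} {S : algGroup k} {I : choiceType} {V : irrSystem S I}.
Variables (A : relDGA S) (eps : relAug V A).
Local Notation e := (aug_eval eps).
Local Notation one := (dga_one A).

(** The two functionals agree on the matrix coefficients of irreducible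
    representations by the definition of an augmentation.  Their difference is a
    convolution idempotent, since [e ∘ one] is one and the counit is neutral. *)
Lemma aug_eval_one s : e (one s) = counit S s.
Proof.
pose u : {linear S -> k^o} := e ∘ one.
pose w := ladd (counit S) (lscale (-1) u).
have wE x : w x = counit S x - u x by rewrite laddE lscaleE scaleN1r.
suff : w s = 0 by rewrite wE => /subr0_eq.
apply: idempotent_functional_eq0 => [x|R irrR].
  have lw y : lact (bi_unit S) w y = y - lact (bi_unit S) u y.
    rewrite -{2}(lcpx_counit lcpx_unit y) /lact !lcompE; move: (bleft _ y) => t.
    rewrite -[- _]scaleN1r; move: t; apply: (tensor_ext (h := ladd (contractl S (counit S)) (lscale (-1) (contractl S u)))).
    by move=> a b; rewrite laddE lscaleE !contractlE wE scalerBl scaleN1r.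
  have w0 : w (lact (bi_unit S) u x) = 0.
    rewrite wE [X in X - _]counit_lact.
    by rewrite [X in X - _](aug_eval_one_idem eps x) subrr.
  by rewrite -[RHS]/(w (lact (bi_unit S) w x)) lw linearB w0 subr0.
have [a [P [Q [PQ QP RP]]]] := irr_exhaust V irrR.
have -> : eval_mx w (rmx R) = P *m eval_mx w (rmx (V a)) *m Q.
  by rewrite -eval_mx_scalel -RP eval_mx_scaler -mulmxA PQ mulmx1.
suff -> : eval_mx w (rmx (V a)) = 0 by rewrite mulmx0 mul0mx.
apply/matrixP => i j; rewrite [RHS]mxE.
pose v : rvec (V a) := delta_mx 0 i; pose v' : rdual (V a) := delta_mx j 0.
have -> : eval_mx w (rmx (V a)) i j = (v *m eval_mx w (rmx (V a)) *m v') 0 0.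
  by rewrite -rowE -colE !mxE.
rewrite -functional_coef wE -[u _]/(e (one (coef (V a) (v ⊗ v')))).
by rewrite aug_eval_one_coef subrr.
Qed.

End AugmentationOfUnit.

(** * The simplicial identities of the bar construction *)

Section BarSimplicial.
Context {k : fieldType} {S : algGroup k} {I : choiceType} {V : irrSystem S I}.
Variables (A : relDGA S) (eps : relAug V A).
Implicit Types M N : bicpx S.
Let hA : is_bicpx A := dga_bicpx A.
Let cA : act_comm A := bicpx_act_comm hA.
Let lA : lcpx A := lcpx_bicpx hA.
Local Notation mul := (dga_mul A).
Local Notation one := (dga_one A).
Local Notation e := (aug_eval eps).
Local Notation p0 := (face_first eps).
Local Notation "'L' f" := (cotr A f) (at level 10, f at level 9).

Lemma aug_r_rcolin : rcolin A (bi_unit S) (aug_r eps).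
Proof.
move=> s x; apply: (funct_ext (U := S)) => r; rewrite functional_aug_r.
have -> : ract A r (ract A s x) = ract A (s ∘ lact (bi_unit S) r) x.
  have := congr1 (contractr A s) (bright_cotensor r x hA).
  by rewrite contractr_tmapl contractr_tmap.
by rewrite -functional_aug_r; apply: lact_ract_unit.
Qed.

Lemma aug_l_lcolin : lcolin A (bi_unit S) (aug_l eps).
Proof.
move=> s x; apply: (funct_ext (U := S)) => r; rewrite functional_aug_l.
by rewrite (lcpx_mul lA) -functional_aug_l.
Qed.

Lemma counit_aug_r x : counit S (aug_r eps x) = e x.
Proof. by rewrite functional_aug_r /ract lcompE (bright1 hA). Qed.

Lemma counit_aug_l x : counit S (aug_l eps x) = e x.
Proof. by rewrite functional_aug_l (lcpx_counit lA). Qed.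

Lemma face_firstE M t : p0 M t = contractl M e (cotval A M t).
Proof.
rewrite /face_first lcompE /cotunitl lcompE cotval_cotmap //; last exact: aug_r_rcolin.
rewrite contractl_tmap -[LHS]/(contractl M (counit S ∘ aug_r eps) _).
by rewrite (lin_ext (f := counit S ∘ aug_r eps) (g := e) counit_aug_r).
Qed.

Lemma face_lastE t : (cotunitr A ∘ cotmap (lid A) (aug_l eps)) t = ev A e t.
Proof.
rewrite lcompE /cotunitr lcompE cotval_cotmap //; last exact: aug_l_lcolin.
rewrite contractr_tmap -[LHS]/(contractr A (counit S ∘ aug_l eps) _).
by rewrite (lin_ext (f := counit S ∘ aug_l eps) (g := e) counit_aug_l).
Qed.

Lemma functional_face_first M (s : {linear M -> k^o}) t : s (p0 M t) = e (ev A s t).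
Proof. by rewrite face_firstE contract_fubini. Qed.

Lemma lhom_ev_aug : lhom (ev A e : {linear A □ A -> A}).
Proof.
split; first exact: ev_lcolin.
- move=> t; rewrite !evE cotval_bdif // linearD contractr_tmapl contractr_tmap.
  rewrite (lin_ext (f := e ∘ bdif A) (g := \0) (aug_eval_dif eps)).
  rewrite (_ : contractr A \0 _ = 0) ?linear0 ?addr0 //.
  by apply: (tensor_ext (h := \0)) => x y; rewrite contractrE scale0r.
- move=> n t; rewrite cot_bdeg evE; apply: tdeg_contractr.
  + exact: (bdeg_lin hA).
  + exact: (bdeg_zero hA).
  + by move=> p x; apply: aug_eval_deg.
Qed.


Lemma face_first_deg M n t : lcpx M -> bdeg (A □ M) n t -> bdeg M n (p0 M t).
Proof.
move=> hM; rewrite cot_bdeg face_firstE; apply: tdeg_contractl.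
- exact: (lcpx_lin hM).
- exact: (lcpx_zero hM).
- by move=> p x; apply: aug_eval_deg.
Qed.

Lemma face_first_dif M t : lcpx M -> p0 M (bdif (A □ M) t) = bdif M (p0 M t).
Proof.
move=> hM; rewrite !face_firstE cotval_bdif // linearD !contractl_tmap.
rewrite (lin_ext (f := e ∘ bdif A) (g := \0) (aug_eval_dif eps)) (lin_ext (f := e ∘ bsgn A) (g := e) (aug_eval_bsgn eps)).
rewrite [X in X + _](_ : _ = 0) ?add0r //.
by apply: (tensor_ext (h := \0)) => x y; rewrite contractlE scale0r.
Qed.

Lemma face_first_cotr M N (f : {linear M -> N}) t : lcolin M N f ->
  p0 N (L f t) = f (p0 M t).
Proof. by move=> hf; rewrite !face_firstE cotval_cotr // contractl_tmapr. Qed.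

Lemma face_first_unit_first M m : lcpx M -> p0 M (unit_first A M m) = m.
Proof.
move=> hM; rewrite face_firstE cotval_unit_first // contractl_tmap.
rewrite (lin_ext (f := e ∘ one) (g := counit S) (aug_eval_one eps)); exact: (lcpx_counit hM).
Qed.

Lemma face_first_mul M t : p0 M (face_mul A M t) = p0 M (p0 (A □ M) t).
Proof.
apply: funct_ext => s; rewrite !functional_face_first ev_face_mul aug_eval_mul.
by rewrite -(face_first_cotr _ (ev_lcolin hA s)) functional_face_first.
Qed.

Lemma mul_cotr_ev t : mul (L (ev A e) t) = ev A e (face_mul A A t).
Proof. by rewrite ev_face_mul. Qed.

Lemma ev_cotr_mul t : ev A e (L (ev A e) t) = ev A e (L mul t).
Proof.
rewrite ev_cotr; last exact: ev_lcolin.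
rewrite ev_cotr; last exact: mul_lcolin.
by rewrite (lin_ext (f := e ∘ mul) (g := e ∘ ev A e) (aug_eval_mul eps)).
Qed.

Lemma aug_r_mul t : aug_r eps (mul t) = aug_r eps (p0 A t).
Proof.
apply: (funct_ext (U := S)) => s; rewrite !functional_aug_r -mul_rcolin aug_eval_mul.
rewrite -[RHS]/((e ∘ ract A s) (p0 A t)) functional_face_first.
by congr (e _); rewrite !evE cotval_ract // contractr_tmap.
Qed.

Lemma aug_l_mul t : aug_l eps (mul t) = aug_l eps (ev A e t).
Proof.
apply: (funct_ext (U := S)) => s; rewrite !functional_aug_l -mul_lcolin aug_eval_mul.
by rewrite ev_lcolin.
Qed.

(** An element x ⊗ y is sent to e(x_0) e(y) x_1 on the left and to e(x) e(y_0) y_(-1)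
    on the right; these agree by the equation of the cotensor product. *)
Lemma aug_r_ev t : aug_r eps (ev A e t) = aug_l eps (p0 A t).
Proof.
apply: (funct_ext (U := S)) => s; rewrite functional_aug_r functional_aug_l.
rewrite -[RHS]/((e ∘ lact A s) (p0 A t)) functional_face_first; congr (e _).
by rewrite !evE -contractr_tmapl cotvalP contractr_tmap.
Qed.

Lemma ev_unit_first_aug x : ev A e (unit_first A A x) = one (aug_l eps x).
Proof. by rewrite ev_unit_first // aug_lE. Qed.

Lemma face_first_unit_last x : p0 A (unit_last A x) = one (aug_r eps x).
Proof. by rewrite face_firstE cotval_unit_last contractl_tmapr aug_rE. Qed.

Lemma ev_unit_last_aug x : ev A e (unit_last A x) = x.
Proof.
rewrite ev_unit_last (lin_ext (f := e ∘ one) (g := counit S) (aug_eval_one eps)).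
by rewrite /ract lcompE (bright1 hA).
Qed.

Lemma aug_r_one s : aug_r eps (one s) = s.
Proof.
apply: (funct_ext (U := S)) => r; rewrite functional_aug_r -one_rcolin aug_eval_one.
exact: counit_ract.
Qed.

Lemma aug_l_one s : aug_l eps (one s) = s.
Proof.
apply: (funct_ext (U := S)) => r; rewrite functional_aug_l -one_lcolin aug_eval_one.
exact: counit_lact.
Qed.

Lemma lcpx_cotpow n : lcpx (cotpow A n).
Proof. by elim: n => [|n IHn] //=; apply: lcpx_cotensor. Qed.

Lemma lcpx_bar n : lcpx (bar A n).
Proof. by case: n => [|n]; [apply: lcpx_unit|apply: lcpx_cotpow]. Qed.

Lemma face_nextS n i t : face_next eps n.+1 i.+1 t = L (face_next eps n i) t.
Proof. by []. Qed.

Lemma face_next_last i t : face_next eps 0 i.+1 t = ev A e t.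
Proof. exact: face_lastE. Qed.

Lemma lhom_face_next n i : lhom (face_next eps n i).
Proof.
elim: n i => [|n IHn] [|i].
- exact: lhom_mul.
- have -> : face_next eps 0 i.+1 = ev A e by apply: lin_ext => t; apply: face_next_last.
  exact: lhom_ev_aug.
- apply: lhom_face_mul; exact: lcpx_cotpow.
- by apply: cotr_lhom; [exact: hA|exact: lcpx_cotpow n.+1|exact: lcpx_cotpow|exact: IHn].
Qed.

Let face_next_lcolin n i := lhom_lin (lhom_face_next n i).

(** The degeneracy number i of x_1 ⊗ ... ⊗ x_(n+1) inserts the unit between x_i and
    x_(i+1). *)
Fixpoint degen_pow (n i : nat) : {linear cotpow A n -> cotpow A n.+1} :=
  match n return {linear cotpow A n -> cotpow A n.+1} with
  | 0 => if i is 0 then unit_first A A else unit_last A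
  | n'.+1 => if i is i'.+1 then cotr A (degen_pow n' i') else unit_first A (cotpow A n'.+1)
  end.

Definition degen (n i : nat) : {linear bar A n -> bar A n.+1} :=
  match n return {linear bar A n -> bar A n.+1} with
  | 0 => one
  | n'.+1 => degen_pow n' i
  end.

Lemma lhom_degen_pow n i : lhom (degen_pow n i).
Proof.
elim: n i => [|n IHn] [|i].
- exact: lhom_unit_first.
- exact: lhom_unit_last.
- by apply: lhom_unit_first; apply: lcpx_cotpow n.+1.
- by apply: cotr_lhom; [exact: hA|exact: lcpx_cotpow|exact: lcpx_cotpow n.+1|exact: IHn].
Qed.

Let degen_pow_lcolin n i := lhom_lin (lhom_degen_pow n i).

Lemma degen_pow0 n t : degen_pow n 0 t = unit_first A (cotpow A n) t.
Proof. by case: n t. Qed.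

Lemma degen_powS n i t : degen_pow n.+1 i.+1 t = L (degen_pow n i) t.
Proof. by []. Qed.

Lemma face_dif n i t : face eps n i (bdif (bar A n.+1) t) = bdif (bar A n) (face eps n i t).
Proof.
case: n i t => [|n] [|i] t.
- have -> : bdif (bar A 0) (face eps 0 0 t) = 0 by [].
  apply: (funct_ext (U := S)) => s; rewrite functional_aug_r linear0.
  by rewrite -(bright_rcolin (bright_dif hA)) aug_eval_dif.
- have -> : bdif (bar A 0) (face eps 0 i.+1 t) = 0 by [].
  apply: (funct_ext (U := S)) => s; rewrite functional_aug_l linear0.
  by rewrite -(lcpx_dif lA) aug_eval_dif.
- by apply: face_first_dif; apply: lcpx_cotpow.
- exact: (lhom_dif (lhom_face_next n i)).
Qed.

Lemma face_deg n i p t : bdeg (bar A n.+1) p t -> bdeg (bar A n) p (face eps n i t).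
Proof.
case: n i t => [|n] [|i] t ht.
- have [->|/eqP pnz] := eqVneq p 0; first by left.
  right; apply: (funct_ext (U := S)) => s; rewrite functional_aug_r linear0.
  exact: (aug_eval_deg eps pnz (ract_deg hA s ht)).
- have [->|/eqP pnz] := eqVneq p 0; first by left.
  right; apply: (funct_ext (U := S)) => s; rewrite functional_aug_l linear0.
  exact: (aug_eval_deg eps pnz (lact_deg hA s ht)).
- by apply: face_first_deg ht; apply: lcpx_cotpow.
- exact: (lhom_deg (lhom_face_next n i)).
Qed.

Lemma degen_dif n i t : degen n i (bdif (bar A n) t) = bdif (bar A n.+1) (degen n i t).
Proof.
by case: n t => [|n] t; [apply: (lhom_dif (lhom_one A))|apply: (lhom_dif (lhom_degen_pow n i))].
Qed.

Lemma degen_deg n i p t : bdeg (bar A n) p t -> bdeg (bar A n.+1) p (degen n i t).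
Proof.
by case: n t => [|n] t; [apply: (lhom_deg (lhom_one A))|apply: (lhom_deg (lhom_degen_pow n i))].
Qed.

Lemma cotr_one_aug_l t : L (one ∘ aug_l eps) t = unit_last A (ev A e t).
Proof.
apply: ev_sep => s; rewrite ev_unit_last ev_cotr.
  rewrite !evE -contractr_tmapl cotvalP contractr_tmap; congr (contractr _ _ _).
  by apply: lin_ext => x; apply: (functional_aug_l eps (s ∘ one)).
by apply: lcolin_comp aug_l_lcolin _; apply: one_lcolin.
Qed.

Lemma face_next_comm n i j t : (i <= j)%N ->
  face_next eps n i (face_next eps n.+1 j.+1 t) = face_next eps n j (face_next eps n.+1 i t).
Proof.
elim: n i j t => [|n IHn] [|i] [|j] t // ij.
- exact/esym/dga_mulA.
- rewrite face_next_last face_nextS -mul_cotr_ev; congr (mul _).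
  by apply: cotr_ext => x; apply: face_next_last.
- rewrite !face_next_last !face_nextS.
  rewrite (cotr_ext (g := ev A e) _ (face_next_last _)).
  case: i ij => [|i] _; first exact: ev_cotr_mul.
  by rewrite (cotr_ext (g := ev A e) _ (face_next_last _)).
- exact: face_mul_assoc.
- rewrite face_nextS (cotr_ext (g := L (face_next eps n j))) //.
  exact: face_mul_cotr.
- rewrite !face_nextS !cotr_comp //; apply: cotr_ext => x; exact: IHn.
Qed.

Lemma face_comm n i j t : (i <= j)%N ->
  face eps n i (face eps n.+1 j.+1 t) = face eps n j (face eps n.+1 i t).
Proof.
case: n i j t => [|n] [|i] [|j] t // ij.
- exact: aug_r_mul.
- by rewrite [face eps 1 _ _]face_next_last; apply: aug_r_ev.
- rewrite [face eps 1 j.+2 _]face_next_last.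
  case: i ij => [|i] _; first exact/esym/aug_l_mul.
  by rewrite [face eps 1 i.+2 _]face_next_last.
- exact: face_first_mul.
- exact: (face_first_cotr t (@face_next_lcolin n j)).
- exact: face_next_comm.
Qed.

Lemma face_next_degen_lt n i j t : (i <= j)%N -> (j <= n)%N ->
  face_next eps n.+1 i (degen_pow n.+1 j.+2 t) = degen_pow n j.+1 (face_next eps n i t).
Proof.
elim: n i j t => [|n IHn] [|i] [|j] t // ij jn.
- exact: face_mul_cotr_unit_last.
- exact: (face_mul_cotr t (@degen_pow_lcolin n 0)).
- exact: (face_mul_cotr t (@degen_pow_lcolin n j.+1)).
- rewrite face_nextS !degen_powS face_nextS !cotr_comp //; apply: cotr_ext => x.
  exact: IHn.
Qed.

Lemma face_degen_lt n i j t : (i <= j)%N -> (j <= n)%N ->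
  face eps n.+1 i (degen n.+1 j.+1 t) = degen n j (face eps n i t).
Proof.
case: n i j t => [|n] [|i] [|j] t // ij jn.
- exact: face_first_unit_last.
- exact: (face_first_cotr t (@degen_pow_lcolin n 0)).
- exact: (face_first_cotr t (@degen_pow_lcolin n j.+1)).
- exact: face_next_degen_lt.
Qed.

Lemma face_next_degen_id n j t : (j <= n)%N ->
  face_next eps n j (degen_pow n j.+1 t) = t.
Proof.
elim: n j t => [|n IHn] [|j] t // jn.
- exact: mul_unit_last.
- rewrite degen_powS (cotr_ext (g := unit_first A (cotpow A n))); last exact: degen_pow0.
  by apply: face_mul_cotr_unit_first; apply: lcpx_cotpow.
- rewrite degen_powS face_nextS cotr_comp // -[RHS](cotr_id t); apply: cotr_ext => x.
  exact: IHn.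
Qed.

Lemma face_degen_id n j t : (j <= n)%N -> face eps n j (degen n j t) = t.
Proof.
case: n j t => [|n] [|j] t // jn.
- exact: aug_r_one.
- rewrite [degen _ _ _]degen_pow0; apply: face_first_unit_first; exact: lcpx_cotpow.
- exact: face_next_degen_id.
Qed.

Lemma face_next_degen_idS n j t : (j <= n.+1)%N ->
  face_next eps n j (degen_pow n j t) = t.
Proof.
elim: n j t => [|n IHn] [|j] t // jn.
- exact: mul_unit_first.
- case: j jn => // _; rewrite face_next_last; exact: ev_unit_last_aug.
- by apply: face_mul_unit_first; apply: lcpx_cotpow.
- rewrite degen_powS face_nextS cotr_comp // -[RHS](cotr_id t); apply: cotr_ext => x.
  exact: IHn.
Qed.

Lemma face_degen_idS n j t : (j <= n)%N -> face eps n j.+1 (degen n j t) = t.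
Proof.
case: n j t => [|n] j t jn; last exact: face_next_degen_idS.
by case: j jn => // _; apply: aug_l_one.
Qed.

Lemma face_next_degen_gt n i j t : (j <= i)%N -> (i <= n.+1)%N ->
  face_next eps n.+1 i.+1 (degen_pow n.+1 j t) = degen_pow n j (face_next eps n i t).
Proof.
elim: n i j t => [|n IHn] i j t ji i_n.
all: case: j ji => [|j] ji.
- rewrite !degen_pow0 face_nextS; apply: cotr_unit_first => //; exact: (lcpx_cotpow 1).
- have -> : i = 1%N by apply/eqP; rewrite eqn_leq i_n (leq_ltn_trans _ ji).
  have -> : j = 0%N by apply/eqP; rewrite -leqn0 -ltnS (leq_trans ji).
  rewrite face_nextS degen_powS cotr_comp // face_next_last -[RHS]cotr_one_aug_l.
  by apply: cotr_ext => x; rewrite lcompE face_next_last; apply: ev_unit_first_aug.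
- rewrite !degen_pow0 face_nextS; apply: cotr_unit_first => //; [exact: (lcpx_cotpow n.+2)|exact: (lcpx_cotpow n.+1)].
- case: i ji i_n => // i ji i_n.
  rewrite degen_powS !face_nextS degen_powS !cotr_comp //; apply: cotr_ext => x.
  exact: IHn.
Qed.

Lemma face_degen_gt n i j t : (j < i)%N -> (i <= n.+1)%N ->
  face eps n.+1 i.+1 (degen n.+1 j t) = degen n j (face eps n i t).
Proof.
case: n i j t => [|n] [|i] j t // ji i_n; last exact: face_next_degen_gt.
have -> : i = 0%N by apply/eqP; rewrite -leqn0.
have -> : j = 0%N by apply/eqP; rewrite -leqn0 -ltnS (leq_trans ji).
by rewrite [LHS]face_next_last; apply: ev_unit_first_aug.
Qed.

End BarSimplicial.

(** * Simplicial vector spaces and strictly increasing sequences *)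

Section Sums.
Context {k : fieldType}.

Lemma laltE (U W : lmodType k) n (f : nat -> {linear U -> W}) x :
  lalt n f x = \sum_(0 <= i < n.+1) (-1) ^+ i *: f i x.
Proof.
elim: n => [|n IHn]; first by rewrite big_nat1 scale1r.
by rewrite big_nat_recr //= IHn.
Qed.

(** The terms below the diagonal cancel against those on and above it. *)
Lemma alt_double_sum (W : lmodType k) N (F : nat -> nat -> W) :
  (forall i j, (i <= j < N)%N -> F i j.+1 = F j i) ->
  \sum_(0 <= i < N) (-1) ^+ i *: (\sum_(0 <= j < N.+1) (-1) ^+ j *: F i j) = 0.
Proof.
move=> FE; pose G i j := ((-1) ^+ (i + j) : k) *: F i j.
transitivity (\sum_(0 <= i < N) (\sum_(0 <= j < N | (j <= i)%N) G i j -
    \sum_(0 <= j < N | (i <= j)%N) G j i)).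
  rewrite big_nat [RHS]big_nat; apply: eq_bigr => i /andP[_ iN].
  rewrite scaler_sumr (big_cat_nat (n := i.+1)) //= ?ltnS ?(ltnW iN) //.
  congr (_ + _).
    rewrite (big_nat_widen _ _ _ _ _ iN); apply: eq_big => [j|j _]; first by rewrite ltnS.
    by rewrite scalerA -exprD.
  rewrite big_add1 /= -sumrN (big_nat_widenl _ 0) //.
  rewrite big_nat_cond [RHS]big_nat_cond; apply: eq_bigr => j /andP[/andP[_ jN] /= ij].
  by rewrite FE ?ij // scalerA -exprD addnS exprS mulN1r scaleNr addnC.
rewrite sumrB; apply/eqP; rewrite subr_eq0; apply/eqP.
by rewrite [RHS](exchange_big_dep xpredT).
Qed.

End Sums.

Section Omit.
Implicit Types s : seq int.

Lemma omit_cat i s1 s2 : omit i (s1 ++ s2) =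
  if (i < size s1)%N then omit i s1 ++ s2 else s1 ++ omit (i - size s1) s2.
Proof.
rewrite /omit take_cat drop_cat; case: ltnP => i1.
  case: ltnP => i2; first by rewrite catA.
  rewrite [drop _ s1]drop_oversize // cats0.
  by rewrite (_ : _ - _ = 0)%N ?drop0 //; apply/eqP; rewrite subn_eq0.
by rewrite ltnNge (leqW i1) /= subSn // catA.
Qed.

Lemma size_omit i s : (i < size s)%N -> size (omit i s) = (size s).-1.
Proof.
move=> hi; rewrite size_cat size_take size_drop hi subnS -subn1 -subn1.
by rewrite addnBA ?subnKC // ?subn_gt0 // ltnW.
Qed.

Lemma nth_omit i s j : nth 0 (omit i s) j = nth 0 s (if (j < i)%N then j else j.+1).
Proof.
rewrite nth_cat size_take; case: (ltnP i (size s)) => hi.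
  case: ltnP => ji; first by rewrite nth_take.
  by rewrite nth_drop addSn subnKC.
rewrite take_oversize // drop_oversize ?leqW // nth_nil.
case: ltnP => js; first by rewrite (leq_trans js hi).
by case: ltnP => _; rewrite nth_default // leqW.
Qed.

Lemma omit_omit i j s : (i <= j)%N -> (j.+1 < size s)%N ->
  omit i (omit j.+1 s) = omit j (omit i s).
Proof.
move=> ij js; have hi : (i < size s)%N by apply: leq_ltn_trans ij (ltnW js).
have h1 : size (omit j.+1 s) = (size s).-1 by apply: size_omit.
have h2 : size (omit i s) = (size s).-1 by apply: size_omit.
have js' : (j < (size s).-1)%N by rewrite -ltnS prednK // (leq_ltn_trans _ js).
apply: (@eq_from_nth _ 0) => [|l _].
  by rewrite !size_omit ?h1 ?h2 // (leq_ltn_trans ij).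
rewrite !nth_omit; congr (nth _ _ _).
case: (ltnP l i) => li; case: (ltnP l j) => lj.
- by rewrite ltnS (ltnW lj) li.
- by have := leq_ltn_trans lj (leq_trans li ij); rewrite ltnn.
- by rewrite ltnS lj ltnNge li.
- by rewrite ltnS ltnNge lj /= ltnNge (leqW li).
Qed.

Lemma drop_omit_le i n s : (i <= n)%N -> (i < size s)%N ->
  drop n (omit i s) = drop n.+1 s.
Proof.
move=> hi his; rewrite drop_cat size_take his ltnNge hi /= drop_drop.
by rewrite addnS subnK.
Qed.

Lemma drop_omit_gt i n s : (n < i)%N -> (i < size s)%N ->
  drop n (omit i s) = omit (i - n) (drop n s).
Proof.
move=> hn his; rewrite drop_cat size_take his hn /omit drop_drop.
rewrite take_drop subnK ?(ltnW hn) //; congr (_ ++ drop _ _).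
by rewrite addSn subnK // ltnW.
Qed.

End Omit.

Section SimplicialSpace.
Context {k : fieldType}.

(** The faces and degeneracies of a simplicial object in complexes of graded vector
    spaces, with the identities in which a face is applied last. *)
Record simplicial := Simplicial {
  sx :> nat -> lmodType k;
  sface : forall n, nat -> {linear sx n.+1 -> sx n};
  sdegen : forall n, nat -> {linear sx n -> sx n.+1};
  sdif : forall n, {linear sx n -> sx n};
  sdeg : forall n, int -> sx n -> Prop;
  sface_face : forall n i j x, (i <= j)%N -> (j <= n.+1)%N ->
    sface n i (sface n.+1 j.+1 x) = sface n j (sface n.+1 i x);
  sface_degen_lt : forall n i j x, (i <= j)%N -> (j <= n)%N ->
    sface n.+1 i (sdegen n.+1 j.+1 x) = sdegen n j (sface n i x);
  sface_degen_id : forall n j x, (j <= n)%N -> sface n j (sdegen n j x) = x;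
  sface_degen_idS : forall n j x, (j <= n)%N -> sface n j.+1 (sdegen n j x) = x;
  sface_degen_gt : forall n i j x, (j < i)%N -> (i <= n.+1)%N ->
    sface n.+1 i.+1 (sdegen n.+1 j x) = sdegen n j (sface n i x);
  sface_dif : forall n i x, sface n i (sdif n.+1 x) = sdif n (sface n i x);
  sdegen_dif : forall n i x, sdegen n i (sdif n x) = sdif n.+1 (sdegen n i x);
  sdif_sq : forall n x, sdif n (sdif n x) = 0;
  sdif_deg : forall n p x, sdeg p x -> sdeg (p + 1) (sdif n x);
  sface_deg : forall n i p x, sdeg p x -> sdeg p (sface n i x);
  sdegen_deg : forall n i p x, sdeg p x -> sdeg p (sdegen n i x);
  sdeg_lin : forall n p a (x y : sx n), sdeg p x -> sdeg p y -> sdeg p (a *: x + y);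
  sdeg_zero : forall n p, sdeg p (0 : sx n)
}.

Variable X : simplicial.
Local Notation d := (sface X).
Local Notation s := (sdegen X).

Definition scx : dcx := Dcx (fun n => lalt n.+1 (d n)) (sdif X) (@sdeg X).

Definition seq_car n : lmodType k := dsum (fun _ : incseq n => X n).

Definition seq_out n : {linear seq_car n.+1 -> seq_car n} :=
  dlift (fun a : incseq n.+1 =>
    lalt n.+1 (fun i => din _ (inc_omit (inord i) a) ∘ d n i)).

Definition seq_cx : dcx := Dcx (dcx_car := seq_car) seq_out
  (fun n => dmap (fun _ : incseq n => sdif X n))
  (fun n p (x : dsum (fun _ : incseq n => X n)) => forall a, sdeg p (x a)).

Definition forget n : {linear seq_cx n -> scx n} := dlift (fun _ : incseq n => lid (X n)).

(** Indexing the copies of [X n] by arbitrary lists, with value zero for those that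
    are no strictly increasing sequences of the right length, keeps proofs of
    monotonicity out of the formulas. *)
Definition place n (q : seq int) : {linear X n -> seq_car n} :=
  if insub q is Some a then din (fun _ : incseq n => X n) a else \0.

Lemma placeE n (a : incseq n) : place n a = din (fun _ : incseq n => X n) a.
Proof. by rewrite /place valK. Qed.

Lemma place_incseq n q (hq : incseq_pred n q) x :
  place n q x = din (fun _ : incseq n => X n) (Incseq hq) x.
Proof. by rewrite -[q]/(inc_seq (Incseq hq)) placeE. Qed.

Lemma out_place n q x : incseq_pred n.+1 q ->
  seq_out n (place n.+1 q x) = \sum_(0 <= i < n.+2) (-1) ^+ i *: place n (omit i q) (d n i x).
Proof.
move=> hq; rewrite (place_incseq hq) dliftE laltE.
rewrite big_nat [RHS]big_nat; apply: eq_bigr => i /andP[_ hi].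
rewrite lcompE -placeE; congr (_ *: place n _ _).
by rewrite /= inordK.
Qed.

Lemma forget_place n q x : incseq_pred n q -> forget n (place n q x) = x.
Proof. by move=> hq; rewrite (place_incseq hq) [LHS]dliftE. Qed.

Lemma in_place n q x : dcx_in seq_cx n (place n q x) = place n q (sdif X n x).
Proof.
rewrite /place; case: insub => [a|]; last by rewrite linear0.
by rewrite [LHS]dliftE.
Qed.

Lemma place_deg n q p x : sdeg p x -> dcx_deg (d := seq_cx) p (place n q x).
Proof.
move=> hx a /=; rewrite /place; case: insub => [b|]; last exact: sdeg_zero.
have [<-|ba] := pselect (b = a); first by rewrite din_id.
by rewrite din_ne //; apply: sdeg_zero.
Qed.

(** The projection 1 - s_j d_j kills the image of s_j and takes values in the
    kernel of d_j; in degrees at most j there is nothing to do. *)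
Definition norm_step j n : {linear X n -> X n} :=
  match n return {linear X n -> X n} with
  | 0 => lid (X 0%N)
  | n'.+1 => if (j <= n')%N then ladd (lid _) (lscale (-1) (s n' j ∘ d n' j)) else lid _
  end.

(** The first [j] of the steps whose composite projects onto the chains that are
    killed by all the faces but the last. *)
Fixpoint norm_proj j n : {linear X n -> X n} :=
  if j is j'.+1 then norm_step j' n ∘ norm_proj j' n else lid _.

Lemma norm_step_le j n x : (j <= n)%N -> norm_step j n.+1 x = x - s n j (d n j x).
Proof. by move=> jn; rewrite /norm_step jn laddE lscaleE scaleN1r. Qed.

Lemma norm_step_gt j n x : (n <= j)%N -> norm_step j n x = x.
Proof. by case: n x => //= n x nj; rewrite leqNgt nj. Qed.

Lemma norm_projS j n x : norm_proj j.+1 n x = norm_step j n (norm_proj j n x).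
Proof. by []. Qed.

Lemma norm_step_face i j n x : (j.+1 < i)%N -> (i <= n.+1)%N ->
  norm_step j n (d n i x) = d n i (norm_step j n.+1 x).
Proof.
case: i => // i; rewrite !ltnS => ji i_n; case: n x i_n => [|n] x i_n.
  by have := leq_trans ji i_n; rewrite ltn0.
have jn : (j <= n)%N by rewrite -ltnS (leq_trans ji i_n).
rewrite !norm_step_le ?(leqW jn) // linearB sface_degen_gt //.
by rewrite sface_face ?(ltnW ji).
Qed.

Lemma norm_proj_face i j n x : (j < i)%N -> (i <= n.+1)%N ->
  norm_proj j n (d n i x) = d n i (norm_proj j n.+1 x).
Proof.
elim: j x => // j IHj x ji i_n.
by rewrite !norm_projS IHj ?(ltnW ji) // norm_step_face.
Qed.

Lemma face_norm_proj0 i j n x : (i < j)%N -> (j <= n.+1)%N ->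
  d n i (norm_proj j n.+1 x) = 0.
Proof.
elim: j => // j IHj; rewrite !ltnS => ij jn.
rewrite norm_projS norm_step_le // linearB.
move: ij; rewrite leq_eqVlt => /predU1P[->|ij].
  by rewrite sface_degen_id // subrr.
rewrite IHj ?(leqW jn) // sub0r; case: j ij jn IHj => // j ij jn IHj.
case: n x jn IHj => // n x jn IHj.
rewrite sface_degen_lt // sface_face //; last exact: ltnW.
by rewrite IHj ?(leqW jn) // linear0 linear0 oppr0.
Qed.

(** Since the first j faces vanish on the image of [norm_proj j], the right hand side
    is the alternating sum of the faces up to number j after the projection: on this
    part of the boundary, projecting before and after has the same effect. *)
Lemma norm_proj_alt j n x : (j <= n.+1)%N ->
  \sum_(0 <= i < j.+1) (-1) ^+ i *: norm_proj j n (d n i x) =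
  (-1) ^+ j *: d n j (norm_proj j n.+1 x).
Proof.
elim: j => [|j IHj] jn; first by rewrite big_nat1.
rewrite big_nat_recr // norm_projS.
transitivity (norm_step j n ((-1) ^+ j *: (d n j (norm_proj j n.+1 x) -
    d n j.+1 (norm_proj j n.+1 x)))).
  rewrite scalerBr linearB -IHj ?(ltnW jn) // linear_sum; congr (_ + _).
    by apply: eq_bigr => i _; rewrite linearZ_LR.
  by rewrite norm_proj_face // exprS mulN1r scaleNr linearZ_LR.
rewrite linearZ_LR norm_projS norm_step_le // [d n j.+1 (_ - _)]linearB sface_degen_idS // exprS mulN1r scaleNr -scalerN opprB.
congr (_ *: _); case: n x jn {IHj} => // n x jn.
have [jn'|jn'] := leqP j n; last by rewrite norm_step_gt.
by rewrite norm_step_le // [d n j (_ - _)]linearB sface_face // subrr linear0 subr0.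
Qed.

Lemma norm_step_dif j n x : norm_step j n (sdif X n x) = sdif X n (norm_step j n x).
Proof.
case: n x => // n x; have [jn|jn] := leqP j n; last by rewrite !norm_step_gt.
by rewrite !norm_step_le // linearB sface_dif sdegen_dif.
Qed.

Lemma norm_proj_dif j n x : norm_proj j n (sdif X n x) = sdif X n (norm_proj j n x).
Proof. by elim: j => // j IHj; rewrite !norm_projS IHj norm_step_dif. Qed.

Lemma norm_proj_deg j n p x : sdeg p x -> sdeg p (norm_proj j n x).
Proof.
move=> hx; elim: j => // j IHj; rewrite norm_projS; move: (norm_proj j n x) IHj => {hx} x.
case: n x => // n x hx; have [jn|jn] := leqP j n; last by rewrite norm_step_gt.
rewrite norm_step_le // -scaleN1r addrC; apply: sdeg_lin => //.
by apply: sdegen_deg; apply: sface_deg.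
Qed.

Lemma forget_out n (x : seq_cx n.+1) :
  forget n (seq_out n x) = lalt n.+1 (d n) (forget n.+1 x).
Proof.
apply: (dsum_lin_ext (f := forget n ∘ seq_out n) (g := lalt n.+1 (d n) ∘ forget n.+1)) x.
move=> a x; have hq : incseq_pred n.+1 a by case: a.
rewrite !lcompE -placeE forget_place // out_place // laltE linear_sum.
rewrite big_nat [RHS]big_nat; apply: eq_bigr => i /andP[_ hi].
rewrite linearZ_LR forget_place //.
by have := omit_subproof (inord i) a; rewrite inordK.
Qed.

Lemma forget_in n (x : seq_cx n) : forget n (dcx_in seq_cx n x) = sdif X n (forget n x).
Proof.
apply: (dsum_lin_ext (f := forget n ∘ dcx_in seq_cx n) (g := sdif X n ∘ forget n)) x.
move=> a x; have hq : incseq_pred n a by case: a.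
by rewrite !lcompE -placeE in_place !forget_place.
Qed.

Lemma out_out n x : lalt n.+1 (d n) (lalt n.+2 (d n.+1) x) = 0.
Proof.
rewrite laltE; under eq_bigr => i _ do rewrite laltE linear_sum.
transitivity (\sum_(0 <= i < n.+2) (-1) ^+ i *:
    (\sum_(0 <= j < n.+3) (-1) ^+ j *: d n i (d n.+1 j x))).
  by apply: eq_bigr => i _; congr (_ *: _); apply: eq_bigr => j _; rewrite linearZ_LR.
by apply: alt_double_sum => i j /andP[ij jn]; apply: sface_face.
Qed.

Lemma seq_out_out n (x : seq_cx n.+2) : seq_out n (seq_out n.+1 x) = 0.
Proof.
apply: (dsum_lin_ext (f := seq_out n ∘ seq_out n.+1) (g := \0)) x => a x.
have hq : incseq_pred n.+2 a by case: a.
rewrite lcompE -placeE out_place // linear_sum.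
have /andP[/eqP sz _] := hq.
pose F i j := place n (omit i (omit j a)) (d n i (d n.+1 j x)).
have hF i j : (i <= j < n.+2)%N -> F i j.+1 = F j i.
  by move=> /andP[ij jn]; rewrite /F omit_omit ?sz // sface_face.
rewrite -[RHS](alt_double_sum hF).
transitivity (\sum_(0 <= j < n.+3) \sum_(0 <= i < n.+2) (-1) ^+ i *: ((-1) ^+ j *: F i j)).
  rewrite big_nat [RHS]big_nat; apply: eq_bigr => j /andP[_ jn].
  have hj : incseq_pred n.+1 (omit j a).
    by have := omit_subproof (inord j) a; rewrite inordK.
  rewrite linearZ_LR out_place // scaler_sumr; apply: eq_bigr => i _.
  by rewrite !scalerA mulrC.
by rewrite exchange_big_nat; apply: eq_bigr => i _; rewrite scaler_sumr.
Qed.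

Lemma seq_deg_add n p (x y : seq_cx n) : dcx_deg (d := seq_cx) p x ->
  dcx_deg (d := seq_cx) p y -> dcx_deg (d := seq_cx) p (x + y).
Proof. by move=> hx hy a; rewrite dsumD -[_ a]scale1r; apply: sdeg_lin. Qed.

Lemma seq_deg_scale n p c (x : seq_cx n) : dcx_deg (d := seq_cx) p x ->
  dcx_deg (d := seq_cx) p (c *: x).
Proof.
by move=> hx a; rewrite dsumZ -[_ *: _]addr0; apply: sdeg_lin => //; apply: sdeg_zero.
Qed.

Lemma dlift_ind_deg n (W : lmodType k) (P : W -> Prop)
    (f : forall a : incseq n, {linear X n -> W}) p (x : seq_cx n) :
  P 0 -> (forall y z, P y -> P z -> P (y + z)) ->
  dcx_deg (d := seq_cx) p x -> (forall a y, sdeg p y -> P (f a y)) -> P (dlift f x).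
Proof.
move=> P0 PD hx hf; have [u uu hu] := dsum_finite (x : dsum _).
rewrite (dlift_sumE f uu hu); elim/big_ind: _ => // a _.
exact/hf/hx.
Qed.

Lemma scx_is_dcx : is_dcx scx.
Proof.
split.
- exact: out_out.
- exact: sdif_sq.
- move=> n x; rewrite -[LHS]/(lalt n.+1 (d n) (sdif X n.+1 x)).
  rewrite -[RHS]/(sdif X n (lalt n.+1 (d n) x)) !laltE linear_sum; apply: eq_bigr => i _.
  by rewrite linearZ_LR sface_dif.
- move=> n p x hx; rewrite -[dcx_out _ _ _]/(lalt n.+1 (d n) x) laltE.
  elim/big_ind: _ => [|y z hy hz|i _].
  + exact: sdeg_zero.
  + by rewrite -[y]scale1r; apply: sdeg_lin.
  + rewrite -[_ *: _]addr0; apply: sdeg_lin; last exact: sdeg_zero.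
    exact: sface_deg.
- exact: sdif_deg.
Qed.

Lemma seq_cx_is_dcx : is_dcx seq_cx.
Proof.
split.
- exact: seq_out_out.
- move=> n x; apply: (dsum_lin_ext (f := dcx_in seq_cx n ∘ dcx_in seq_cx n) (g := \0)) x.
  by move=> a x; rewrite lcompE -placeE !in_place sdif_sq linear0.
- move=> n x; apply: (dsum_lin_ext (f := seq_out n ∘ dcx_in seq_cx n.+1)
    (g := dcx_in seq_cx n ∘ seq_out n)) x => a x.
  have hq : incseq_pred n.+1 a by case: a.
  rewrite !lcompE -placeE in_place !out_place // linear_sum; apply: eq_bigr => i _.
  by rewrite linearZ_LR in_place sface_dif.
- move=> n p x hx; apply: dlift_ind_deg hx _ => [a|y z|a y hy].
  + exact: sdeg_zero.
  + exact: seq_deg_add.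
  + rewrite laltE; elim/big_ind: _ => [b|u v|i _].
    * exact: sdeg_zero.
    * exact: seq_deg_add.
    * apply: seq_deg_scale; rewrite lcompE -placeE; apply: place_deg; exact: sface_deg.
- move=> n p x hx; apply: dlift_ind_deg hx _ => [a|y z|a y hy].
  + exact: sdeg_zero.
  + exact: seq_deg_add.
  + by rewrite lcompE -placeE; apply: place_deg; apply: sdif_deg.
Qed.

Lemma forget_is_dcx_hom : is_dcx_hom forget.
Proof.
split; [exact: forget_out|exact: forget_in|move=> n p x hx].
apply: dlift_ind_deg hx _ => [|y z hy hz|a y //]; first exact: sdeg_zero.
by rewrite -[y]scale1r; apply: sdeg_lin.
Qed.

(** * Replacing a sequence by an interval below it *)

Section Pushing.
Variable M : int.

Definition run n : seq int := mkseq (fun i => M + i%:Z) n.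

(** The entries of a sequence are replaced by M, M + 1, ... from the left; the
    interpolating sequence [insert j q] has both [push j q] and [push j.+1 q] among
    its faces. *)
Definition push j (q : seq int) := run j ++ drop j q.
Definition insert j (q : seq int) := run j.+1 ++ drop j q.

Definition above n (q : seq int) := incseq_pred n q && all (fun z => M < z) q.

Lemma size_run n : size (run n) = n.
Proof. exact: size_mkseq. Qed.

Lemma above_nth n q i : above n q -> (i <= n)%N -> M + i%:Z < nth 0 q i.
Proof.
move=> /andP[/andP[/eqP sz /(sortedP 0) srt] /(all_nthP 0) hM].
elim: i => [|i IHi] i_n; first by rewrite addr0; apply: hM; rewrite sz.
apply: (@Order.POrderTheory.le_lt_trans _ _ (nth 0 q i)); last by apply: srt; rewrite sz.
by rewrite -addn1 PoszD addrA lezD1 IHi // ltnW.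
Qed.

Lemma incseq_insert n j q : above n q -> (j <= n)%N -> incseq_pred n.+1 (insert j q).
Proof.
move=> hq jn; have /andP[/andP[/eqP sz /(sortedP 0) srt] _] := hq.
apply/andP; split.
  by rewrite size_cat size_run size_drop sz addSn subnKC // (leqW jn).
apply/(sortedP 0) => i; rewrite size_cat size_run size_drop sz addSn subnKC ?(leqW jn) //.
rewrite ltnS => i_n; rewrite !nth_cat !size_run !nth_drop ltnS.
case: (ltnP i j) => ij.
  rewrite (ltnW ij) ltnS ij !nth_mkseq ?ltnS ?(ltnW ij) //.
  by rewrite Num.Theory.ltrD2l ltz_nat.
rewrite ltnS ltnNge ij /= subSS; case: (leqP i j) => ij'.
  have -> : i = j by apply/eqP; rewrite eqn_leq ij ij'.
  by rewrite nth_mkseq // subnn addn0; apply: (above_nth hq).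
case: i i_n ij ij' => // i i_n ij ij'; rewrite subSS !subnKC //.
by apply: srt; rewrite sz.
Qed.

Lemma omit_insert_eq n j q : size q = n.+1 -> omit j (insert j q) = push j q.
Proof.
move=> sz; rewrite omit_cat size_run ltnSn; congr (_ ++ _).
rewrite /omit /run /mkseq -map_take -map_drop take_iota drop_iota minnC.
by rewrite (minn_idPr (leqnSn j)) subnn cats0.
Qed.

Lemma omit_insert_eqS n j q : size q = n.+1 -> (j <= n)%N ->
  omit j.+1 (insert j q) = push j.+1 q.
Proof.
move=> sz jn; rewrite omit_cat size_run ltnn subnn; congr (_ ++ _).
by rewrite /omit take0 drop_drop.
Qed.

Lemma omit_insert_gt n i j q : size q = n.+1 -> (j < i)%N -> (i <= n)%N ->
  omit i.+1 (insert j q) = insert j (omit i q).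
Proof.
move=> sz ji i_n; rewrite omit_cat size_run ltnS ltnNge (ltnW ji) /= subSS.
by rewrite /insert drop_omit_gt // sz.
Qed.

Lemma insert_omit_le n i j q : size q = n.+1 -> (i <= j)%N -> (j <= n)%N ->
  insert j (omit i q) = push j.+1 q.
Proof.
by move=> sz ij jn; rewrite /insert drop_omit_le // sz ltnS (leq_trans ij).
Qed.

Lemma omit_run n : omit n (run n.+1) = run n.
Proof.
rewrite /omit /run /mkseq -map_take -map_drop take_iota drop_iota minnC.
by rewrite (minn_idPr (leqnSn n)) subnn cats0.
Qed.

Lemma incseq_run n : incseq_pred n (run n.+1).
Proof.
apply/andP; split; first by rewrite size_run.
apply/(sortedP 0) => i.
rewrite size_run ltnS => i_n; rewrite !nth_mkseq ?ltnS ?(ltnW i_n) //.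
by rewrite Num.Theory.ltrD2l ltz_nat.
Qed.

Lemma push0 q : push 0 q = q.
Proof. by rewrite /push drop0. Qed.

Lemma push_all n q : size q = n -> push n q = run n.
Proof. by move=> sz; rewrite /push drop_oversize ?cats0 // sz. Qed.

Lemma above_omit n i q : above n.+1 q -> (i <= n.+1)%N -> above n (omit i q).
Proof.
move=> /andP[hq hM] i_n; apply/andP; split.
  have := omit_subproof (inord i) (Incseq hq).
  by rewrite inordK.
apply/allP => z; rewrite mem_cat => /orP[/mem_take|/mem_drop]; exact: (allP hM).
Qed.

(** Each replacement of an entry is a homotopy, given by a degeneracy, between a chain
    and its image under the next step of the projection onto normalized chains. *)
Definition homotopy n : {linear seq_cx n -> seq_cx n.+1} :=
  dlift (fun a : incseq n =>
    lalt n (fun j => place n.+1 (insert j a) ∘ (s n j ∘ norm_proj j n))).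

Definition homotopy_forget n : {linear scx n -> scx n.+1} :=
  lalt n (fun j => s n j ∘ norm_proj j n).

(** The right hand end of the homotopy; it is independent of the initial sequence. *)
Definition section_run n : {linear scx n -> seq_cx n} :=
  place n (run n.+1) ∘ norm_proj n n.

Lemma homotopy_place n q x : incseq_pred n q -> homotopy n (place n q x) =
  \sum_(0 <= j < n.+1) (-1) ^+ j *: place n.+1 (insert j q) (s n j (norm_proj j n x)).
Proof. by move=> hq; rewrite (place_incseq hq) dliftE laltE. Qed.

Lemma homotopy_forgetE n x : homotopy_forget n x =
  \sum_(0 <= j < n.+1) (-1) ^+ j *: s n j (norm_proj j n x).
Proof. exact: laltE. Qed.

Lemma section_runE n x : section_run n x = place n (run n.+1) (norm_proj n n x).
Proof. by []. Qed.

Lemma out_insert0 (q : seq int) x : above 0 q ->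
  seq_out 0 (homotopy 0 (place 0 q x)) = place 0 q x - section_run 0 x.
Proof.
move=> hq; have /andP[hq' _] := hq; have /andP[/eqP sz _] := hq'.
rewrite homotopy_place // big_nat1 scale1r out_place ?incseq_insert //.
rewrite big_nat_recl // big_nat1 /= scale1r (omit_insert_eq _ sz) push0.
by rewrite (omit_insert_eqS sz) // push_all // sface_degen_id // sface_degen_idS // expr1 scaleN1r.
Qed.

(** Of the boundary of the j-th summand, the faces before j vanish on normalized
    chains, the faces j and j + 1 will telescope, and the others will cancel against
    the homotopy of the boundary. *)
Lemma out_insertS n j (q : seq int) (x : X n.+1) : above n.+1 q -> (j <= n.+1)%N ->
  seq_out n.+1 (place n.+2 (insert j q) (s n.+1 j (norm_proj j n.+1 x))) =
  (-1) ^+ j *: (place n.+1 (push j q) (norm_proj j n.+1 x) -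
                place n.+1 (push j.+1 q) (norm_proj j n.+1 x)) -
  \sum_(j.+1 <= i < n.+2) (-1) ^+ i *:
     place n.+1 (insert j (omit i q)) (s n j (norm_proj j n (d n i x))).
Proof.
move=> hq jn; have /andP[hq' _] := hq; have /andP[/eqP sz _] := hq'.
rewrite out_place ?incseq_insert // (big_cat_nat (n := j)) ?(leqW (leqW jn)) //=.
rewrite big_nat big1 ?add0r => [|i /andP[_ ij]]; last first.
  case: j ij jn => // j ij jn; rewrite sface_degen_lt // face_norm_proj0 //.
  by rewrite !linear0.
rewrite big_ltn ?ltnS ?(leqW jn) // big_ltn ?ltnS // addrA; congr (_ + _).
  rewrite (omit_insert_eq _ sz) sface_degen_id // (omit_insert_eqS sz) // sface_degen_idS //.
  by rewrite exprS mulN1r scaleNr scalerBr.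
rewrite big_add1 -sumrN big_nat [RHS]big_nat; apply: eq_bigr => i /andP[ji i_n].
rewrite (omit_insert_gt sz) // sface_degen_gt // norm_proj_face //.
by rewrite exprS mulN1r scaleNr.
Qed.

Lemma homotopy_out n (q : seq int) (x : X n.+1) : above n.+1 q ->
  homotopy n (seq_out n (place n.+1 q x)) =
  \sum_(0 <= j < n.+1) (-1) ^+ j *:
    ((-1) ^+ j *: place n.+1 (push j.+1 q) (s n j (d n j (norm_proj j n.+1 x))) +
     \sum_(j.+1 <= i < n.+2) (-1) ^+ i *:
        place n.+1 (insert j (omit i q)) (s n j (norm_proj j n (d n i x)))).
Proof.
move=> hq; have /andP[hq' _] := hq; have /andP[/eqP sz _] := hq'.
rewrite out_place // linear_sum.
transitivity (\sum_(0 <= i < n.+2) \sum_(0 <= j < n.+1) (-1) ^+ i *: ((-1) ^+ j *: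
    place n.+1 (insert j (omit i q)) (s n j (norm_proj j n (d n i x))))).
  rewrite big_nat [RHS]big_nat; apply: eq_bigr => i /andP[_ i_n].
  have /andP[hi _] := above_omit hq i_n.
  by rewrite linearZ_LR homotopy_place // scaler_sumr.
rewrite exchange_big_nat big_nat [RHS]big_nat; apply: eq_bigr => j /andP[_ jn].
transitivity ((-1) ^+ j *: \sum_(0 <= i < n.+2) (-1) ^+ i *:
    place n.+1 (insert j (omit i q)) (s n j (norm_proj j n (d n i x)))).
  by rewrite scaler_sumr; apply: eq_bigr => i _; rewrite !scalerA mulrC.
congr (_ *: _); rewrite (big_cat_nat (n := j.+1)) ?ltnS ?(ltnW jn) //=; congr (_ + _).
rewrite -(linearZ_LR (place n.+1 _)) -(linearZ_LR (s n j)) -norm_proj_alt; last exact: ltnW.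
rewrite !linear_sum big_nat [RHS]big_nat; apply: eq_bigr => i /andP[_ ij].
by rewrite (insert_omit_le sz) ?linearZ_LR // ltnW.
Qed.

Lemma homotopy_identity n (q : seq int) (x : X n.+1) : above n.+1 q ->
  seq_out n.+1 (homotopy n.+1 (place n.+1 q x)) + homotopy n (seq_out n (place n.+1 q x)) =
  place n.+1 q x - section_run n.+1 x.
Proof.
move=> hq; have /andP[hq' _] := hq; have /andP[/eqP sz _] := hq'.
pose T j := place n.+1 (push j q) (norm_proj j n.+1 x).
have -> : place n.+1 q x - section_run n.+1 x = T 0%N - T n.+2.
  rewrite /T push0 push_all // norm_projS norm_step_gt //.
rewrite homotopy_place // linear_sum big_nat_recr //= homotopy_out // addrAC -big_split /=.
transitivity (\sum_(0 <= j < n.+1) (T j - T j.+1) + (T n.+1 - T n.+2)).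
  congr (_ + _); last first.
    rewrite linearZ_LR out_insertS // big_geq // subr0 scalerA -expr2 sqrr_sign scale1r.
    by rewrite /T [norm_proj n.+2 _ _]norm_projS norm_step_gt.
  rewrite big_nat [RHS]big_nat; apply: eq_bigr => j /andP[_ jn].
  rewrite linearZ_LR out_insertS ?(ltnW jn) //.
  rewrite -scalerDr addrA addrAC addrNK -scalerDr scalerA -expr2 sqrr_sign scale1r.
  rewrite /T norm_projS norm_step_le // [place _ _ (_ - _)]linearB.
  by rewrite opprB addrA addrAC.
have tel N : \sum_(0 <= j < N) (T j - T j.+1) = T 0%N - T N.
  elim: N => [|N IHN]; first by rewrite big_nil subrr.
  by rewrite big_nat_recr //= IHN addrA subrK.
by rewrite tel addrA subrK.
Qed.

Lemma section_run_out n (x : X n.+1) :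
  seq_out n (section_run n.+1 x) = section_run n (lalt n.+1 (d n) x).
Proof.
rewrite !section_runE out_place ?incseq_run // big_nat_recr // omit_run.
rewrite big_nat big1 => [|i /andP[_ i_n]]; last first.
  by rewrite face_norm_proj0 // linear0 scaler0.
rewrite [LHS]add0r -linearZ_LR -norm_proj_alt // laltE !linear_sum; apply: eq_bigr => i _.
by rewrite norm_projS norm_step_gt // !linearZ_LR.
Qed.

Lemma section_run_dif n x : section_run n (sdif X n x) = dcx_in seq_cx n (section_run n x).
Proof. by rewrite !section_runE norm_proj_dif [RHS]in_place. Qed.

Lemma homotopy_dif n (x : seq_cx n) :
  homotopy n (dcx_in seq_cx n x) = dcx_in seq_cx n.+1 (homotopy n x).
Proof.
apply: (dsum_lin_ext (f := homotopy n ∘ dcx_in seq_cx n)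
  (g := dcx_in seq_cx n.+1 ∘ homotopy n)) x => a x.
have hq : incseq_pred n a by case: a.
rewrite !lcompE -placeE in_place !homotopy_place // linear_sum; apply: eq_bigr => j _.
by rewrite linearZ_LR in_place norm_proj_dif sdegen_dif.
Qed.

Lemma homotopy_forget_dif n x :
  homotopy_forget n (sdif X n x) = sdif X n.+1 (homotopy_forget n x).
Proof.
rewrite !homotopy_forgetE linear_sum; apply: eq_bigr => j _.
by rewrite linearZ_LR norm_proj_dif sdegen_dif.
Qed.

Lemma homotopy_forget_deg n p x : sdeg p x -> sdeg p (homotopy_forget n x).
Proof.
move=> hx; rewrite homotopy_forgetE; elim/big_ind: _ => [|y z hy hz|j _].
- exact: sdeg_zero.
- by rewrite -[y]scale1r; apply: sdeg_lin.
- rewrite -[_ *: _]addr0; apply: sdeg_lin; last exact: sdeg_zero.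
  by apply: sdegen_deg; apply: norm_proj_deg.
Qed.

Lemma section_run_deg n p x : sdeg p x -> dcx_deg (d := seq_cx) p (section_run n x).
Proof. by move=> hx; rewrite section_runE; apply: place_deg; apply: norm_proj_deg. Qed.

Lemma homotopy_deg n p (x : seq_cx n) :
  dcx_deg (d := seq_cx) p x -> dcx_deg (d := seq_cx) p (homotopy n x).
Proof.
move=> hx; apply: dlift_ind_deg hx _ => [a|y z|a y hy].
- exact: sdeg_zero.
- exact: seq_deg_add.
- rewrite laltE; elim/big_ind: _ => [b|u v|j _].
  + exact: sdeg_zero.
  + exact: seq_deg_add.
  + apply: seq_deg_scale; apply: place_deg; apply: sdegen_deg; exact: norm_proj_deg.
Qed.

Lemma forget_homotopy n q x : above n q ->
  forget n.+1 (homotopy n (place n q x)) = homotopy_forget n x.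
Proof.
move=> hq; have /andP[hq' _] := hq.
rewrite homotopy_place // homotopy_forgetE linear_sum big_nat [RHS]big_nat.
apply: eq_bigr => j /andP[_ jn].
by rewrite linearZ_LR forget_place //; apply: incseq_insert hq _.
Qed.

End Pushing.

(** * Total complexes *)

Lemma tot_dif0 (Z : @dcx k) (z : Z 0%N) : tot_dif Z (din Z 0%N z) = din Z 0%N (dcx_in Z 0%N z).
Proof. by rewrite /tot_dif dliftE laddE [LHS]add0r lcompE lscaleE scale1r. Qed.

Lemma tot_difS (Z : @dcx k) n (z : Z n.+1) : tot_dif Z (din Z n.+1 z) =
  din Z n (dcx_out Z n z) + (-1) ^+ n.+1 *: din Z n.+1 (dcx_in Z n.+1 z).
Proof. by rewrite /tot_dif dliftE laddE (lcompE (din Z n.+1)) lscaleE linearZ_LR. Qed.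

Lemma tot_map_din (Z Z' : @dcx k) (f : forall n, {linear Z n -> Z' n}) n z :
  tot_map f (din Z n z) = din Z' n (f n z).
Proof. by rewrite /tot_map /dmap dliftE. Qed.

Lemma tot_map_proj (Z Z' : @dcx k) (f : forall n, {linear Z n -> Z' n}) (z : tot Z) n :
  (tot_map f z : dsum _) n = f n ((z : dsum _) n).
Proof.
pose pr (Y : @dcx k) := mklin (@dproj_linear _ _ (dcx_car Y) n).
apply: (dsum_lin_ext (f := pr Z' ∘ tot_map f) (g := f n ∘ pr Z)) z => j z.
rewrite !lcompE tot_map_din -[LHS]/(din Z' j (f j z) n) -[pr Z _]/(din Z j z n).
have [e|ne] := pselect (j = n); last by rewrite !din_ne // linear0.
by case: _ / e; rewrite !din_id.
Qed.

Lemma tot_map_dif (Z Z' : @dcx k) (f : forall n, {linear Z n -> Z' n}) (z : tot Z) :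
  (forall n x, f n (dcx_out Z n x) = dcx_out Z' n (f n.+1 x)) ->
  (forall n x, f n (dcx_in Z n x) = dcx_in Z' n (f n x)) ->
  tot_map f (tot_dif Z z) = tot_dif Z' (tot_map f z).
Proof.
move=> fo fi.
apply: (dsum_lin_ext (f := tot_map f ∘ tot_dif Z) (g := tot_dif Z' ∘ tot_map f)) z => -[|n] z.
  by rewrite !lcompE tot_dif0 !tot_map_din tot_dif0 fi.
by rewrite !lcompE tot_difS linearD linearZ_LR !tot_map_din tot_difS fi fo.
Qed.

Definition tot_shift (Z : @dcx k) (h : forall n, {linear Z n -> Z n.+1}) : {linear tot Z -> tot Z} :=
  dlift (fun n => din Z n.+1 ∘ h n).

Lemma tot_shift_din (Z : @dcx k) (h : forall n, {linear Z n -> Z n.+1}) n z :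
  tot_shift h (din Z n z) = din Z n.+1 (h n z).
Proof. by rewrite /tot_shift dliftE. Qed.

Lemma tot_shift_proj0 (Z : @dcx k) (h : forall n, {linear Z n -> Z n.+1}) (z : tot Z) :
  (tot_shift h z : dsum _) 0%N = 0.
Proof.
pose pr := mklin (@dproj_linear _ _ (dcx_car Z) 0%N).
apply: (dsum_lin_ext (f := pr ∘ tot_shift h) (g := \0)) z => j z.
by rewrite lcompE tot_shift_din -[LHS]/(din Z j.+1 (h j z) 0%N) din_ne.
Qed.

Lemma tot_shift_projS (Z : @dcx k) (h : forall n, {linear Z n -> Z n.+1}) (z : tot Z) n :
  (tot_shift h z : dsum _) n.+1 = h n ((z : dsum _) n).
Proof.
pose pr j := mklin (@dproj_linear _ _ (dcx_car Z) j).
apply: (dsum_lin_ext (f := pr n.+1 ∘ tot_shift h) (g := h n ∘ pr n)) z => j z.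
rewrite !lcompE tot_shift_din -[LHS]/(din Z j.+1 (h j z) n.+1) -[pr n _]/(din Z j z n).
have [e|ne] := pselect (j = n); last by rewrite !din_ne ?linear0 // => -[].
by case: _ / e; rewrite !din_id.
Qed.

Lemma tot_shift_deg (Z : @dcx k) (h : forall n, {linear Z n -> Z n.+1}) m (z : tot Z) :
  (forall p, dcx_deg (d := Z) p (0 : Z 0%N)) ->
  (forall n p x, dcx_deg (d := Z) p x -> dcx_deg (d := Z) p (h n x)) ->
  tot_deg m z -> tot_deg (m - 1) (tot_shift h z).
Proof.
move=> h0 hdeg hz [|n]; first by rewrite tot_shift_proj0.
rewrite tot_shift_projS; apply: hdeg.
by rewrite -addn1 PoszD [n%:Z + 1]addrC addrA subrK.
Qed.

Lemma tot_map_deg (Z Z' : @dcx k) (f : forall n, {linear Z n -> Z' n}) m (z : tot Z) :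
  (forall n p x, dcx_deg (d := Z) p x -> dcx_deg (d := Z') p (f n x)) ->
  tot_deg m z -> tot_deg m (tot_map f z).
Proof. by move=> hf hz n; rewrite tot_map_proj; apply: hf. Qed.

(** A homotopy in the outer direction that commutes with the inner differential
    is a homotopy of total complexes, because the inner differential enters the
    total one with a sign that alternates with the outer degree. *)
Lemma tot_shift_homotopy0 (Z : @dcx k) (h : forall n, {linear Z n -> Z n.+1}) (z : Z 0%N) :
  (forall n x, h n (dcx_in Z n x) = dcx_in Z n.+1 (h n x)) ->
  tot_dif Z (tot_shift h (din Z 0%N z)) + tot_shift h (tot_dif Z (din Z 0%N z)) =
  din Z 0%N (dcx_out Z 0%N (h 0%N z)).
Proof.
move=> hi; rewrite tot_dif0 !tot_shift_din tot_difS hi -addrA.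
by rewrite expr1 scaleN1r addNr addr0.
Qed.

Lemma tot_shift_homotopyS (Z : @dcx k) (h : forall n, {linear Z n -> Z n.+1}) n (z : Z n.+1) :
  (forall n x, h n (dcx_in Z n x) = dcx_in Z n.+1 (h n x)) ->
  tot_dif Z (tot_shift h (din Z n.+1 z)) + tot_shift h (tot_dif Z (din Z n.+1 z)) =
  din Z n.+1 (dcx_out Z n.+1 (h n.+1 z) + h n (dcx_out Z n z)).
Proof.
move=> hi; rewrite tot_shift_din !tot_difS linearD linearZ_LR !tot_shift_din hi.
rewrite exprS mulN1r scaleNr [din Z n.+1 (_ + _)]linearD addrACA -[RHS]addr0; congr (_ + _).
by rewrite addNr.
Qed.

Definition seq_above M (z : tot seq_cx) : Prop :=
  forall n a, ((z : dsum _) n : dsum _) a != 0 -> above M n a.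

Lemma seq_above_ext M (W : lmodType k) (f g : {linear tot seq_cx -> W}) z :
  seq_above M z ->
  (forall n q x, above M n q -> f (din seq_cx n (place n q x)) = g (din seq_cx n (place n q x))) ->
  f z = g z.
Proof.
move=> hz h; have [t ut ht] := dsum_finite (z : dsum seq_cx).
rewrite (dsum_sum ut ht) !linear_sum; apply: eq_bigr => n _.
have [r ur hr] := dsum_finite ((z : dsum seq_cx) n : dsum (fun _ : incseq n => X n)).
rewrite [X in din _ n X](dsum_sum ur hr) !linear_sum; apply: eq_bigr => a _.
rewrite -placeE; have [->|/hz] := eqVneq (((z : dsum seq_cx) n : dsum _) a) 0.
  by rewrite !linear0.
exact: h.
Qed.

Lemma lower_bound_seq (q : seq int) : exists M : int, all (fun z => M < z) q.
Proof.
elim: q => [|z q [M hM]]; first by exists 0.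
have [h|h] := Order.TotalTheory.leP M (z - 1).
  by exists M; rewrite /= hM andbT -lezD1 -Num.Theory.lerBrDr.
exists (z - 1); rewrite /= -lezD1 subrK Order.POrderTheory.lexx.
apply/allP => y /(allP hM); exact: Order.POrderTheory.lt_trans.
Qed.

Lemma seq_above_exists (z : tot seq_cx) : exists M, seq_above M z.
Proof.
have [t _ ht] := dsum_finite (z : dsum seq_cx).
have [r hr] : exists r : seq int, forall n, n \in t -> forall a : incseq n,
    ((z : dsum seq_cx) n : dsum (fun _ : incseq n => X n)) a != 0 -> {subset (a : seq int) <= r}.
  elim: t {ht} => [|n t [r hr]]; first by exists [::].
  have [u _ hu] := dsum_finite ((z : dsum seq_cx) n : dsum (fun _ : incseq n => X n)).
  exists (flatten [seq (a : seq int) | a : incseq n <- u] ++ r) => j.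
  rewrite inE => /predU1P[->|jt] a za y ya; rewrite mem_cat; last by rewrite (hr j jt a) ?orbT.
  by apply/orP; left; apply/flattenP; exists (a : seq int) => //; apply: map_f; apply: hu.
have [M hM] := lower_bound_seq r; exists M => n a za; apply/andP; split; first by case: a za.
apply/allP => y ya; apply: (allP hM); apply: hr ya; last exact: za.
apply: ht; apply: contraNneq za => z0; apply/eqP.
by move: (congr1 (fun x : dsum (fun _ : incseq n => X n) => x a) z0).
Qed.

Section PushedHomotopy.
Variable M : int.

Let K := tot_shift (homotopy M).
Let T := tot_map (X := scx) (Y := seq_cx) (section_run M).

Lemma seq_homotopy (z : tot seq_cx) : seq_above M z ->
  tot_dif seq_cx (K z) + K (tot_dif seq_cx z) = z - T (tot_map forget z).
Proof.
move=> hz.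
apply: (seq_above_ext (f := ladd (tot_dif seq_cx ∘ K) (K ∘ tot_dif seq_cx))
  (g := ladd (lid _) (lscale (-1) (T ∘ tot_map forget))) hz) => n q x hq.
have /andP[hq' _] := hq.
rewrite !laddE lscaleE !lcompE tot_map_din forget_place // [T _]tot_map_din scaleN1r.
case: n q x hq hq' => [|n] q x hq hq'.
  rewrite tot_shift_homotopy0; last exact: homotopy_dif.
  apply: (etrans (congr1 (din seq_cx 0%N) (out_insert0 x hq))); exact: linearB.
rewrite tot_shift_homotopyS; last exact: homotopy_dif.
apply: (etrans (congr1 (din seq_cx n.+1) (homotopy_identity x hq))); exact: linearB.
Qed.

Let K' := tot_shift (Z := scx) homotopy_forget.

Lemma above_run n : above M n (run (M + 1) n.+1).
Proof.
apply/andP; split; first exact: incseq_run.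
apply/allP => z /mapP[i _ ->]; rewrite -lezD1 -[X in X <= _]addr0.
by rewrite Num.Theory.lerD2l.
Qed.

(** Every chain is the image of a chain indexed by a sequence above M, to which
    [seq_homotopy] applies. *)
Lemma scx_homotopy (y : tot scx) :
  tot_dif scx (K' y) + K' (tot_dif scx y) = y - tot_map forget (T y).
Proof.
apply: (dsum_lin_ext (f := ladd (tot_dif scx ∘ K') (K' ∘ tot_dif scx))
  (g := ladd (lid _) (lscale (-1) (tot_map forget ∘ T)))) y => n x.
have hq := above_run n; have /andP[hq' _] := hq.
rewrite !laddE lscaleE !lcompE [T _]tot_map_din tot_map_din scaleN1r.
case: n x hq hq' => [|n] x hq hq'.
  rewrite tot_shift_homotopy0; last exact: homotopy_forget_dif.
  have e : dcx_out scx 0 (homotopy_forget 0 x) = x - forget 0 (section_run M 0 x).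
    have := congr1 (forget 0) (out_insert0 x hq).
    by rewrite linearB forget_out (forget_homotopy x hq) forget_place.
  by apply: (etrans (congr1 (din scx 0%N) e)); apply: linearB.
rewrite tot_shift_homotopyS; last exact: homotopy_forget_dif.
have e : dcx_out scx n.+1 (homotopy_forget n.+1 x) + homotopy_forget n (dcx_out scx n x) =
    x - forget n.+1 (section_run M n.+1 x).
  have := congr1 (forget n.+1) (homotopy_identity x hq).
  rewrite linearB linearD forget_out (forget_homotopy x hq) forget_place // => <-.
  congr (_ + _); rewrite out_place // -[dcx_out scx n x]/(lalt n.+1 (d n) x) laltE.
  rewrite !linear_sum big_nat [RHS]big_nat; apply: eq_bigr => i /andP[_ i_n].
  by rewrite !linearZ_LR (forget_homotopy _ (above_omit hq i_n)).
by apply: (etrans (congr1 (din scx n.+1) e)); apply: linearB.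
Qed.

Lemma section_run_cycle m y : cycle m y -> cycle m (T y).
Proof.
move=> [dy y0]; split; first by apply: tot_map_deg dy => n p x; apply: section_run_deg.
rewrite -tot_map_dif ?y0 ?linear0 //.
- by move=> n x; rewrite [RHS]section_run_out.
- by move=> n x; apply: section_run_dif.
Qed.

Lemma section_run_tot_dif y : T (tot_dif scx y) = tot_dif seq_cx (T y).
Proof.
apply: tot_map_dif => n x; first by rewrite [RHS]section_run_out.
exact: section_run_dif.
Qed.

Lemma pushed_shift_deg m z : tot_deg m z -> tot_deg (m - 1) (K z).
Proof.
apply: tot_shift_deg => [p a|n p x]; first exact: sdeg_zero.
exact: homotopy_deg.
Qed.

Lemma forget_shift_deg m y : tot_deg m y -> tot_deg (m - 1) (K' y).
Proof.
apply: tot_shift_deg => [p|n p x]; first exact: sdeg_zero.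
exact: homotopy_forget_deg.
Qed.

End PushedHomotopy.

Lemma tot_deg_add (Z : @dcx k) m (x y : tot Z) :
  (forall n p (u v : Z n), dcx_deg p u -> dcx_deg p v -> dcx_deg p (u + v)) ->
  tot_deg m x -> tot_deg m y -> tot_deg m (x + y).
Proof. by move=> h hx hy n; rewrite dsumD; apply: h. Qed.

(** A cycle has finite support, hence lies above some M.  It is then homologous to a
    cycle that depends only on its image under [forget].  For surjectivity, the
    section is an inverse up to homotopy, whatever M is. *)
Theorem forget_quasi_iso : quasi_iso forget.
Proof.
move=> m; split=> [x [dx x0] [y dy yx]|y hy].
  have [M hM] := seq_above_exists x.
  pose K := tot_shift (Z := seq_cx) (homotopy M).
  pose T := tot_map (X := scx) (Y := seq_cx) (section_run M).
  exists (K x + T y).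
    apply: tot_deg_add; first by move=> n p u v; apply: seq_deg_add.
      exact: pushed_shift_deg.
    by apply: tot_map_deg dy => n p z; apply: section_run_deg.
  have := seq_homotopy hM; rewrite x0 linear0 addr0 linearD => ->.
  by rewrite -section_run_tot_dif yx subrK.
exists (tot_map (X := scx) (Y := seq_cx) (section_run 0) y); first exact: section_run_cycle.
have [dy y0] := hy; exists (tot_shift (Z := scx) homotopy_forget y).
  exact: forget_shift_deg.
by have := scx_homotopy 0 y; rewrite y0 linear0 addr0.
Qed.

End SimplicialSpace.

Section BarAsSimplicial.
Context {k : fieldType} {S : algGroup k} {I : choiceType} {V : irrSystem S I}.
Variables (A : relDGA S) (eps : relAug V A).

Definition bar_simplicial : simplicial := @Simplicial k
  (fun n => bcar (bar A n)) (face eps) (degen A)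
  (fun n => bdif (bar A n)) (fun n => bdeg (bar A n))
  (fun n i j x ij _ => face_comm eps x ij)
  (fun n i j x => @face_degen_lt _ _ _ _ _ eps n i j x)
  (fun n j x => @face_degen_id _ _ _ _ _ eps n j x)
  (fun n j x => @face_degen_idS _ _ _ _ _ eps n j x)
  (fun n i j x => @face_degen_gt _ _ _ _ _ eps n i j x)
  (fun n i x => face_dif eps i x)
  (fun n i x => degen_dif i x)
  (fun n x => lcpx_dif_sq (lcpx_bar A n) x)
  (fun n p x => @lcpx_dif_deg _ _ _ (lcpx_bar A n) p x)
  (fun n i p x => @face_deg _ _ _ _ _ eps n i p x)
  (fun n i p x => @degen_deg _ _ _ n i p x)
  (fun n p a x y => @lcpx_lin _ _ _ (lcpx_bar A n) p a x y)
  (fun n p => @lcpx_zero _ _ _ (lcpx_bar A n) p).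

End BarAsSimplicial.

Theorem theorem2p9 (k : fieldType) (k_char0 : [pchar k] =i pred0)
    (S : algGroup k) (S_reductive : reductive S) (S_split : split_group S)
    (I : choiceType) (V : irrSystem S I)
    (A : relDGA S) (eps : relAug V A) :
  [/\ is_dcx (Bar_simp eps), is_dcx (Bar eps),
      is_dcx_hom (sigma eps) & quasi_iso (sigma eps)].
Proof.
split.
- exact: (seq_cx_is_dcx (bar_simplicial eps)).
- exact: (scx_is_dcx (bar_simplicial eps)).
- exact: (forget_is_dcx_hom (bar_simplicial eps)).
- exact: (@forget_quasi_iso k (bar_simplicial eps)).
Qed.
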